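(* Let $X$ be a Banach space, fix $p>1$, and let $\mathcal W_X=\langle t\rangle^{-p}L^\infty_t\mathcal B(X)$, a Banach algebra under convolution in $t$ (composition in $\mathcal B(X)$), with unitization $\overline{\mathcal W}_X=\mathcal W_X\oplus\mathbb C\mathbb 1$, $\mathbb 1=\delta_{t=0}I$. Let $T\in\mathcal W_X$ satisfy, for some $N\ge1$, $$ \lim_{\delta\to0}\|T^N-T^N(\cdot-\delta)\|_{\mathcal W_X}=0, $$ where $T^N$ is the $N$-th convolution power. If $I+\widehat T(\lambda)$ is invertible in $\mathcal B(X)$ for every $\lambda\in\mathbb R$, then $\mathbb 1+T$ has an inverse in $\overline{\mathcal W}_X$ of the form $\mathbb 1+S$ with $S\in\mathcal W_X$.
   Context: $\langle t\rangle=(1+t^2)^{1/2}$. $\mathcal W_X$ consists of strongly measurable families $T(t)\in\mathcal B(X)$, $t\in\mathbb R$, with norm $\sup_t\langle t\rangle^p\|T(t)\|_{\mathcal B(X)}$; the product is $(T_1*T_2)(t)=\int_{\mathbb R}T_1(s)T_2(t-s)\,ds$. The Fourier transform is $\widehat T(\lambda)=\int_{\mathbb R}T(t)e^{-it\lambda}\,dt$, and $\widehat{\mathbb 1}=I$. *)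

(* Defs.v *)
From HB Require Import structures.
From mathcomp Require Import all_boot all_order all_algebra.
From mathcomp Require Import all_classical all_reals all_analysis.
From mathcomp Require Export complex.
Export Order.TTheory GRing.Theory Num.Theory.

Set Implicit Arguments.
Unset Strict Implicit.
Unset Printing Implicit Defensive.

Local Open Scope ring_scope.
Local Open Scope classical_set_scope.

Definition nrm (R : realType) (X : normedModType R[i]) (x : X) : R :=
  complex.Re `|x|.

Definition jbr (R : realType) (t : R) : R := Num.sqrt (1 + t ^+ 2).

Definition expmi (R : realType) (t lam : R) : R[i] :=
  (cos (t * lam) -i* sin (t * lam))%C.

Definition is_bounded_op (R : realType) (X : normedModType R[i]) (A : X -> X)
  : Prop :=
  (forall (a : R[i]) (x y : X), A (a *: x + y) = a *: A x + A y) /\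
  exists C : R, forall x, nrm (A x) <= C * nrm x.

Definition simple_fun (R : realType) (X : normedModType R[i]) (n : nat)
  (A : 'I_n -> set R) (v : 'I_n -> X) : R -> X :=
  fun t => \sum_(i < n) (if `[< A i t >] then v i else 0).

Definition simple_int (R : realType) (X : normedModType R[i]) (n : nat)
  (A : 'I_n -> set R) (v : 'I_n -> X) : X :=
  \sum_(i < n) ((fine (lebesgue_measure (A i)))%:C%C *: v i).

Definition admissible (R : realType) (n : nat) (A : 'I_n -> set R) : Prop :=
  forall i, measurable (A i) /\ (lebesgue_measure (A i) < +oo)%E.

Definition strongly_measurable (R : realType) (X : normedModType R[i])
  (f : R -> X) : Prop :=
  exists (n : nat -> nat) (A : forall k, 'I_(n k) -> set R)
         (v : forall k, 'I_(n k) -> X),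
    (forall k, admissible (A k)) /\
    {ae lebesgue_measure, forall t,
       (fun k => simple_fun (A k) (v k) t) @ \oo --> f t}.

(* Bochner integral: [is_bochner f w] means f is Bochner integrable on R
   (w.r.t. Lebesgue measure) and its integral is w. *)
Definition is_bochner (R : realType) (X : normedModType R[i])
  (f : R -> X) (w : X) : Prop :=
  exists (n : nat -> nat) (A : forall k, 'I_(n k) -> set R)
         (v : forall k, 'I_(n k) -> X),
    (forall k, admissible (A k)) /\
    {ae lebesgue_measure, forall t,
       (fun k => simple_fun (A k) (v k) t) @ \oo --> f t} /\
    (fun k => (\int[lebesgue_measure]_t
                 (nrm (simple_fun (A k) (v k) t - f t))%:E)%E)
      @ \oo --> (0 : \bar R) /\
    (fun k => simple_int (A k) (v k)) @ \oo --> w.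

(* Norm of W_X: sup_t <t>^p ||T(t)||_{B(X)} = sup_{t, ||x||<=1} <t>^p ||T(t)x|| *)
Definition Wnorm (R : realType) (X : normedModType R[i]) (p : R)
  (T : R -> X -> X) : \bar R :=
  ereal_sup [set ((jbr tx.1 `^ p * nrm (T tx.1 tx.2))%:E)%E
            | tx in [set tx : R * X | nrm tx.2 <= 1]].

Definition inW (R : realType) (X : normedModType R[i]) (p : R)
  (T : R -> X -> X) : Prop :=
  (forall t, is_bounded_op (T t)) /\
  (forall x, strongly_measurable (fun t => T t x)) /\
  (Wnorm p T < +oo)%E.

Definition is_conv (R : realType) (X : normedModType R[i])
  (T1 T2 U : R -> X -> X) : Prop :=
  forall t x, is_bochner (fun s => T1 s (T2 (t - s) x)) (U t x).

Fixpoint is_convpow (R : realType) (X : normedModType R[i])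
  (T : R -> X -> X) (N : nat) (U : R -> X -> X) : Prop :=
  match N with
  | 0 => False
  | m.+1 => match m with
            | 0 => U = T
            | _.+1 => exists V, is_convpow T m V /\ is_conv V T U
            end
  end.

Definition is_fourier (R : realType) (X : normedModType R[i])
  (T : R -> X -> X) (lam : R) (F : X -> X) : Prop :=
  forall x, is_bochner (fun t => expmi t lam *: T t x) (F x).

Definition invertible_op (R : realType) (X : normedModType R[i]) (A : X -> X)
  : Prop :=
  is_bounded_op A /\
  exists G, is_bounded_op G /\ (forall x, G (A x) = x) /\ (forall x, A (G x) = x).

(* Main.v *)
Require Import Defs.
From HB Require Import structures.
From mathcomp Require Import all_boot all_order all_algebra.
From mathcomp Require Import all_classical all_reals all_analysis.
From mathcomp Require Import complex ring lra measurable_realfun.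
Import Order.TTheory GRing.Theory Num.Theory.
Import numFieldNormedType.Exports.
Set Implicit Arguments.
Unset Strict Implicit.
Unset Printing Implicit Defensive.
Local Open Scope ring_scope.
Local Open Scope classical_set_scope.

(** Write P_{l,w} and M_{l,w} for the scalar kernels exp(ilt - wt) 1_{t >= 0} and
    exp(ilt + wt) 1_{t < 0}; they commute with everything and satisfy resolvent
    identities, in particular P_{l,d} + M_{l,d} = 2d P_{l,d} M_{l,d}.

    Fix l and let F be the Fourier transform of T at l. The kernel T - F P_{l,1} has
    vanishing transform at l, so its product with w P_{l,w} is small in L^1(B(X)) for
    small w, uniformly for l in a compact set. As I + F is invertible, this gives
    1 = B (1 + T) + Y (1 - P_{l,1}), and the resolvent identities turn it into
    P_{l,d} + M_{l,d} = y (1 + T) + O(d) for small d.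

    A Fejer kernel damped by exp(-d|t|) is a positive combination of the
    P_{l,d} + M_{l,d} with |l| <= L and total mass O(L), uniformly in d. By the
    continuity of translations it is an approximate unit for T^N, hence
    T^N = y (1 + T) + small. Since 1 - (-T)^N is a multiple of 1 + T, so is
    1 + small, up to a Neumann series. That series converges in the weighted norm as
    soon as the unweighted L^1 norm is small, so only L^1 estimates are ever needed.
    This is a left inverse of 1 + T; the same argument in the opposite algebra gives a
    right inverse. *)

(** * Deciding identities in commutative groups *)

(** Only t -> T(t)x is strongly measurable, so the norm of T(t) need not be measurable in t. Every
    L^1 bound is therefore carried by a measurable majorant with values in [0, +oo], and identities
    between vector-valued integrals are proved for indicators times vectors, where Tonelli for
    scalars suffices, and extended by density in L^1.

    On the Fourier side, with z = i(lambda - l), the kernels P_{l,w} and M_{l,w} become 1/(w + z)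
    and 1/(w - z), and 1 - P_{l,1} becomes z/(1 + z), which vanishes exactly at lambda = l. For
    P_{l,d} or M_{l,d} alone the argument leaves an error that is bounded but not small; only their
    product 2d P_{l,d} M_{l,d} gains the factor d. This is why both half lines occur.

    The order of choices matters: the approximate unit fixes L and its mass first, compactness of
    [-L, L] then gives constants valid for all l, and d is taken last. The operator F need not
    commute with T, so the two one-sided inverses are separate statements. *)

Inductive zexpr := ZVar of nat | ZZero | ZAdd of zexpr & zexpr | ZOpp of zexpr.

Section ZEval.
Variable V : zmodType.

Fixpoint zeval (env : seq V) (e : zexpr) : V :=
  match e with
  | ZVar n => nth 0 env n
  | ZZero => 0
  | ZAdd a b => zeval env a + zeval env b
  | ZOpp a => - zeval env a
  end.

Fixpoint zcoef (e : zexpr) (n : nat) : int :=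
  match e with
  | ZVar m => (m == n)%:Z
  | ZZero => 0
  | ZAdd a b => zcoef a n + zcoef b n
  | ZOpp a => - zcoef a n
  end.

Lemma zevalE env e :
  zeval env e = \sum_(i < size env) nth 0 env i *~ zcoef e i.
Proof.
elim: e => [n||a IHa b IHb|a IHa] /=.
- case: (ltnP n (size env)) => h.
    rewrite (bigD1 (Ordinal h))//= eqxx mulr1z big1 ?addr0// => i /eqP ni.
    by rewrite (_ : n == i = false)// ?mulr0z//; apply/eqP => e; apply: ni; exact/val_inj.
  rewrite nth_default// big1// => i _.
  by rewrite gtn_eqF ?mulr0z// (leq_trans (ltn_ord i)).
- by rewrite big1.
- by rewrite IHa IHb -big_split; apply: eq_bigr => i _; rewrite mulrzDr.
- by rewrite IHa -sumrN; apply: eq_bigr => i _; rewrite mulrNz.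
Qed.

(** Soundness of [zmod]: both sides are integer combinations of the same atoms, so it is enough to
    compare coefficients, which is done by computation. *)
Lemma zeval_eq env a b :
  all (fun i => zcoef a i == zcoef b i) (iota 0 (size env)) ->
  zeval env a = zeval env b.
Proof.
move=> /allP h; rewrite !zevalE; apply: eq_bigr => i _; congr (_ *~ _).
by apply/eqP/h; rewrite mem_iota add0n ltn_ord.
Qed.
End ZEval.

(* The same operation can occur through different inheritance paths, so atoms
   are compared structurally and not syntactically. *)
Ltac zsame x y :=
  first [ constr_eq x y
        | lazymatch x with
          | @GRing.scale _ _ ?a ?u => lazymatch y with @GRing.scale _ _ ?b ?v =>
              zsame a b; zsame u v end
          | @GRing.mul _ ?a ?u => lazymatch y with @GRing.mul _ ?b ?v =>
              zsame a b; zsame u v end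
          | (?a + ?u)%R => lazymatch y with (?b + ?v)%R => zsame a b; zsame u v end
          | (- ?a)%R => lazymatch y with (- ?b)%R => zsame a b end
          | @GRing.exp _ ?a ?n => lazymatch y with @GRing.exp _ ?b ?m =>
              constr_eq n m; zsame a b end
          | @GRing.one _ => lazymatch y with @GRing.one _ => idtac end
          end ].
Ltac zin x l :=
  lazymatch l with
  | nil => constr:(false)
  | ?h :: ?t => match goal with
     | _ => let _ := match goal with _ => zsame x h end in constr:(true)
     | _ => zin x t
     end
  end.
Ltac zidx x l :=
  lazymatch l with
  | ?h :: ?t => match goal with
     | _ => let _ := match goal with _ => zsame x h end in constr:(0%N)
     | _ => let n := zidx x t in constr:((S n))
     end
  end.
Ltac zatoms t l :=
  lazymatch t with
  | (?a + ?b)%R => let l1 := zatoms a l in zatoms b l1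
  | (- ?a)%R => zatoms a l
  | 0%R => l
  | _ => let b := zin t l in
         lazymatch b with true => l | false => constr:(t :: l) end
  end.
Ltac zreify t l :=
  lazymatch t with
  | (?a + ?b)%R => let x := zreify a l in let y := zreify b l in constr:(ZAdd x y)
  | (- ?a)%R => let x := zreify a l in constr:(ZOpp x)
  | 0%R => constr:(ZZero)
  | _ => let n := zidx t l in constr:(ZVar n)
  end.
Ltac zmod :=
  lazymatch goal with
  | |- @eq ?T ?a ?b =>
    let l0 := constr:(@nil T) in
    let l1 := zatoms a l0 in let l := zatoms b l1 in
    let x := zreify a l in let y := zreify b l in
    change (zeval l x = zeval l y); apply: zeval_eq; vm_compute; reflexivity
  end.

(** * Real-valued norms on a complex normed space *)

Section Nrm.
Context (R : realType) (X : normedModType R[i]).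
Implicit Types (x y : X) (a : R[i]).

(** Norms over [R[i]] take their values in [R[i]]. Passing to the real part loses nothing, since a
    norm is a real element, and lets all estimates live in [R]. *)
Definition cabs a : R := complex.Re `|a|.

Lemma cabsE a : `|a| = (cabs a)%:C%C.
Proof. by rewrite /cabs RRe_real// ger0_real. Qed.

Lemma nrmE x : `|x| = (nrm x)%:C%C.
Proof. by rewrite /nrm RRe_real// ger0_real. Qed.

Lemma nrm_ge0 x : 0 <= nrm x.
Proof. by rewrite -ler0c -nrmE. Qed.

Lemma nrm0 : nrm (0 : X) = 0.
Proof. by rewrite /nrm normr0. Qed.

Lemma nrm_eq0 x : nrm x <= 0 -> x = 0.
Proof.
move=> h; apply/eqP; rewrite -normr_eq0 nrmE.
by have /eqP -> : nrm x == 0 by rewrite eq_le h nrm_ge0.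
Qed.

Lemma nrmD x y : nrm (x + y) <= nrm x + nrm y.
Proof. by rewrite -lecR rmorphD/= -!nrmE ler_normD. Qed.

Lemma nrmN x : nrm (- x) = nrm x.
Proof. by rewrite /nrm normrN. Qed.

Lemma nrmB x y : nrm (x - y) <= nrm x + nrm y.
Proof. by rewrite -(nrmN y) nrmD. Qed.

Lemma nrm_distC x y : nrm (x - y) = nrm (y - x).
Proof. by rewrite -nrmN opprB. Qed.

Lemma nrm_tri z x y : nrm (x - y) <= nrm (x - z) + nrm (z - y).
Proof. by rewrite -[x - y](subrKA z) nrmD. Qed.

Lemma nrm_le_dist x y : nrm x <= nrm y + nrm (x - y).
Proof. by rewrite -{1}[x](subrK y) [leRHS]addrC nrmD. Qed.

Lemma nrmZ a x : nrm (a *: x) = cabs a * nrm x.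
Proof.
by apply: (@complexI R); rewrite rmorphM/= -nrmE -cabsE -nrmE normrZ.
Qed.

Lemma cabsM a b : cabs (a * b) = cabs a * cabs b.
Proof. by apply: (@complexI R); rewrite rmorphM/= -!cabsE normrM. Qed.

Lemma cabsD a b : cabs (a + b) <= cabs a + cabs b.
Proof. by rewrite -lecR rmorphD/= -!cabsE ler_normD. Qed.

Lemma cabs_ge0 a : 0 <= cabs a.
Proof. by rewrite -ler0c -cabsE. Qed.

Lemma cabsR (r : R) : cabs r%:C%C = `|r|.
Proof. by rewrite /cabs normc_def /= expr0n/= addr0 sqrtr_sqr. Qed.

Lemma nrmZr (r : R) x : nrm (r%:C%C *: x) = `|r| * nrm x.
Proof. by rewrite nrmZ cabsR. Qed.

Lemma nrm_cvgP (u : nat -> X) (l : X) :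
  (u @ \oo --> l) <->
  (forall e : R, 0 < e -> exists N, forall n, (N <= n)%N -> nrm (u n - l) < e).
Proof.
split=> [/cvgrPdist_lt h e e0|h].
- have : 0 < e%:C%C :> R[i] by rewrite ltcR.
  move=> /h [N _ hN]; exists N => n Nn.
  by have := hN n Nn; rewrite /= nrmE ltcR nrm_distC.
- apply/cvgrPdist_lt => e e0.
  have er : e = (complex.Re e)%:C%C by rewrite RRe_real// gtr0_real.
  move: e0; rewrite er ltcR => /h [N hN]; exists N => // n /= Nn.
  by rewrite nrmE ltcR nrm_distC hN.
Qed.

End Nrm.

Section Complete.
Context (R : realType) (X : completeNormedModType R[i]).

Lemma nrm_complete (u : nat -> X) :
  (forall e : R, 0 < e -> exists N, forall m n, (N <= m)%N -> (N <= n)%N ->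
     nrm (u m - u n) < e) ->
  exists l : X, u @ \oo --> l.
Proof.
move=> h; suff : [cvg (u @ \oo) in X] by move=> /cvg_ex.
apply: cauchy_cvg; apply/cauchy_ballP => e e0.
have er : e = (complex.Re e)%:C%C by rewrite RRe_real// gtr0_real.
move: e0; rewrite er ltcR => /h [N hN].
exists (u @` [set n | (N <= n)%N], u @` [set n | (N <= n)%N]).
  by split; exists N => // n /= Nn; exists n.
move=> [_ _] /= [[m Nm <-] [n Nn <-]].
by rewrite -ball_normE /= nrmE ltcR hN.
Qed.

End Complete.

(** * Reflections preserve Lebesgue measure *)

Section LebesgueInvariance.
Context (R : realType).
Local Notation mu := (@lebesgue_measure R).
Local Open Scope ereal_scope.

(** The substitution s -> t - s is the one that a convolution needs; translations are later obtained
    as products of two reflections. *)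
Definition refl (a : R) : measurableTypeR R -> measurableTypeR R :=
  fun t => (a - t)%R.

Lemma measurable_refl a : measurable_fun setT (refl a).
Proof. by apply: measurable_funB => //; exact: measurable_id. Qed.

(** Lebesgue measure is determined by half-open intervals; a reflection turns one closed on the
    right into one closed on the left, of the same length. *)
Lemma lebesgue_refl a (A : set R) : measurable A ->
  pushforward mu (refl a) A = mu A.
Proof.
move=> mA; apply/esym/lebesgue_measure_unique => //.
  exact: measurable_refl.
move=> /= mr _ [[b c]] _ <-.
rewrite /pushforward (_ : refl a @^-1` _ = `[(a - c)%R, (a - b)%R[%classic).
  rewrite !lebesgue_measure_itv/= !lte_fin ltrD2l ltrN2.
  by case: ifP => // _; rewrite -!EFinB; congr EFin; ring.
by apply/seteqP; split=> t /=; rewrite !in_itv/= /refl => /andP[? ?];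
  apply/andP; split; lra.
Qed.

Lemma integral_refl a (f : R -> \bar R) : measurable_fun setT f ->
  (forall t, 0 <= f t) -> \int[mu]_t f (a - t)%R = \int[mu]_t f t.
Proof.
move=> mf f0.
transitivity (\int[pushforward mu (refl a)]_t f t).
  by rewrite ge0_integral_pushforward//; exact: measurable_refl.
apply: eq_measure_integral; first exact: measurable_refl.
by move=> mr A mA _; exact: (lebesgue_refl a mA).
Qed.
End LebesgueInvariance.

(** * Bochner integrals as limits of step functions *)

Section LowerIntegral.
Context (R : realType).
Local Notation mu := (@lebesgue_measure R).
Local Open Scope ereal_scope.

(* No measurability is assumed: the integral of a nonnegative function is
   a supremum over the simple functions below it. *)
Lemma le_lower_integral (f g : R -> \bar R) :
  (forall t, 0 <= f t) -> (forall t, f t <= g t) ->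
  \int[mu]_t f t <= \int[mu]_t g t.
Proof.
move=> f0 fg; have g0 t : 0 <= g t by rewrite (le_trans (f0 t)).
rewrite !ge0_integralTE//; apply: le_ereal_sup => _ [h hf <-].
by exists h => // x; rewrite (le_trans (hf x)).
Qed.

Lemma lower_integral_restrict (f : R -> \bar R) (D : set R) :
  (forall t, 0 <= f t) -> \int[mu]_(t in D) f t <= \int[mu]_t f t.
Proof.
move=> f0; rewrite integral_mkcond; apply: le_lower_integral => t.
  by rewrite erestrict_ge0.
by rewrite /patch; case: ifPn.
Qed.
End LowerIntegral.

(** * Step functions and their elementary integrals *)

Section Simple.
Context (R : realType) (X : normedModType R[i]).
Local Notation mu := (@lebesgue_measure R).
Implicit Types (l : seq (set R * X)) (A E : set R) (v w x : X).

(** Step functions are lists of pairs (set, value). The sets may overlap, so that addition is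
    concatenation. *)
Definition sfl l (t : R) : X :=
  \sum_(a <- l) (if `[< a.1 t >] then a.2 else 0).

Definition sil l : X := \sum_(a <- l) ((fine (mu a.1))%:C%C *: a.2).

Definition finm A : Prop := measurable A /\ (mu A < +oo)%E.

Fixpoint adm l : Prop := if l is a :: l' then finm a.1 /\ adm l' else True.

Definition restr E l := [seq (a.1 `&` E, a.2) | a <- l].

Lemma adm_cat l l' : adm l -> adm l' -> adm (l ++ l').
Proof. by elim: l => //= a l IH [ha hl] hl'; split => //; exact: IH. Qed.

Lemma sfl_cat l l' t : sfl (l ++ l') t = sfl l t + sfl l' t.
Proof. by rewrite /sfl big_cat. Qed.

Lemma sil_cat l l' : sil (l ++ l') = sil l + sil l'.
Proof. by rewrite /sil big_cat. Qed.

Definition mapv (F : X -> X) l := [seq (a.1, F a.2) | a <- l].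

Lemma adm_mapv F l : adm l -> adm (mapv F l).
Proof. by elim: l => //= a l IH [? ?]; split => //; exact: IH. Qed.

Lemma sfl_mapv (F : X -> X) l t : F 0 = 0 -> {morph F : x y / x + y} ->
  sfl (mapv F l) t = F (sfl l t).
Proof.
move=> F0 FD; rewrite /sfl big_map.
rewrite (big_morph F FD F0); apply: eq_bigr => a _ /=.
by case: ifP.
Qed.

Lemma sil_mapv (F : X -> X) l : F 0 = 0 -> {morph F : x y / x + y} ->
  (forall (c : R) x, F (c%:C%C *: x) = c%:C%C *: F x) ->
  sil (mapv F l) = F (sil l).
Proof.
move=> F0 FD FZ; rewrite /sil big_map.
by rewrite (big_morph F FD F0); apply: eq_bigr => a _ /=.
Qed.

Lemma finmI A E : finm A -> measurable E -> finm (A `&` E).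
Proof.
move=> [mA fA] mE; split; first exact: measurableI.
by apply: le_lt_trans fA; apply: le_measure; rewrite ?inE//; exact: measurableI.
Qed.

Lemma finmD A E : finm A -> measurable E -> finm (A `\` E).
Proof. by move=> fA mE; rewrite setDE; apply: finmI => //; exact: measurableC. Qed.

Lemma finmU A B : finm A -> finm B -> finm (A `|` B).
Proof.
move=> [mA fA] [mB fB]; split; first exact: measurableU.
by apply: le_lt_trans (measureU2 mu mA mB) _; rewrite lte_add_pinfty.
Qed.

Lemma adm_restr E l : measurable E -> adm l -> adm (restr E l).
Proof.
by move=> mE; elim: l => //= a l IH [? ?]; split; [exact: finmI|exact: IH].
Qed.

Lemma sfl_restr E l t : sfl (restr E l) t = if `[< E t >] then sfl l t else 0.
Proof.
rewrite /sfl big_map /=; case: ifPn => Et.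
  apply: eq_bigr => a _; congr (if _ then _ else _); apply/asboolP/asboolP.
    by case.
  by move: Et => /asboolP.
by rewrite big1// => a _; case: ifPn => // /asboolP [_ /asboolP]; rewrite (negbTE Et).
Qed.

Lemma measurable_nrm_sfl l w : adm l ->
  measurable_fun setT (fun t : R => nrm (sfl l t + w)).
Proof.
elim: l w => [|a l IH] w /=.
  by move=> _; under eq_fun do rewrite /sfl big_nil; exact: measurable_cst.
move=> [[ma _] al].
pose D : set R := a.1.
rewrite (_ : (fun t : R => _) = (fun t => if t \in D then nrm (sfl l t + (a.2 + w))
   else nrm (sfl l t + w))); last first.
  apply/funext => t; rewrite /sfl big_cons; rewrite -[`[< a.1 t >]]/(t \in D); case: ifPn => h.
    by rewrite -addrA addrCA.
  by rewrite add0r.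
apply: measurable_fun_ifT => //; [|exact: IH|exact: IH].
by apply: (measurable_fun_bool true); rewrite setTI (_ : _ @^-1` _ = D)//;
  apply/seteqP; split=> t; [exact: set_mem|exact: mem_set].
Qed.

Lemma fin_mu A : finm A -> (fine (mu A))%:E = mu A.
Proof. by move=> [_ h]; rewrite fineK// ge0_fin_numE. Qed.

Lemma sil_restrU E1 E2 l : adm l -> measurable E1 -> measurable E2 ->
  E1 `&` E2 = set0 ->
  sil (restr (E1 `|` E2) l) = sil (restr E1 l) + sil (restr E2 l).
Proof.
move=> al m1 m2 E12; elim: l al => [|a l IH] /=.
  by rewrite /sil !big_nil addr0.
move=> [fa al]; rewrite /sil !big_cons -!/(sil _) IH//= addrACA; congr (_ + _).
rewrite -scalerDl -rmorphD/=; congr ((_)%:C%C *: _).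
apply: EFin_inj; rewrite EFinD !fin_mu; [|exact: finmI..|]; last first.
  by apply: finmI => //; exact: measurableU.
case: fa => ma _; rewrite setIUr (measureU mu)//; try exact: measurableI.
by rewrite setIACA E12 setI0.
Qed.


Lemma integral_cst_nrm E w : finm E ->
  (\int[mu]_(t in E) (nrm w)%:E)%E = (fine (mu E) * nrm w)%:E.
Proof.
by move=> fE; rewrite integral_cst ?EFinM ?fin_mu 1?muleC//; case: fE.
Qed.

(* Splitting E along the head set turns the claim for [a :: l] into the claim
   for l with two constants; no disjoint representation is needed. *)
Lemma nrm_sil_restr l E w : adm l -> finm E ->
  ((nrm (sil (restr E l) + (fine (mu E))%:C%C *: w))%:E <=
   \int[mu]_(t in E) (nrm (sfl l t + w))%:E)%E.
Proof.
elim: l E w => [|a l IH] E w al fE.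
  rewrite /sil big_nil add0r nrmZr.
  under eq_integral do rewrite /sfl big_nil add0r.
  by rewrite integral_cst_nrm// ger0_norm// fine_ge0.
case: (al) => /= fa al'; case: (fa) => ma _; case: (fE) => mE _.
pose E1 := E `&` a.1; pose E2 := E `\` a.1.
have fE1 : finm E1 by exact: finmI.
have fE2 : finm E2 by exact: finmD.
have EE : E = E1 `|` E2 by rewrite /E1 /E2 setDE -setIUr setUv setIT.
have E0 : E1 `&` E2 = set0.
  by rewrite /E1 /E2 setDE setIACA setICr setI0.
case: (fE1) => mE1 _; case: (fE2) => mE2 _.
have -> : sil (restr E (a :: l)) + (fine (mu E))%:C%C *: w =
   (sil (restr E1 l) + (fine (mu E1))%:C%C *: (a.2 + w)) +
   (sil (restr E2 l) + (fine (mu E2))%:C%C *: w).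
  have muE : fine (mu E) = fine (mu E1) + fine (mu E2).
    apply: EFin_inj; rewrite EFinD !fin_mu//.
    by rewrite {1}EE (measureU mu).
  rewrite /sil big_cons -!/(sil _) /= [in sil (restr E l)]EE sil_restrU//.
  rewrite muE rmorphD/= scalerDl scalerDr setIC -/E1.
  by rewrite addrACA [X in _ = X + _]addrC -!addrA.
rewrite (le_trans (y := ((nrm (sil (restr E1 l) + (fine (mu E1))%:C%C *: (a.2 + w)))%:E +
   (nrm (sil (restr E2 l) + (fine (mu E2))%:C%C *: w))%:E)%E))//.
  by rewrite -EFinD lee_fin nrmD.
rewrite EE ge0_integral_setU//; last 3 first.
- apply/measurable_EFinP; apply: measurable_funTS; exact: measurable_nrm_sfl.
- by move=> t _; rewrite lee_fin nrm_ge0.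
- by rewrite disj_set2E E0.
apply: leeD.
  rewrite (le_trans (IH E1 _ al' fE1))//; rewrite le_eqVlt; apply/orP; left.
  apply/eqP; apply: eq_integral => t /set_mem [_ at1]; rewrite /sfl big_cons asboolT//.
  by rewrite -addrA addrCA.
rewrite (le_trans (IH E2 _ al' fE2))//; rewrite le_eqVlt; apply/orP; left.
apply/eqP; apply: eq_integral => t /set_mem [_ at1]; rewrite /sfl big_cons asboolF//.
by rewrite add0r.
Qed.

Lemma finm0 : finm set0. Proof. by split => //; rewrite measure0. Qed.

Lemma restr_le l E : (forall A, (exists v, List.In (A, v) l) -> A `<=` E) -> restr E l = l.
Proof.
elim: l => //= -[A v] l IH h /=; rewrite IH; last first.
  by move=> B [u ul]; apply: h; exists u; right.
by congr (( _, _) :: _); apply: setIidl; apply: h; exists v; left.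
Qed.

Lemma adm_cover l : adm l ->
  exists E, finm E /\ (forall A, (exists v, List.In (A, v) l) -> A `<=` E).
Proof.
elim: l => [_|[A v] l IH /= [fA /IH [E [fE hE]]]].
  by exists set0; split; [exact: finm0|move=> A []].
exists (A `|` E); split; first exact: finmU.
move=> B [u [[<- _]|ul]]; first exact: subsetUl.
by apply: subset_trans (@subsetUr _ _ _); apply: hE; exists u.
Qed.

(** The inequality on a set E of finite measure, with constant 0, is applied to an E that contains
    all the sets of the list. *)
Lemma nrm_sil l : adm l ->
  ((nrm (sil l))%:E <= \int[mu]_t (nrm (sfl l t))%:E)%E.
Proof.
move=> al; have [E [fE hE]] := adm_cover al.
have := nrm_sil_restr 0 al fE; rewrite restr_le// scaler0 addr0 => h.
rewrite (le_trans h)//; under eq_integral do rewrite addr0.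
by apply: lower_integral_restrict => t; rewrite lee_fin nrm_ge0.
Qed.

End Simple.

(** * Upper L^1 bounds and the integral they define *)

Section UpperL1.
Context (R : realType) (X : normedModType R[i]).
Local Notation mu := (@lebesgue_measure R).
Implicit Types (f g : R -> X) (c : R).

(* A measurable majorant, because the norm of [f] need not be measurable. *)
Definition N1le f c : Prop := exists g : R -> \bar R,
  [/\ measurable_fun setT g, forall t, (0 <= g t)%E,
      forall t, ((nrm (f t))%:E <= g t)%E & (\int[mu]_t g t <= c%:E)%E].

Lemma N1le_ge0 f c : N1le f c -> 0 <= c.
Proof.
move=> [g [_ g0 _ h]]; rewrite -lee_fin; apply: le_trans h.
exact: integral_ge0.
Qed.

Lemma N1leW f c c' : N1le f c -> c <= c' -> N1le f c'.
Proof.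
move=> [g [mg g0 fg h]] cc; exists g; split => //.
by rewrite (le_trans h)// lee_fin.
Qed.

Lemma N1le_dom f g c K : 0 <= K -> (forall t, nrm (f t) <= K * nrm (g t)) ->
  N1le g c -> N1le f (K * c).
Proof.
move=> K0 fg [h [mh h0 gh ih]]; exists (fun t => K%:E * h t)%E; split.
- exact: measurable_funeM.
- by move=> t; rewrite mule_ge0// lee_fin.
- move=> t; rewrite (le_trans (y := (K%:E * (nrm (g t))%:E)%E))//.
    by rewrite -EFinM lee_fin.
  by rewrite lee_wpmul2l ?lee_fin.
- rewrite ge0_integralZl//.
  by rewrite EFinM lee_wpmul2l ?lee_fin.
Qed.

Lemma N1le_le f g c : (forall t, nrm (f t) <= nrm (g t)) ->
  N1le g c -> N1le f c.
Proof. by move=> fg hg; rewrite -[c]mul1r; apply: N1le_dom hg => // t; rewrite mul1r. Qed.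

Lemma N1leD f g a b : N1le f a -> N1le g b -> N1le (fun t => f t + g t) (a + b).
Proof.
move=> [f' [mf f0 ff iF]] [g' [mg g0 gg ig]]; exists (fun t => f' t + g' t)%E; split.
- exact: emeasurable_funD.
- by move=> t; rewrite adde_ge0.
- by move=> t; rewrite (le_trans (y := ((nrm (f t))%:E + (nrm (g t))%:E)%E))//
    ?leeD// -EFinD lee_fin nrmD.
- by rewrite ge0_integralD// EFinD leeD.
Qed.

Lemma N1leN f c : N1le f c -> N1le (fun t => - f t) c.
Proof. by apply: N1le_le => t; rewrite nrmN. Qed.

Lemma N1leB f g a b : N1le f a -> N1le g b -> N1le (fun t => f t - g t) (a + b).
Proof. by move=> hf hg; apply: N1leD => //; exact: N1leN. Qed.

Lemma N1le0 : N1le (fun=> 0) 0.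
Proof.
exists (fun=> 0%E); split => //; last by rewrite integral0.
by move=> t; rewrite nrm0.
Qed.

Lemma N1le_refl a f c : N1le f c -> N1le (fun t => f (a - t)) c.
Proof.
move=> [g [mg g0 fg ig]]; exists (fun t => g (a - t)%R); split => //.
- exact: (measurableT_comp mg (measurable_refl a)).
- by rewrite integral_refl.
Qed.

Lemma N1le_sfl_sil l c : adm l -> N1le (@sfl R X l) c -> nrm (sil l) <= c.
Proof.
move=> al [g [mg g0 fg ig]]; rewrite -lee_fin.
apply: le_trans (nrm_sil al) _; apply: le_trans ig.
by apply: le_lower_integral => // t; rewrite lee_fin nrm_ge0.
Qed.

Definition Lint f : Prop := forall e : R, 0 < e ->
  exists l, adm l /\ N1le (fun t => f t - sfl l t) e.

(** [is_bochner] freed of sequences and of almost everywhere convergence: L^1 approximation alone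
    determines the integral. [bochner_isI] and [isI_bochner] show that the two notions agree. *)
Definition isI f (w : X) : Prop := forall e : R, 0 < e ->
  exists l, [/\ adm l, N1le (fun t => f t - sfl l t) e & nrm (w - sil l) <= e].

Lemma isI_Lint f w : isI f w -> Lint f.
Proof. by move=> h e /h [l [? ? _]]; exists l. Qed.

Definition sub_seq (l l' : seq (set R * X)) := l ++ mapv -%R l'.

Lemma adm_sub l l' : adm l -> adm l' -> adm (sub_seq l l').
Proof. by move=> *; apply: adm_cat => //; exact: adm_mapv. Qed.

Lemma sfl_sub l l' t : sfl (sub_seq l l') t = sfl l t - sfl l' t.
Proof. by rewrite sfl_cat sfl_mapv// ?oppr0// => x y; rewrite opprD. Qed.

Lemma sil_sub l l' : sil (sub_seq l l') = sil l - sil l'.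
Proof.
rewrite sil_cat sil_mapv ?oppr0//; last by move=> c x; rewrite scalerN.
by move=> x y; rewrite opprD.
Qed.

Lemma eps0 (a b K : R) : 0 <= K -> (forall e, 0 < e -> a <= b + K * e) -> a <= b.
Proof.
move=> K0 h; apply/ler_addgt0Pr => e e0.
have K1 : 0 < K + 1 by rewrite ltr_wpDl.
apply: le_trans (h (e / (K + 1)) _) _; first by rewrite divr_gt0.
rewrite lerD2l mulrA ler_pdivrMr// mulrC ler_wpM2l ?(ltW e0)//.
by rewrite lerDl.
Qed.

Lemma isI_bound f w c : isI f w -> N1le f c -> nrm w <= c.
Proof.
move=> hw hf; apply: (@eps0 _ _ 2) => // e e0.
have [l [al fl wl]] := hw e e0.
have : nrm (sil l) <= c + e.
  apply: N1le_sfl_sil => //.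
  have := N1leB hf fl; apply: N1le_le => t; rewrite subKr//.
have h1 := nrm_le_dist w (sil l) => h2; lra.
Qed.

Lemma isIB f g v w : isI f v -> isI g w -> isI (fun t => f t - g t) (v - w).
Proof.
move=> hf hg e e0; have e2 : 0 < e / 2 by rewrite divr_gt0.
have [l [al fl vl]] := hf _ e2; have [l' [al' gl wl]] := hg _ e2.
exists (sub_seq l l'); split; first exact: adm_sub.
  have := N1leB fl gl; rewrite -splitr; apply: N1le_le => t.
  by rewrite sfl_sub le_eqVlt; apply/orP; left; apply/eqP; congr nrm; zmod.
rewrite sil_sub (_ : _ - _ = (v - sil l) - (w - sil l')); last by zmod.
by rewrite (le_trans (nrmB _ _))// [leRHS]splitr lerD.
Qed.

Lemma Lint_isI0 : isI (fun=> 0) 0.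
Proof.
move=> e e0; exists [::]; split => //; last by rewrite /sil big_nil subr0 nrm0 ltW.
apply: N1leW (ltW e0); apply: N1le_le N1le0 => t.
by rewrite /sfl big_nil subr0.
Qed.

Lemma isI_uniq f v w : isI f v -> isI f w -> v = w.
Proof.
move=> hv hw; apply/eqP; rewrite -subr_eq0; apply/eqP/nrm_eq0.
apply: isI_bound (isIB hv hw) _; apply: N1le_le N1le0 => t.
by rewrite subrr.
Qed.

Lemma isIN f v : isI f v -> isI (fun t => - f t) (- v).
Proof.
move=> h; have := isIB Lint_isI0 h.
by rewrite sub0r; under eq_fun do rewrite sub0r.
Qed.

Lemma isID f g v w : isI f v -> isI g w -> isI (fun t => f t + g t) (v + w).
Proof.
move=> hv /isIN hw; have := isIB hv hw.
by rewrite opprK; under eq_fun do rewrite opprK.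
Qed.

(** Only real scalars have to pass through [F], because the coefficients in [sil] are measures of
    sets. *)
Lemma isI_op (F : X -> X) K f w : 0 <= K ->
  {morph F : x y / x + y} ->
  (forall (c : R) x, F (c%:C%C *: x) = c%:C%C *: F x) ->
  (forall x, nrm (F x) <= K * nrm x) ->
  isI f w -> isI (fun t => F (f t)) (F w).
Proof.
move=> K0 FD FZ FK h e e0.
have F0 : F 0 = 0 by have := FZ 0 0; rewrite !scale0r.
have FB x y : F (x - y) = F x - F y.
  by apply/eqP; rewrite eq_sym subr_eq -FD subrK.
have K1 : 0 < K + 1 by rewrite ltr_wpDl.
have [l [al fl wl]] := h _ (divr_gt0 e0 K1).
have le1 : K * (e / (K + 1)) <= e.
  by rewrite mulrA ler_pdivrMr// mulrC ler_wpM2l ?(ltW e0)// lerDl.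
exists (mapv F l); split; first exact: adm_mapv.
  apply: N1leW le1; apply: N1le_dom fl => // t.
  by rewrite sfl_mapv// -FB.
rewrite sil_mapv// -FB (le_trans (FK _))//.
by apply: le_trans le1; rewrite ler_wpM2l.
Qed.

Lemma isIZ (k : R[i]) f w : isI f w -> isI (fun t => k *: f t) (k *: w).
Proof.
apply: (isI_op (cabs_ge0 k)); first by move=> x y; rewrite scalerDr.
  by move=> c x; rewrite !scalerA mulrC.
by move=> x; rewrite nrmZ.
Qed.

Lemma Lint_lim f : (forall e, 0 < e -> exists g,
    Lint g /\ N1le (fun t => f t - g t) e) -> Lint f.
Proof.
move=> h e e0; have e2 : 0 < e / 2 by rewrite divr_gt0.
have [g [gv fg]] := h _ e2; have [l [al gl]] := gv _ e2.
exists l; split => //.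
have := N1leD fg gl; rewrite -splitr; apply: N1le_le => t.
by rewrite subrKA.
Qed.

Lemma isI_indic (A : set R) v : finm A ->
  isI (fun t => if `[< A t >] then v else 0) ((fine (mu A))%:C%C *: v).
Proof.
move=> fA e e0; exists [:: (A, v)]; split => //.
  apply: N1leW (ltW e0); apply: N1le_le N1le0 => t.
  by rewrite /sfl big_seq1 subrr.
by rewrite /sil big_seq1 subrr nrm0 ltW.
Qed.

Lemma isI_sfl l : adm l -> isI (@sfl R X l) (sil l).
Proof.
move=> al e e0; exists l; split => //.
  apply: N1leW (ltW e0); apply: N1le_le N1le0 => t.
  by rewrite subrr.
by rewrite subrr nrm0 ltW.
Qed.

Definition reflA (a : R) (A : set R) : set R := [set s | A (a - s)].

Lemma finm_refl a A : finm A -> finm (reflA a A).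
Proof.
move=> [mA fA].
have mr : measurable (reflA a A).
  rewrite -[reflA a A]setTI; exact: (measurable_refl a measurableT mA).
by split => //; have := lebesgue_refl a mA; rewrite /pushforward => ->.
Qed.

Lemma mu_refl a A : measurable A -> mu (reflA a A) = mu A.
Proof. exact: lebesgue_refl. Qed.

Lemma isI_refl a f w : isI f w -> isI (fun s => f (a - s)) w.
Proof.
move=> h e e0; have [l [al fl wl]] := h e e0.
exists [seq (reflA a b.1, b.2) | b <- l]; split.
- by elim: l al {fl wl} => //= b l IH [fb /IH]; split => //; exact: finm_refl.
- apply: N1le_le (N1le_refl a fl) => t.
  by rewrite /sfl big_map.
- rewrite (_ : sil _ = sil l)//; move: al; rewrite /sil big_map {fl wl}.
  elim: l => [|b l IH] /=; first by rewrite !big_nil.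
  by move=> [[mb _] /IH]; rewrite !big_cons mu_refl// => ->.
Qed.

Lemma Lint0 : Lint (fun=> 0). Proof. exact: isI_Lint Lint_isI0. Qed.
End UpperL1.

Section BochnerExists.
Context (R : realType) (X : completeNormedModType R[i]).
Implicit Types (f g : R -> X).

(** Two step functions close to [f] in L^1 are close to each other, so their integrals form a Cauchy
    sequence; completeness of [X] gives the limit. *)
Lemma Lint_isI f : Lint f -> exists w, isI f w.
Proof.
move=> h; pose d (n : nat) : R := n.+1%:R^-1.
have d0 n : 0 < d n by rewrite invr_gt0.
have /choice[l hl] : forall n, exists l, adm l /\ N1le (fun t => f t - sfl l t) (d n).
  by move=> n; exact: h.
have dlt (e : R) : 0 < e -> exists N, forall n, (N <= n)%N -> d n < e.
  move=> e0; have [N _ hN] := near_infty_natSinv_lt (PosNum e0).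
  by exists N => n Nn; exact: hN.
have key m n : nrm (sil (l m) - sil (l n)) <= d m + d n.
  rewrite -sil_sub; apply: N1le_sfl_sil.
    by apply: adm_sub; [case: (hl m)|case: (hl n)].
  have := N1leB (hl n).2 (hl m).2; rewrite addrC; apply: N1le_le => t.
  by rewrite sfl_sub le_eqVlt; apply/orP; left; apply/eqP; congr nrm; zmod.
have [|w hw] := @nrm_complete _ X (fun n => sil (l n)).
  move=> e e0; have e2 : 0 < e / 2 by rewrite divr_gt0.
  have [N hN] := dlt _ e2; exists N => m n Nm Nn.
  by rewrite (le_lt_trans (key m n))// [ltRHS]splitr ltrD ?hN.
exists w => e e0; have [N hN] := dlt e e0.
have [M hM] := (nrm_cvgP _ _).1 hw e e0.
exists (l (maxn N M)); split; first by case: (hl (maxn N M)).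
  by apply: N1leW (hl (maxn N M)).2 (ltW (hN _ (leq_maxl _ _))).
by rewrite nrm_distC ltW// hM// leq_maxr.
Qed.

(** The default 0 for a function without integral makes convolution a total operation. *)
Definition bint f : X := xget 0 [set w | isI f w].

Lemma bintP f : Lint f -> isI f (bint f).
Proof. by move=> /Lint_isI[w hw]; rewrite /bint; case: xgetP => // /(_ w). Qed.

Lemma bintE f w : isI f w -> bint f = w.
Proof. by move=> h; apply: isI_uniq (h); apply: bintP; exact: isI_Lint h. Qed.

End BochnerExists.

(** * Null sets and agreement with [is_bochner] *)

Section NullSets.
Context (R : realType) (X : normedModType R[i]).
Local Notation mu := (@lebesgue_measure R).

(** The majorant is set to +oo on the null set, which does not change its integral; thus a bound off
    a null set becomes a bound everywhere. *)
Lemma N1le_ae (f : R -> X) (B : set R) (g : R -> \bar R) c :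
  measurable B -> mu B = 0%E ->
  measurable_fun setT g -> (forall t, (0 <= g t)%E) ->
  (forall t, ~ B t -> ((nrm (f t))%:E <= g t)%E) ->
  (\int[mu]_t g t <= c%:E)%E -> N1le f c.
Proof.
move=> mB B0 mg g0 fg ig.
pose h : R -> \bar R := (fun=> +oo%E) \_ B.
have mh : measurable_fun setT h.
  by apply/(measurable_restrictT _ mB); exact: measurable_cst.
have h0 t : (0 <= h t)%E by rewrite /h /patch; case: ifP.
exists (fun t => g t + h t)%E; split.
- exact: emeasurable_funD.
- by move=> t; rewrite adde_ge0.
- move=> t; have [Bt|nBt] := pselect (B t).
    by rewrite /h /patch mem_set// addey ?leey// gt_eqF// (lt_le_trans _ (g0 t)).
  by rewrite (le_trans (fg t nBt))// leeDl.
rewrite ge0_integralD// (_ : (\int[mu]_t h t)%E = 0%E) ?adde0//.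
by rewrite -integral_mkcond; apply: null_set_integral.
Qed.

Lemma N1le_mu (f : R -> X) (B : set R) (c : R) :
  measurable B -> mu B = 0%E ->
  measurable_fun (~` B) (fun t => nrm (f t)) ->
  (\int[mu]_(t in ~` B) (nrm (f t))%:E <= c%:E)%E -> N1le f c.
Proof.
move=> mB B0 mf ig.
have mC : measurable (~` B) by exact: measurableC.
pose g := ((fun t => (nrm (f t))%:E) \_ (~` B)).
apply: (@N1le_ae f B g) => //.
- by apply/(measurable_restrictT _ mC); exact/measurable_EFinP.
- by move=> t; apply: erestrict_ge0 => u _; rewrite lee_fin nrm_ge0.
- by move=> t nBt; rewrite /g /patch mem_set.
- by rewrite -integral_mkcond.
Qed.

(** Off the null set the function is a pointwise limit of norms of step functions, which are
    measurable. *)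
Lemma measurable_nrm_diff (f : R -> X) (B : set R) (u : nat -> seq (set R * X)) l :
  measurable B -> (forall k, adm (u k)) -> adm l ->
  (forall t, ~ B t -> (fun k => sfl (u k) t) @ \oo --> f t) ->
  measurable_fun (~` B) (fun t => nrm (f t - sfl l t)).
Proof.
move=> mB au al uf.
apply: (@measurable_fun_cvg _ _ _ _ (fun k t => nrm (sfl (u k) t - sfl l t))).
  move=> k; apply: measurable_funTS.
  have := @measurable_nrm_sfl _ X (sub_seq (u k) l) 0 (adm_sub (au k) al).
  by under eq_fun do rewrite addr0 sfl_sub.
move=> t /uf /nrm_cvgP ut; apply/cvgrPdist_lt => e /ut [N hN].
exists N => // k /= Nk.
have h := hN _ Nk; apply: le_lt_trans h.
have h1 := nrm_le_dist (f t - sfl l t) (sfl (u k) t - sfl l t).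
have h2 := nrm_le_dist (sfl (u k) t - sfl l t) (f t - sfl l t).
rewrite (_ : f t - sfl l t - (sfl (u k) t - sfl l t) = - (sfl (u k) t - f t)) in h1; last by zmod.
rewrite nrmN in h1.
rewrite (_ : sfl (u k) t - sfl l t - (f t - sfl l t) = (sfl (u k) t - f t)) in h2; last by zmod.
by rewrite ler_norml; apply/andP; split; lra.
Qed.

Definition lst n (A : 'I_n -> set R) (v : 'I_n -> X) : seq (set R * X) :=
  [seq (A i, v i) | i <- index_enum 'I_n].

Lemma sfl_lst n (A : 'I_n -> set R) v t : sfl (lst A v) t = simple_fun A v t.
Proof. by rewrite /sfl /lst big_map. Qed.

Lemma sil_lst n (A : 'I_n -> set R) v : sil (lst A v) = simple_int A v.
Proof. by rewrite /sil /lst big_map. Qed.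

Lemma adm_lst n (A : 'I_n -> set R) v : admissible A -> adm (lst A v).
Proof. by move=> h; rewrite /lst; elim: (index_enum _) => //= i s IH; split => //; exact: h. Qed.

Definition lA (l : seq (set R * X)) (i : 'I_(size l)) : set R :=
  (nth (set0, 0) l i).1.
Definition lv (l : seq (set R * X)) (i : 'I_(size l)) : X :=
  (nth (set0, 0) l i).2.

Lemma sfl_simple l t : simple_fun (lA (l:=l)) (lv (l:=l)) t = sfl l t.
Proof. by rewrite /sfl (big_nth (set0, 0)) big_mkord. Qed.

Lemma sil_simple l : simple_int (lA (l:=l)) (lv (l:=l)) = sil l.
Proof. by rewrite /sil (big_nth (set0, 0)) big_mkord. Qed.

Lemma adm_simple l : adm l -> admissible (lA (l:=l)).
Proof.
move=> al i; rewrite /lA; case: i => i /=.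
elim: l al i => //= a l IH [fa al] [|i] //=; exact: IH.
Qed.

Lemma bochner_isI (f : R -> X) w : is_bochner f w -> isI f w.
Proof.
move=> [n [A [v [aA [[B [mB B0 fB]] [iA sA]]]]]] e e0.
have fB' t : ~ B t -> (fun k => sfl (lst (A k) (v k)) t) @ \oo --> f t.
  move=> nB; under eq_fun do rewrite sfl_lst.
  by apply: contra_notP nB => h; apply: fB.
have [N1 hN1] : exists N, forall k, (N <= k)%N ->
    (\int[mu]_t (nrm (simple_fun (A k) (v k) t - f t))%:E <= e%:E)%E.
  have /fine_cvgP [[N1 _ h1] /cvgrPdist_lt /(_ e e0) [N2 _ h2]] := iA.
  exists (maxn N1 N2) => k Nk.
  have := h1 k (leq_trans (leq_maxl _ _) Nk).
  have := h2 k (leq_trans (leq_maxr _ _) Nk).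
  move=> /= h3 h4; rewrite -(fineK h4) lee_fin.
  by move: h3; rewrite sub0r normrN => /ltW; apply: le_trans; rewrite ler_norm.
have [N2 hN2] := (nrm_cvgP _ _).1 sA e e0.
pose k := maxn N1 N2.
exists (lst (A k) (v k)); split; first exact: adm_lst.
- apply: (N1le_mu mB B0).
    by apply: measurable_nrm_diff mB (fun k => adm_lst (v k) (aA k)) _ fB'; exact: adm_lst.
  apply: le_trans (hN1 k (leq_maxl _ _)).
  under eq_integral do rewrite sfl_lst nrm_distC.
  by apply: lower_integral_restrict => t; rewrite lee_fin nrm_ge0.
- by rewrite sil_lst nrm_distC ltW// hN2// leq_maxr.
Qed.

(** Step functions are taken at L^1 distance 4^-k. The series G of 2^k times the majorants then has
    integral at most 2, hence is finite almost everywhere, and the error at t is at most 2^-k G(t):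
    fast L^1 convergence forces convergence almost everywhere. *)
Lemma isI_bochner (f : R -> X) w : isI f w -> is_bochner f w.
Proof.
move=> h; pose c (k : nat) : R := 4^-1 ^+ k.
have c0 k : 0 < c k by rewrite exprn_gt0// invr_gt0.
have /choice[l hl] : forall k, exists l,
    [/\ adm l, N1le (fun t => f t - sfl l t) (c k) & nrm (w - sil l) <= c k].
  by move=> k; exact: h.
have /choice[g hg] : forall k, exists g : R -> \bar R,
  [/\ measurable_fun setT g, forall t, (0 <= g t)%E,
      forall t, ((nrm (f t - sfl (l k) t))%:E <= g t)%E & (\int[mu]_t g t <= (c k)%:E)%E].
  by move=> k; case: (hl k) => _ [g hg] _; exists g.
have mg k : measurable_fun setT (g k) by case: (hg k).
have g0 k t : (0 <= g k t)%E by case: (hg k).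
have fg k t : ((nrm (f t - sfl (l k) t))%:E <= g k t)%E by case: (hg k).
have ig k : (\int[mu]_t g k t <= (c k)%:E)%E by case: (hg k).
have ccv : c @ \oo --> (0 : R).
  by apply: cvg_expr; rewrite ger0_norm ?invr_ge0// invf_lt1 ?ltr1n.
have ccvg (e : R) : 0 < e -> exists N, forall k, (N <= k)%N -> c k < e.
  move=> e0; have /cvgrPdist_lt /(_ e e0) [N _ hN] := ccv.
  exists N => k Nk; have := hN k Nk.
  by rewrite /= sub0r normrN gtr0_norm.
have ccvg2 (e : R) : 0 < e -> exists N, forall k, (N <= k)%N -> 2^-1 ^+ k < e.
  move=> e0; have /cvgrPdist_lt /(_ e e0) [N _ hN] :
      (fun k => 2^-1 ^+ k : R) @ \oo --> (0 : R).
    by apply: cvg_expr; rewrite ger0_norm ?invr_ge0// invf_lt1 ?ltr1n.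
  exists N => k Nk; have := hN k Nk.
  by rewrite /= sub0r normrN gtr0_norm// exprn_gt0 ?invr_gt0.
exists (fun k => size (l k)), (fun k => lA (l:=l k)), (fun k => lv (l:=l k)).
split; [|split; [|split]].
- by move=> k; apply: adm_simple; case: (hl k).
- pose G t := (\sum_(0 <= k <oo) ((2 ^+ k)%:E * g k t))%E.
  have mG k : measurable_fun setT (fun t => (2 ^+ k)%:E * g k t)%E.
    exact: measurable_funeM.
  have G0 k t : (0 <= (2 ^+ k)%:E * g k t)%E by rewrite mule_ge0// lee_fin exprn_ge0.
  have iG : (\int[mu]_t G t <= 2%:E)%E.
    rewrite integral_nneseries//; apply: lime_le.
      by apply: is_cvg_nneseries => k _ _; exact: integral_ge0.
    apply: nearW => n.
    apply: (@le_trans _ _ (\sum_(0 <= k < n) (2^-1 ^+ k)%:E)%E).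
      apply: lee_sum => k _; rewrite ge0_integralZl//; last exact: mg.
      apply: (@le_trans _ _ ((2 ^+ k)%:E * (c k)%:E)%E).
        by rewrite lee_wpmul2l ?lee_fin ?exprn_ge0.
      by rewrite -EFinM lee_fin /c -exprMn (_ : 2 * 4^-1 = 2^-1 :> R)//; lra.
    rewrite sumEFin lee_fin big_mkord.
    suff -> : \sum_(i < n) 2^-1 ^+ i = 2 - 2 * 2^-1 ^+ n :> R.
      by rewrite gerBl mulr_ge0// exprn_ge0 ?invr_ge0.
    elim: n => [|n IH]; first by rewrite big_ord0 expr0 mulr1 subrr.
    by rewrite big_ord_recr/= IH exprS; field.
  have mGG : measurable_fun setT G by apply: ge0_emeasurable_sum => // k *; exact: G0.
  have GG0 t : (0 <= G t)%E by apply: nneseries_ge0 => k *; exact: G0.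
  have intG : mu.-integrable setT G.
    apply/integrableP; split => //.
    under eq_integral do rewrite gee0_abs//.
    exact: le_lt_trans iG (ltry _).
  have := integrable_ae measurableT intG.
  apply: filterS => t /(_ Logic.I) Gt; under eq_fun do rewrite sfl_simple.
  have GE : G t = (fine (G t))%:E by rewrite fineK.
  apply/nrm_cvgP => e e0.
  pose K := fine (G t); have K0 : 0 <= K by rewrite fine_ge0.
  have gK k : nrm (sfl (l k) t - f t) <= 2^-1 ^+ k * K.
    rewrite nrm_distC exprVn ler_pdivlMl ?exprn_gt0// -lee_fin -GE EFinM.
    apply: (@le_trans _ _ ((2 ^+ k)%:E * g k t)%E).
      by rewrite lee_wpmul2l ?lee_fin ?exprn_ge0.
    apply: (@le_trans _ _ (\sum_(0 <= j < k.+1) ((2 ^+ j)%:E * g j t))%E).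
      by rewrite big_nat_recr//= leeDr// sume_ge0.
    by apply: nneseries_lim_ge => j *; exact: G0.
  have [N hN] := ccvg2 (e / (K + 1)) (divr_gt0 e0 (ltr_wpDl K0 ltr01)).
  exists N => k Nk; apply: le_lt_trans (gK k) _.
  have := hN k Nk; rewrite ltr_pdivlMr ?ltr_wpDl//; apply: le_lt_trans.
  by rewrite ler_wpM2l ?exprn_ge0 ?invr_ge0// lerDl.
- apply: (@squeeze_cvge _ _ _ _ (fun=> 0%E) _ (fun k => (c k)%:E)).
  + apply: nearW => k; rewrite integral_ge0 ?andTb; last by move=> t _; rewrite lee_fin nrm_ge0.
    apply: le_trans (ig k).
    by apply: le_lower_integral => t; rewrite ?lee_fin ?nrm_ge0// sfl_simple nrm_distC.
  + exact: cvg_cst.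
  + apply: cvg_EFin; first exact: nearW.
    exact: ccv.
- apply/nrm_cvgP => e /ccvg [N hN]; exists N => k Nk.
  rewrite sil_simple nrm_distC; case: (hl k) => _ _ h2.
  by rewrite (le_lt_trans h2)// hN.
Qed.

End NullSets.

(** * The weight and convolutions of scalar functions *)

Section Weight.
Context (R : realType).
Local Notation mu := (@lebesgue_measure R).
Implicit Types (p s t : R).

Lemma jbr_ge1 t : 1 <= jbr t.
Proof. by rewrite -[leLHS]sqrtr1 ler_wsqrtr// lerDl sqr_ge0. Qed.

Lemma jbr_gt0 t : 0 < jbr t. Proof. exact: lt_le_trans (jbr_ge1 t). Qed.

Lemma jbr_sqr t : jbr t ^+ 2 = 1 + t ^+ 2.
Proof. by rewrite sqr_sqrtr// addr_ge0 ?sqr_ge0. Qed.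

Lemma jbrN t : jbr (- t) = jbr t. Proof. by rewrite /jbr sqrrN. Qed.

Lemma jbr_half t : 1 + `|t| <= 2 * jbr t.
Proof.
rewrite -(@ler_pXn2r _ 2) ?nnegrE ?mulr_ge0 ?(ltW (jbr_gt0 t))// ?addr_ge0//.
rewrite exprMn jbr_sqr -[t ^+ 2]real_normK ?num_real//.
have := sqr_ge0 (`|t| - 1); have := normr_ge0 t; nra.
Qed.

Lemma jbr_le s t : `|t| <= 2 * `|s| -> jbr t <= 2 * jbr s.
Proof.
move=> h; rewrite -(@ler_pXn2r _ 2) ?nnegrE ?mulr_ge0 ?(ltW (jbr_gt0 _))//.
rewrite exprMn !jbr_sqr -[t ^+ 2]real_normK ?num_real// -[s ^+ 2]real_normK ?num_real//.
have := normr_ge0 t; have := normr_ge0 s; nra.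
Qed.

Definition wt p t : R := (jbr t `^ p)^-1.

Lemma wt_gt0 p t : 0 < wt p t.
Proof. by rewrite invr_gt0 powR_gt0// jbr_gt0. Qed.

Lemma wt_ge0 p t : 0 <= wt p t. Proof. exact/ltW/wt_gt0. Qed.

Lemma wtN p t : wt p (- t) = wt p t. Proof. by rewrite /wt jbrN. Qed.

Lemma wt_le1 p t : 0 <= p -> wt p t <= 1.
Proof.
move=> p0; rewrite invf_le1 ?powR_gt0 ?jbr_gt0//.
by have := ler_powR (jbr_ge1 t) p0; rewrite powRr0.
Qed.

Lemma wt_le p s t : 0 <= p -> `|t| <= 2 * `|s| -> wt p s <= 2 `^ p * wt p t.
Proof.
move=> p0 h; rewrite /wt ler_pdivlMr ?powR_gt0 ?jbr_gt0//.
rewrite mulrC ler_pdivrMr ?powR_gt0 ?jbr_gt0// -powRM ?(ltW (jbr_gt0 _))//.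
by apply: ge0_ler_powR; rewrite ?nnegrE ?mulr_ge0 ?(ltW (jbr_gt0 _))// jbr_le.
Qed.

Lemma measurable_jbr : measurable_fun setT (@jbr R).
Proof.
apply: continuous_measurable_fun => t.
apply: (@continuous_comp _ _ _ (fun t : R => 1 + t ^+ 2) (@Num.sqrt R)); last exact: sqrt_continuous.
by apply: cvgD; [exact: cvg_cst|exact: exprn_continuous].
Qed.

Lemma measurable_wt p : measurable_fun setT (wt p).
Proof.
rewrite (_ : wt p = (fun t => jbr t `^ (- p))).
  by apply: (@measurableT_comp _ _ _ _ _ _ (@powR R ^~ (- p)) _ (@jbr R)); [exact: measurable_powR|exact: measurable_jbr].
by apply/funext => t; rewrite powRN.
Qed.

(** The primitive - (1 + t)^(1 - p) / (p - 1) tends to 0 at infinity exactly because p > 1. *)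
Lemma integral_powR_tail p : 1 < p ->
  (\int[mu]_(t in `[0%R, +oo[) (((1 + t) `^ (- p))%:E) = ((p - 1)^-1)%:E)%E.
Proof.
move=> p1; have p10 : 0 < p - 1 by rewrite subr_gt0.
pose F (t : R) := - (p - 1)^-1 * (1 + t) `^ (1 - p).
have dF (x : R) : 0 <= x -> is_derive x 1 F ((1 + x) `^ (- p)).
  move=> x0; have x1 : 0 < 1 + x by rewrite ltr_wpDr.
  have h := is_derive1_powR (1 - p) x1.
  have h1 : is_derive x (1:R) (cst 1 + id : R -> R) (0 + 1).
    exact: is_deriveD.
  rewrite add0r in h1.
  have h2 : is_derive x (1 : R) (fun t : R => (1 + t) `^ (1 - p)) ((1 - p) * (1 + x) `^ (1 - p - 1) * 1).
    exact: (is_derive1_comp h h1).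
  have h3 := is_deriveZ (- (p - 1)^-1) h2.
  have e : (- (p - 1)^-1) *: ((1 - p) * (1 + x) `^ (1 - p - 1) * 1) = (1 + x) `^ (- p).
    rewrite /GRing.scale/= (_ : 1 - p - 1 = - p); last by ring.
    by field; rewrite gt_eqF.
  by rewrite e in h3.
have cF (x : R) : 0 <= x -> {for x, continuous F}.
  move=> x0; apply: differentiable_continuous; apply/derivable1_diffP.
  by have h := dF x x0; exact: ex_derive.
rewrite (@ge0_continuous_FTC2y _ _ F _ 0).
- by rewrite sub0e /F addr0 powR1 -EFinN mulr1 opprK.
- by move=> x _; exact: powR_ge0.
- apply: derivable_within_continuous => x; rewrite in_itv/= andbT => x0.
  have x1 : 0 < 1 + x by rewrite ltr_wpDr.
  have h := is_derive1_powR (- p) x1.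
  have h1 : is_derive x (1:R) (cst 1 + id : R -> R) (0 + 1).
    exact: is_deriveD.
  rewrite add0r in h1.
  have h2 := is_derive1_comp h h1.
  exact: (@ex_derive _ _ _ _ _ _ _ h2).
- apply/cvgrPdist_lt => e e0; near=> x.
  have x0 : 0 < x by near: x; exact: nbhs_pinfty_gt.
  have x1 : 0 < 1 + x by rewrite ltr_wpDr// ltW.
  rewrite sub0r normrN /F normrM normrN (gtr0_norm (x := _^-1)) ?invr_gt0//.
  rewrite ger0_norm ?powR_ge0// mulrC ltr_pdivrMr//.
  pose d := e * (p - 1); have d0 : 0 < d by rewrite mulr_gt0.
  have : d `^ (- (p - 1)^-1) < 1 + x.
    by rewrite -ltrBlDl; near: x; apply: nbhs_pinfty_gt; exact: num_real.
  rewrite -/d (_ : 1 - p = - (p - 1)); last by ring.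
  rewrite !powRN => h.
  rewrite invf_plt ?posrE ?powR_gt0//.
  have -> : d^-1 = ((d `^ (p - 1)^-1)^-1) `^ (p - 1).
    rewrite -powRN -powRrM mulNr mulVf ?gt_eqF// powRN powRr1// ltW//.
  by apply: gt0_ltr_powR; rewrite ?nnegrE ?invr_ge0 ?powR_ge0// ltW.
- by move=> x /ltW/dF h; exact: ex_derive.
- by apply/cvg_at_right_filter; apply: cF.
- move=> x; rewrite in_itv/= andbT => /ltW/dF h; by rewrite derive1E; apply: derive_val.
Unshelve. all: by end_near. Qed.


(** The weight is at most 2^p (1 + |t|)^-p. The function [h] is this bound on t >= 0, and its
    reflection covers t < 0. *)
Lemma integral_wt_lty p : 1 < p -> (\int[mu]_t (wt p t)%:E < +oo)%E.
Proof.
move=> p1; have p0 : 0 <= p by rewrite (le_trans ler01)// ltW.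
pose h (t : R) : \bar R := ((fun t => (2 `^ p)%:E * ((1 + t) `^ (- p))%:E)%E \_ (`[0%R, +oo[%classic : set R)) t.
have mh : measurable_fun setT h.
  apply/(measurable_restrictT _ (measurable_itv _)).
  apply: measurable_funeM; apply/measurable_EFinP.
  apply: measurable_funTS.
  apply: (@measurableT_comp _ _ _ _ _ _ (@powR R ^~ (- p)) _ (fun t => 1 + t)).
    exact: measurable_powR.
  by apply: measurable_funD; [exact: measurable_cst|exact: measurable_id].
have h0 t : (0 <= h t)%E.
  by apply: erestrict_ge0 => u _; rewrite mule_ge0// lee_fin powR_ge0.
have ih : (\int[mu]_t h t = (2 `^ p)%:E * ((p - 1)^-1)%:E)%E.
  rewrite -integral_mkcond ge0_integralZl ?integral_powR_tail//.
  - apply/measurable_EFinP/measurable_funTS.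
    apply: (@measurableT_comp _ _ _ _ _ _ (@powR R ^~ (- p)) _ (fun t => 1 + t)).
      exact: measurable_powR.
    by apply: measurable_funD; [exact: measurable_cst|exact: measurable_id].
  - by move=> t _; rewrite lee_fin powR_ge0.
have wh t : ((wt p t)%:E <= h t + h (0 - t)%R)%E.
  have key (u : R) : 0 <= u -> wt p u <= 2 `^ p * (1 + u) `^ (- p).
    move=> u0; rewrite /wt powRN ler_pdivlMr ?powR_gt0 ?ltr_wpDr//.
    rewrite mulrC ler_pdivrMr ?powR_gt0 ?jbr_gt0// -powRM ?(ltW (jbr_gt0 _))//.
    apply: ge0_ler_powR; rewrite ?nnegrE ?mulr_ge0 ?(ltW (jbr_gt0 _))// ?addr_ge0//.
    by have := jbr_half u; rewrite ger0_norm.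
  have [t0|t0] := leP 0 t.
    apply: (@le_trans _ _ (h t)); last by rewrite leeDl.
    rewrite /h /patch mem_set /=; last by rewrite in_itv/= andbT.
    by rewrite -EFinM lee_fin key.
  apply: (@le_trans _ _ (h (0 - t)%R)); last by rewrite leeDr.
  rewrite sub0r /h /patch mem_set /=; last by rewrite in_itv/= andbT oppr_ge0 ltW.
  by rewrite -EFinM lee_fin -[wt p t]wtN key// oppr_ge0 ltW.
have mh' : measurable_fun setT (fun t : R => h (0 - t)%R).
  exact: (measurableT_comp mh (measurable_refl 0)).
apply: (@le_lt_trans _ _ (\int[mu]_t (h t + h (0 - t)%R))%E).
  by apply: le_lower_integral => // t; rewrite lee_fin wt_ge0.
by rewrite ge0_integralD// integral_refl// ih -EFinM -EFinD ltry.
Qed.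

Definition cw p : R := fine (\int[mu]_t (wt p t)%:E).

Lemma integral_wt p : 1 < p -> (\int[mu]_t (wt p t)%:E = (cw p)%:E)%E.
Proof.
move=> p1; rewrite /cw fineK// ge0_fin_numE; first exact: integral_wt_lty.
by apply: integral_ge0 => t _; rewrite lee_fin wt_ge0.
Qed.

Lemma cw_ge0 p : 0 <= cw p.
Proof. by apply/fine_ge0/integral_ge0 => t _; rewrite lee_fin wt_ge0. Qed.

Lemma integrable_wt p : 1 < p -> mu.-integrable setT (EFin \o wt p).
Proof.
move=> p1; apply/integrableP; split.
  by apply/measurable_EFinP; exact: measurable_wt.
under eq_integral do rewrite /= ger0_norm ?wt_ge0//.
exact: integral_wt_lty.
Qed.

Lemma wt_tail p e : 1 < p -> 0 < e -> exists2 r, 0 < r &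
  (\int[mu]_t ((if r < `|t| then wt p t else 0)%:E) <= e%:E)%E.
Proof.
move=> p1 e0.
pose f (n : nat) (t : R) : \bar R := (if n%:R < `|t| then wt p t else 0)%:E.
have mf n : measurable_fun setT (f n).
  apply/measurable_EFinP; apply: measurable_fun_ifT => //.
    by apply: measurable_fun_ltr.
  exact: measurable_wt.
have fcvg t : setT t -> (fun n => f n t) @ \oo --> 0%E.
  move=> _; apply: cvg_EFin; first exact: nearW.
  apply/cvgrPdist_lt => d d0; near=> n.
  have tn : (n%:R < `|t|) = false.
    apply/negbTE; rewrite -leNgt.
    by apply: ltW; near: n; exact: nbhs_infty_gtr.
  by rewrite /f /= tn subrr normr0.
have fdom t : forall n, setT t -> (`|f n t| <= (EFin \o wt p) t)%E.
  move=> n _; rewrite /f /= lee_fin; case: ifP => _; first by rewrite ger0_norm ?wt_ge0.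
  by rewrite normr0 wt_ge0.
have := @dominated_convergence _ _ _ mu setT measurableT f (cst 0%E) (EFin \o wt p).
move=> /(_ mf (measurable_cst _) (aeW mu fcvg) (integrable_wt p1) (aeW mu fdom)) [_ _ /=].
rewrite integral0 => /fine_cvgP[[N1 _ h1] /cvgrPdist_lt /(_ e e0) [N2 _ h2]].
(* The successor makes the radius positive. *)
exists (maxn N1 N2).+1%:R => //.
have := h1 (maxn N1 N2).+1 (leqW (leq_maxl _ _)).
have := h2 (maxn N1 N2).+1 (leqW (leq_maxr _ _)).
move=> /= h3 h4; rewrite -(fineK h4) lee_fin.
by move: h3; rewrite sub0r normrN => /ltW; apply: le_trans; rewrite ler_norm.
Unshelve. all: by end_near. Qed.

End Weight.

(** * Strongly measurable functions below the weight *)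

Section Domination.
Context (R : realType) (X : normedModType R[i]).
Local Notation mu := (@lebesgue_measure R).

(** The given step functions converge almost everywhere but are not dominated. Each is cut to the
    set where its norm is at most 2g, with g a multiple of the weight that bounds [f]. As g > 0
    (hence the +1 in [A']), the cut is eventually inactive at each point, and dominated convergence
    applies with bound 3g. *)
Lemma strongly_measurable_Lint p (f : R -> X) A : 1 < p ->
  strongly_measurable f -> (forall t, nrm (f t) <= A * wt p t) -> Lint f.
Proof.
move=> p1 [n [S [v [aS [B [mB B0 fB]]]]]] fA.
pose u k := lst (S k) (v k).
have au k : adm (u k) by exact: adm_lst.
have fB' t : ~ B t -> (fun k => sfl (u k) t) @ \oo --> f t.
  move=> nB; under eq_fun do rewrite sfl_lst.
  by apply: contra_notP nB => h; apply: fB.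
pose A' := `|A| + 1; have A0 : 0 < A' by rewrite ltr_wpDl.
pose g t := A' * wt p t.
have fg t : nrm (f t) <= g t.
  apply: le_trans (fA t) _; rewrite ler_wpM2r ?wt_ge0//.
  by rewrite (le_trans (ler_norm A))// lerDl.
have g0 t : 0 < g t by rewrite mulr_gt0// wt_gt0.
have mg : measurable_fun setT g.
  by apply: measurable_funM; [exact: measurable_cst|exact: measurable_wt].
pose E k := [set t : R | nrm (sfl (u k) t) <= 2 * g t].
have mE k : measurable (E k).
  rewrite -[X in measurable X]setTI.
  apply: (measurable_fun_ler (f := fun t => nrm (sfl (u k) t)) (g := fun t => 2 * g t) _ _ measurableT (Y := [set true])) => //.
    have := @measurable_nrm_sfl _ X (u k) 0 (au k).
    by under eq_fun do rewrite addr0.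
  by apply: measurable_funM.
pose l k := restr (E k) (u k).
have al k : adm (l k) by exact: adm_restr.
have mC : measurable (~` B) by exact: measurableC.
have lg k t : nrm (f t - sfl (l k) t) <= 3 * g t.
  rewrite (le_trans (nrmB _ _))// sfl_restr.
  case: ifPn => [/asboolP h|_]; last first.
    by rewrite nrm0; have := fg t; have := ltW (g0 t); lra.
  by move: h; rewrite /E /=; have := fg t; lra.
pose d k t := (nrm (f t - sfl (l k) t))%:E.
have md k : measurable_fun (~` B) (d k).
  by apply/measurable_EFinP; apply: measurable_nrm_diff mB au (al k) fB'.
have dcvg t : ~ B t -> (fun k => d k t) @ \oo --> 0%E.
  move=> nB; apply: cvg_EFin; first exact: nearW.
  apply/cvgrPdist_lt => e e0.
  have /nrm_cvgP h := fB' t nB.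
  have [N1 h1] := h e e0; have [N2 h2] := h (g t) (g0 t).
  exists (maxn N1 N2) => // k /= Nk.
  rewrite sub0r normrN ger0_norm ?nrm_ge0// sfl_restr ifT.
    by rewrite nrm_distC h1// (leq_trans (leq_maxl _ _) Nk).
  apply/asboolP; rewrite /E /=.
  have := nrm_le_dist (sfl (u k) t) (f t).
  by have := h2 k (leq_trans (leq_maxr _ _) Nk); have := fg t; lra.
have ig : mu.-integrable (~` B) (fun t => (3 * g t)%:E).
  apply: (integrableS measurableT) => //.
  rewrite (_ : (fun t => _) = (fun t => (3 * A')%:E * (EFin \o wt p) t)%E).
    by apply: integrableZl => //; exact: integrable_wt.
  by apply/funext => t; rewrite /g /= -EFinM mulrA.
have ddom t : forall k, (~` B) t -> (`|d k t| <= (3 * g t)%:E)%E.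
  by move=> k _; rewrite /d /= lee_fin ger0_norm ?nrm_ge0.
have := @dominated_convergence _ _ _ mu (~` B) mC d (cst 0%E) (fun t => (3 * g t)%:E).
move=> /(_ md (measurable_cst _) (aeW mu dcvg) ig (aeW mu ddom)) [_ + _].
move=> /= /fine_cvgP[[N1 _ h1] /cvgrPdist_lt h0] e e0.
have [N2 _ h2] := h0 e e0.
have := h1 (maxn N1 N2) (leq_maxl _ _).
have := h2 (maxn N1 N2) (leq_maxr _ _).
set k := maxn N1 N2; move=> /= h3 h4.
exists (l k); split => //; apply: (N1le_mu mB B0).
  by apply/measurable_EFinP; exact: (md k).
have -> : (\int[mu]_(t in ~` B) (nrm (f t - sfl (l k) t))%:E)%E =
    (\int[mu]_(x in ~` B) `|d k x - 0|)%E.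
  by apply: eq_integral => t _; rewrite sube0 gee0_abs// lee_fin nrm_ge0.
rewrite -(fineK h4) lee_fin.
by move: h3; rewrite sub0r normrN => /ltW; apply: le_trans; rewrite ler_norm.
Qed.
End Domination.

(** * Convolution of nonnegative functions *)

Section ScalarConvolution.
Context (R : realType).
Local Notation mu := (@lebesgue_measure R).
Local Open Scope ereal_scope.
Implicit Types (g h : R -> \bar R).

(** The value +oo is allowed, so that Tonelli applies to majorants with no integrability
    condition. *)
Definition cvm g h (t : R) : \bar R := \int[mu]_s (g s * h (t - s)%R).

Lemma integral_shift a h : measurable_fun setT h -> (forall t, 0 <= h t) ->
  \int[mu]_t h (t - a)%R = \int[mu]_t h t.
Proof.
move=> mh h0; rewrite -(integral_refl 0 mh h0).
have mh' : measurable_fun setT (fun t : R => h (0 - t)%R).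
  exact: (measurableT_comp mh (measurable_refl 0)).
rewrite -(integral_refl a mh')//.
by apply: eq_integral => t _; rewrite sub0r opprB.
Qed.

Lemma measurable_prod_mul g h : measurable_fun setT g -> measurable_fun setT h ->
  measurable_fun setT (fun z : measurableTypeR R * measurableTypeR R => g z.2 * h (z.1 - z.2)%R).
Proof.
move=> mg mh; apply: emeasurable_funM.
  exact: (measurableT_comp mg measurable_snd).
apply: (measurableT_comp mh).
by apply: measurable_funB; [exact: measurable_fst|exact: measurable_snd].
Qed.

Lemma cvm_ge0 g h t : (forall t, 0 <= g t) -> (forall t, 0 <= h t) -> 0 <= cvm g h t.
Proof. by move=> g0 h0; apply: integral_ge0 => s _; rewrite mule_ge0. Qed.

Lemma measurable_cvm g h : measurable_fun setT g -> measurable_fun setT h ->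
  (forall t, 0 <= g t) -> (forall t, 0 <= h t) -> measurable_fun setT (cvm g h).
Proof.
move=> mg mh g0 h0.
exact: (@measurable_fun_fubini_tonelli_F _ _ _ _ _ mu _ (measurable_prod_mul mg mh)
  (fun z => mule_ge0 (g0 z.2) (h0 (z.1 - z.2)%R))).
Qed.

Lemma integral_cvm g h : measurable_fun setT g -> measurable_fun setT h ->
  (forall t, 0 <= g t) -> (forall t, 0 <= h t) ->
  \int[mu]_t cvm g h t = \int[mu]_t g t * \int[mu]_t h t.
Proof.
move=> mg mh g0 h0.
have := @fubini_tonelli _ _ _ _ _ mu mu _ (measurable_prod_mul mg mh)
  (fun z => mule_ge0 (g0 z.2) (h0 (z.1 - z.2)%R)).
rewrite /fubini_F /fubini_G /= => ->.
rewrite muleC -ge0_integralZl//; last exact: integral_ge0.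
apply: eq_integral => s _; rewrite ge0_integralZl//; last first.
- exact: (measurableT_comp mh (measurable_funB (@measurable_id _ _ setT) (measurable_cst _))).
by rewrite integral_shift// muleC.
Qed.


Lemma cvm_assoc a b c t : measurable_fun setT a -> measurable_fun setT b ->
  measurable_fun setT c ->
  (forall t, 0 <= a t) -> (forall t, 0 <= b t) -> (forall t, 0 <= c t) ->
  cvm a (cvm b c) t = cvm (cvm a b) c t.
Proof.
move=> ma mb mc a0 b0 c0.
have mcr : measurable_fun setT (fun u : R => c (t - u)%R).
  exact: (measurableT_comp mc (measurable_refl t)).
have mF : measurable_fun setT (fun z : measurableTypeR R * measurableTypeR R =>
   a z.2 * b (z.1 - z.2)%R * c (t - z.1)%R).
  apply: emeasurable_funM; first exact: measurable_prod_mul.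
  exact: (measurableT_comp mcr measurable_fst).
have := @fubini_tonelli _ _ _ _ _ mu mu _ mF
  (fun z => mule_ge0 (mule_ge0 (a0 z.2) (b0 (z.1 - z.2)%R)) (c0 (t - z.1)%R)).
rewrite /fubini_F /fubini_G /= => h.
transitivity (\int[mu]_y (\int[mu]_x (a y * b (x - y)%R * c (t - x)%R))).
  apply: eq_integral => s _; rewrite /cvm.
  have mq : measurable_fun setT (fun x : R => b x * c (t - s - x)%R).
    apply: emeasurable_funM; first exact: mb.
    exact: (measurableT_comp mc (measurable_refl (t - s)%R)).
  rewrite -(integral_shift s mq); last by move=> x; rewrite mule_ge0.
  rewrite -ge0_integralZl.
  - apply: eq_integral => x _; rewrite muleA; congr (_ * _ * c _); ring.
  - exact: measurableT.
  - exact: (measurableT_comp mq (measurable_funB (@measurable_id _ _ setT) (measurable_cst _))).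
  - by move=> x _; rewrite mule_ge0.
  - exact: a0.
rewrite -h; apply: eq_integral => u _.
rewrite [in RHS]/cvm muleC -ge0_integralZl.
- by apply: eq_integral => s _; rewrite muleC.
- exact: measurableT.
- apply: emeasurable_funM; first exact: ma.
  exact: (measurableT_comp mb (measurable_refl u)).
- by move=> s _; rewrite mule_ge0.
- exact: c0.
Qed.

End ScalarConvolution.

Section WeightConvolution.
Context (R : realType).
Local Notation mu := (@lebesgue_measure R).

(** One of |s| and |t - s| is at least |t|/2; the weight at that point exceeds the weight at t by a
    factor of at most 2^p. *)
Lemma wt_cvm_pointwise p (s t : R) : 0 <= p ->
  wt p s <= 2 `^ p * wt p t \/ wt p (t - s) <= 2 `^ p * wt p t.
Proof.
move=> p0; have [h|h] := leP `|t| (2 * `|s|).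
  by left; exact: wt_le.
right; apply: wt_le => //.
have := ler_normD (t - s) s; rewrite subrK; lra.
Qed.

(** At each s one factor is bounded through its weight at t, and the other one is integrated. The
    result pairs the weighted bound of one factor with the L^1 bound of the other, never two
    weighted bounds; this is what makes a condition on the L^1 size alone sufficient for Neumann
    series. *)
Lemma cvm_wt p (g h : R -> \bar R) A B a b (t : R) : 0 <= p ->
  0 <= A -> 0 <= B ->
  measurable_fun setT g -> measurable_fun setT h ->
  (forall t, (0 <= g t)%E) -> (forall t, (0 <= h t)%E) ->
  (forall t, (g t <= (A * wt p t)%:E)%E) -> (forall t, (h t <= (B * wt p t)%:E)%E) ->
  (\int[mu]_t g t <= a%:E)%E -> (\int[mu]_t h t <= b%:E)%E ->
  (cvm g h t <= (2 `^ p * (A * b + B * a) * wt p t)%:E)%E.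
Proof.
move=> p0 A0 B0 mg mh g0 h0 gA hB ga hb.
pose C := 2 `^ p * wt p t.
have C0 : 0 <= C by rewrite mulr_ge0 ?powR_ge0 ?wt_ge0.
have mhr : measurable_fun setT (fun s : R => h (t - s)).
  exact: (measurableT_comp mh (measurable_refl t)).
have CA0 : (0 <= (C * A)%:E)%E by rewrite lee_fin mulr_ge0.
have CB0 : (0 <= (C * B)%:E)%E by rewrite lee_fin mulr_ge0.
apply: (@le_trans _ _ (\int[mu]_s ((C * A)%:E * h (t - s)%R + (C * B)%:E * g s))%E).
  apply: le_lower_integral => s; first by rewrite mule_ge0.
  have [ws|ws] := wt_cvm_pointwise s t p0.
    apply: (@le_trans _ _ ((C * A)%:E * h (t - s)%R)%E); last by rewrite leeDl// mule_ge0.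
    rewrite lee_wpmul2r// (le_trans (gA s))// lee_fin mulrC ler_wpM2r//.
  apply: (@le_trans _ _ ((C * B)%:E * g s)%E); last by rewrite leeDr// mule_ge0.
  by rewrite muleC lee_wpmul2r// (le_trans (hB _))// lee_fin mulrC ler_wpM2r.
rewrite ge0_integralD//; last 4 first.
- by move=> s _; rewrite mule_ge0.
- exact: measurable_funeM.
- by move=> s _; rewrite mule_ge0.
- exact: measurable_funeM.
rewrite !ge0_integralZl// integral_refl//.
apply: (@le_trans _ _ ((C * A)%:E * b%:E + (C * B)%:E * a%:E)%E).
  by apply: leeD; rewrite lee_wpmul2l.
by rewrite -!EFinM -EFinD lee_fin /C le_eqVlt; apply/orP; left; apply/eqP; ring.
Qed.
End WeightConvolution.

Lemma measurable_le (R : realType) (f g : R -> R) : measurable_fun setT f ->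
  measurable_fun setT g -> measurable [set t : R | f t <= g t].
Proof.
move=> mf mg; rewrite -[X in measurable X]setTI.
exact: (measurable_fun_ler mf mg measurableT (Y := [set true])).
Qed.

(** * Integrals of a scalar function times a fixed vector *)

Section ScalarFunctions.
Context (R : realType) (X : completeNormedModType R[i]).
Local Notation mu := (@lebesgue_measure R).
Implicit Types (phi : R -> R) (A : set R) (x : X).

Definition approx phi A x e l := [/\ adm l,
    forall t, nrm ((if `[< A t >] then (phi t)%:C%C *: x else 0) - sfl l t) <=
       (if `[< A t >] then e * nrm x else 0) &
    nrm ((fine (\int[mu]_(t in A) (phi t)%:E))%:C%C *: x - sil l) <= e * fine (mu A) * nrm x].

Lemma integral_bounds phi A a b : measurable_fun setT phi -> 0 <= a ->
  finm A -> (forall t, A t -> a <= phi t <= b) ->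
  ((a * fine (mu A))%:E <= \int[mu]_(t in A) (phi t)%:E <= (b * fine (mu A))%:E)%E.
Proof.
move=> mphi a0 fA h; have [mA _] := fA.
have mphiA : measurable_fun A (fun t => (phi t)%:E).
  by apply/measurable_EFinP; exact: measurable_funTS.
rewrite !EFinM (fin_mu fA) -!integral_cst//; apply/andP; split; apply: ge0_le_integral => //=.
- by move=> t At; rewrite lee_fin; case/andP: (h t At).
- by move=> t At; rewrite lee_fin; case/andP: (h t At) => h1 _; rewrite (le_trans a0).
- by move=> t At; rewrite lee_fin; case/andP: (h t At).
Qed.

Lemma simple_approx_flat phi A x e a : measurable_fun setT phi -> 0 <= a -> 0 < e ->
  finm A -> (forall t, A t -> a <= phi t <= a + e) -> approx phi A x e [:: (A, a%:C%C *: x)].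
Proof.
move=> mphi a0 e0 fA h; split => //.
  move=> t; rewrite /sfl big_seq1 /=; case: ifPn => [/asboolP /h /andP[h1 h2]|_].
    rewrite -scalerBl -rmorphB/= nrmZr ler_wpM2r ?nrm_ge0//.
    by rewrite ger0_norm ?subr_ge0// lerBlDl.
  by rewrite subrr nrm0.
have /andP[h1 h2] := integral_bounds mphi a0 fA h.
have iE : (\int[mu]_(t in A) (phi t)%:E \is a fin_num)%E.
  by rewrite fin_numElt (lt_le_trans _ h1) ?ltNyr// (le_lt_trans h2)// ltry.
move: h1 h2; rewrite -(fineK iE) !lee_fin => h1 h2.
rewrite /sil big_seq1 /= scalerA -scalerBl -rmorphM -rmorphB/= nrmZr ler_wpM2r ?nrm_ge0//.
by rewrite mulrC ger0_norm ?subr_ge0// lerBlDl -mulrDl.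
Qed.

(* The range of phi is cut into n slices of height e. *)
Lemma simple_approx phi A x e a n : measurable_fun setT phi -> 0 <= a -> 0 < e ->
  finm A -> (forall t, A t -> a <= phi t <= a + n%:R * e) ->
  exists l, approx phi A x e l.
Proof.
move=> mphi + e0; elim: n a A => [|n IH] a A a0 fA hA.
  eexists; apply: (simple_approx_flat x mphi a0 e0 fA) => // t /hA.
  by rewrite mul0r addr0 => /andP[-> h] /=; rewrite (le_trans h)// lerDl ltW.
pose E := [set t : R | phi t <= a + e].
have mE : measurable E by exact: measurable_le mphi (measurable_cst _).
have ae0 : 0 <= a + e by rewrite addr_ge0// ltW.
have h1 t : (A `&` E) t -> a <= phi t <= a + e.
  by case=> /hA/andP[-> _].
have h2 t : (A `\` E) t -> a + e <= phi t <= a + e + n%:R * e.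
  move=> [At /negP]; rewrite -ltNge => h; rewrite (ltW h)/=.
  by move: (hA t At) => /andP[_]; rewrite -natr1; lra.
have fA1 := finmI fA mE; have fA2 := finmD fA mE.
have [al1 sl1 il1] := simple_approx_flat x mphi a0 e0 fA1 h1.
have [l2 [al2 sl2 il2]] := IH (a + e) (A `\` E) ae0 fA2 h2.
have [mA _] := fA; have [mA1 _] := fA1; have [mA2 _] := fA2.
have AE : A = (A `&` E) `|` (A `\` E) by rewrite setDE -setIUr setUv setIT.
have A0 : (A `&` E) `&` (A `\` E) = set0 by rewrite setDE setIACA setICr setI0.
have phiA t : A t -> 0 <= phi t by move=> /hA /andP[+ _]; exact: le_trans.
exists ([:: (A `&` E, a%:C%C *: x)] ++ l2); split; first exact: adm_cat.
  move=> t; rewrite sfl_cat; have := sl1 t; have := sl2 t.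
  have [At|nAt] := pselect (A t); last first.
    rewrite !asboolF//; [|by case..].
    move=> u v; rewrite (_ : _ - _ = (0 - sfl [:: (A `&` E, a%:C%C *: x)] t) + (0 - sfl l2 t)); last by zmod.
    by rewrite (le_trans (nrmD _ _))// -[leRHS]addr0 lerD.
  rewrite [`[< A t >]]asboolT//.
  have [Et|nEt] := pselect (E t).
    rewrite asboolF; last by case.
    rewrite asboolT// => u v.
    rewrite (_ : _ - _ = ((phi t)%:C%C *: x - sfl [:: (A `&` E, a%:C%C *: x)] t) + (0 - sfl l2 t)); last by zmod.
    by rewrite (le_trans (nrmD _ _))// -[leRHS]addr0 lerD.
  rewrite asboolT// asboolF; last by case.
  move=> u v; rewrite (_ : _ - _ = (0 - sfl [:: (A `&` E, a%:C%C *: x)] t) + ((phi t)%:C%C *: x - sfl l2 t)); last by zmod.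
  by rewrite (le_trans (nrmD _ _))// -[leRHS]add0r lerD.
have iA : (\int[mu]_(t in A) (phi t)%:E = \int[mu]_(t in A `&` E) (phi t)%:E + \int[mu]_(t in A `\` E) (phi t)%:E)%E.
  rewrite {1}AE ge0_integral_setU//.
  - by apply/measurable_EFinP; exact: measurable_funTS.
  - by move=> t; rewrite -AE => /phiA; rewrite lee_fin.
  - by rewrite disj_set2E A0.
have fin (B : set R) (b c : R) : 0 <= b -> finm B -> (forall t, B t -> b <= phi t <= c) -> (\int[mu]_(t in B) (phi t)%:E \is a fin_num)%E.
  move=> b0 fB hB; have /andP[u v] := integral_bounds mphi b0 fB hB.
  by rewrite fin_numElt (lt_le_trans _ u) ?ltNyr// (le_lt_trans v)// ltry.
have muA : fine (mu A) = fine (mu (A `&` E)) + fine (mu (A `\` E)).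
  by rewrite {1}AE (measureU mu)// fineD// ge0_fin_numE//; [case: fA1|case: fA2].
rewrite iA fineD ?(fin _ _ _ a0 fA1 h1) ?(fin _ _ _ ae0 fA2 h2)//.
rewrite sil_cat rmorphD/= scalerDl muA mulrDr mulrDl.
by rewrite opprD addrACA (le_trans (nrmD _ _))// lerD.
Qed.

(** Reduces such an integral to a Lebesgue integral: on the set where |t| and phi are at most n the
    function is sliced by height, and the remainder has a small integral r by dominated
    convergence. *)
Lemma isI_scalar phi x c : measurable_fun setT phi -> (forall t, 0 <= phi t) ->
  (\int[mu]_t (phi t)%:E = c%:E)%E -> isI (fun t => (phi t)%:C%C *: x) (c%:C%C *: x).
Proof.
move=> mphi phi0 ic.
pose E (n : nat) := [set t : R | `|t| <= n%:R] `&` [set t | phi t <= n%:R].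
have mE n : measurable (E n).
  apply: measurableI.
    by apply: (@measurable_le R (fun t => `|t|) (cst n%:R)); [exact: normr_measurable|exact: measurable_cst].
  exact: measurable_le mphi (measurable_cst _).
have fE n : finm (E n).
  split => //.
  have leE : (mu (E n) <= mu (`[(- n%:R)%R, n%:R%R]%classic : set R))%E.
    apply: le_measure; rewrite ?inE; [exact: mE|exact: measurable_itv|].
    by move=> t [/= h _]; rewrite /= in_itv/= -ler_norml.
  apply: le_lt_trans leE _.
  by rewrite lebesgue_measure_itv/=; case: ifP => _; rewrite -?EFinB ltry.
have ephi : mu.-integrable setT (EFin \o phi).
  apply/integrableP; split; first exact/measurable_EFinP.
  by under eq_integral do rewrite /= ger0_norm//; rewrite ic ltry.
pose f (n : nat) (t : R) : \bar R := (if `[< E n t >] then 0 else phi t)%:E.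
have mf n : measurable_fun setT (f n).
  apply/measurable_EFinP; rewrite (_ : (fun t => _) = (phi \_ (~` E n))).
    by apply/(measurable_restrictT _ (measurableC (mE n))); exact: measurable_funTS.
  apply/funext => t; rewrite /patch; case: ifPn => [/asboolP h|/asboolP h].
    by rewrite memNset.
  by rewrite mem_set.
have fcvg t : setT t -> (fun n => f n t) @ \oo --> 0%E.
  move=> _; apply: cvg_EFin; first exact: nearW.
  apply/cvgrPdist_lt => d d0; near=> n.
  have En : E n t by split => /=; apply: ltW; near: n; exact: nbhs_infty_gtr.
  by rewrite /f /= asboolT// subrr normr0.
have fdom t : forall n, setT t -> (`|f n t| <= (EFin \o phi) t)%E.
  move=> n _; rewrite /f /= lee_fin; case: ifP => _; first by rewrite normr0.
  by rewrite ger0_norm.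
have := @dominated_convergence _ _ _ mu setT measurableT f (cst 0%E) (EFin \o phi).
move=> /(_ mf (measurable_cst _) (aeW mu fcvg) ephi (aeW mu fdom)) [_ _ /=].
rewrite integral0 => /fine_cvgP[[N1 _ h1] /cvgrPdist_lt h2] e e0.
(* So that d times [nrm x] is at most e/2, also for x = 0. *)
pose d := e / (2 * (nrm x + 1)).
have nx1 : 0 < nrm x + 1 by rewrite ltr_wpDl// nrm_ge0.
have d0 : 0 < d by rewrite divr_gt0// mulr_gt0.
have [N2 _ h3] := h2 d d0; pose n := maxn N1 N2.
have intf : exists2 r, (\int[mu]_t f n t = r%:E)%E & 0 <= r <= d.
  have := h3 n (leq_maxr _ _); have h4 := h1 n (leq_maxl _ _).
  rewrite /= sub0r normrN => /ltW h5; exists (fine (\int[mu]_t f n t)%E); first by rewrite fineK.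
  apply/andP; split; last by apply: le_trans h5; exact: ler_norm.
  by apply/fine_ge0/integral_ge0 => t _; rewrite lee_fin; case: ifP.
have [r ir /andP[r0 rd]] := intf.
have cE : (\int[mu]_(t in E n) (phi t)%:E = (c - r)%:E)%E.
  have : (\int[mu]_(t in E n) (phi t)%:E + \int[mu]_t f n t = c%:E)%E.
    rewrite -ic integral_mkcond -ge0_integralD//.
    - apply: eq_integral => t _; rewrite /f /patch -[t \in E n]/`[< E n t >].
      by case: ifP; rewrite ?adde0 ?add0e.
    - by move=> t _; apply: erestrict_ge0 => *; rewrite lee_fin.
    - apply/(measurable_restrictT _ (mE n)); apply/measurable_EFinP; exact: measurable_funTS.
    - by move=> t _; rewrite lee_fin; case: ifP.
    - exact: mf.
  by rewrite ir => h; rewrite EFinB -h addeK.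
pose M := fine (mu (E n)) + 1.
have M0 : 0 < M by rewrite ltr_wpDl// fine_ge0.
pose e' := d / M; have e'0 : 0 < e' by rewrite divr_gt0.
(* Slices of height [e'], as many as are needed to pass the bound n of phi; [e'] times the measure
   of [E n] is at most d. *)
have [|l [al sl il]] := @simple_approx phi (E n) x e' 0 (Num.truncn (n%:R / e')).+1 mphi (lexx _) e'0 (fE n).
  move=> t [_ /= h]; rewrite phi0 add0r (le_trans h)//= -ler_pdivrMr//.
  by rewrite ltW// truncnS_gt.
have dx : d * nrm x <= e / 2.
  rewrite /d invfM mulrA -mulrA ler_piMr ?divr_ge0 ?ltW//.
  by rewrite mulrC ltr_pdivrMr// mul1r ltrDl.
exists l; split => //.
  have Ha : N1le (fun t => (if `[< E n t >] then 0 else phi t)%:C%C *: x) (e / 2).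
    apply: N1leW (dx); exists (fun t => f n t * (nrm x)%:E)%E; split.
    - by apply: emeasurable_funM => //; exact: measurable_cst.
    - by move=> t; rewrite mule_ge0// lee_fin ?nrm_ge0//; case: ifP.
    - by move=> t; rewrite nrmZr -EFinM lee_fin ger0_norm//; case: ifP.
    - rewrite ge0_integralZr; last 4 first.
        exact: measurableT.
        exact: mf.
        by move=> t _; rewrite lee_fin; case: ifP.
        by rewrite lee_fin nrm_ge0.
      by rewrite ir -EFinM lee_fin ler_wpM2r ?nrm_ge0.
  have Hb : N1le (fun t => (if `[< E n t >] then (phi t)%:C%C *: x else 0) - sfl l t) (e / 2).
    apply: N1leW (dx); exists (fun t => (if `[< E n t >] then e' * nrm x else 0)%:E); split.
    - apply/measurable_EFinP; rewrite (_ : (fun t => _) = ((fun=> e' * nrm x) \_ (E n))).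
        by apply/(measurable_restrictT _ (mE n)); exact: measurable_cst.
      by apply/funext.
    - by move=> t; rewrite lee_fin; case: ifP => // _; rewrite mulr_ge0 ?nrm_ge0 ?ltW.
    - by move=> t; rewrite lee_fin.
    - rewrite (_ : (fun t => _) = (((fun=> (e' * nrm x)%:E) : R -> \bar R) \_ (E n))); last first.
        by apply/funext => t; rewrite /patch -[t \in E n]/`[< E n t >]; case: ifP.
      rewrite -integral_mkcond.
      apply: (@le_trans _ _ (e' * nrm x * fine (mu (E n)))%:E).
        rewrite integral_cst; last exact: mE.
        by rewrite (EFinM (e' * nrm x)) (fin_mu (fE n)).
      rewrite lee_fin mulrAC ler_wpM2r ?nrm_ge0//.
      by rewrite /e' mulrAC ler_pdivrMr// ler_wpM2l ?(ltW d0)// /M lerDl.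
  rewrite (splitr e); apply: N1le_le (N1leD Ha Hb) => t.
  rewrite addrA le_eqVlt; apply/orP; left; apply/eqP; congr (nrm (_ - _)).
  by case: ifP; rewrite ?scale0r ?add0r ?addr0.
rewrite (_ : c%:C%C *: x - sil l = r%:C%C *: x + ((c - r)%:C%C *: x - sil l)); last first.
  by rewrite addrA -scalerDl -rmorphD/= [r + _]addrC subrK.
rewrite (le_trans (nrmD _ _))// [leRHS]splitr; apply: lerD.
  by apply: le_trans dx; rewrite nrmZr ger0_norm// ler_wpM2r ?nrm_ge0.
rewrite cE /= in il; apply: le_trans il _; apply: le_trans dx.
by rewrite ler_wpM2r ?nrm_ge0// /e' mulrAC ler_pdivrMr// ler_wpM2l ?(ltW d0)// /M lerDl.
Unshelve. all: by end_near. Qed.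

End ScalarFunctions.

(** * Convolution of operator-valued kernels *)

Section Kernels.
Context (R : realType) (X : completeNormedModType R[i]).
Local Notation mu := (@lebesgue_measure R).
Implicit Types (f g : R -> X) (k : R -> X -> X) (K : X -> X).

Definition islin K := forall (a : R[i]) x y, K (a *: x + y) = a *: K x + K y.

Lemma islinD K : islin K -> {morph K : x y / x + y}.
Proof. by move=> h x y; have := h 1 x y; rewrite !scale1r. Qed.

Lemma islin0 K : islin K -> K 0 = 0.
Proof. by move=> h; have := h (-1) 0 0; rewrite !scaleN1r oppr0 addr0 addNr. Qed.

Lemma islinZ K a x : islin K -> K (a *: x) = a *: K x.
Proof. by move=> h; have := h a x 0; rewrite (islin0 h) !addr0. Qed.

Lemma islinN K x : islin K -> K (- x) = - K x.
Proof. by move=> h; rewrite -scaleN1r (islinZ _ _ h) scaleN1r. Qed.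

Lemma islinB K : islin K -> {morph K : x y / x - y}.
Proof. by move=> h x y; rewrite (islinD h) (islinN _ h). Qed.

Lemma LintD f g : Lint f -> Lint g -> Lint (fun t => f t + g t).
Proof. by move=> /bintP hf /bintP hg; exact: isI_Lint (isID hf hg). Qed.

Lemma LintB f g : Lint f -> Lint g -> Lint (fun t => f t - g t).
Proof. by move=> /bintP hf /bintP hg; exact: isI_Lint (isIB hf hg). Qed.

Lemma LintZ (a : R[i]) f : Lint f -> Lint (fun t => a *: f t).
Proof. by move=> /bintP hf; exact: isI_Lint (isIZ a hf). Qed.

Lemma Lint_refl a f : Lint f -> Lint (fun t => f (a - t)).
Proof. by move=> /bintP hf; exact: isI_Lint (isI_refl a hf). Qed.

Lemma Lint_sfl l : adm l -> Lint (@sfl R X l).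
Proof. by move=> /isI_sfl; exact: isI_Lint. Qed.

Lemma Lint_indic A v : finm A -> Lint (fun t : R => if `[< A t >] then v else 0 : X).
Proof. by move=> fA; exact: isI_Lint (isI_indic v fA). Qed.

Lemma Lint_if (E : set R) f : measurable E -> Lint f ->
  Lint (fun t => if `[< E t >] then f t else 0).
Proof.
move=> mE hf e e0; have [l [al fl]] := hf e e0.
exists (restr E l); split; first exact: adm_restr.
apply: N1le_le fl => t; rewrite sfl_restr.
by case: ifP; rewrite ?subrr ?nrm0 ?nrm_ge0.
Qed.

(** Density of step functions in L^1, in the form of an induction principle. *)
Lemma Lint_rect (P : (R -> X) -> Prop) :
  (forall A v, finm A -> P (fun t => if `[< A t >] then v else 0)) ->
  P (fun=> 0) ->
  (forall f g, Lint f -> Lint g -> P f -> P g -> P (fun t => f t + g t)) ->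
  (forall f, Lint f -> (forall e, 0 < e ->
     exists g, [/\ Lint g, P g & N1le (fun t => f t - g t) e]) -> P f) ->
  forall f, Lint f -> P f.
Proof.
move=> PA P0 PD Plim f hf.
have Ps l : adm l -> P (@sfl R X l).
  elim: l => [_|[A v] l IH /= [fA al]].
    by rewrite (_ : sfl _ = fun=> 0)//; apply/funext => t; rewrite /sfl big_nil.
  rewrite (_ : sfl _ = fun t => (if `[< A t >] then v else 0) + sfl l t).
    by apply: PD; [exact: Lint_indic|exact: Lint_sfl|exact: PA|exact: IH].
  by apply/funext => t; rewrite /sfl big_cons.
apply: Plim => // e e0; have [l [al fl]] := hf e e0.
by exists (sfl l); split => //; [exact: Lint_sfl|exact: Ps].
Qed.

(** For an indicator times v the function is s -> k(s)v cut to a set, which is integrable by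
    hypothesis; the uniform bound M carries this to L^1 limits. No measurability of k in operator
    norm is needed. *)
Lemma Lint_kapp k M f : 0 <= M -> (forall t, islin (k t)) ->
  (forall x, Lint (k^~ x)) -> (forall t x, nrm (k t x) <= M * nrm x) ->
  Lint f -> Lint (fun s => k s (f s)).
Proof.
move=> M0 kl kx kM; move: f; apply: Lint_rect.
- move=> A v fA; rewrite (_ : (fun s => _) = fun s => if `[< A s >] then k s v else 0).
    by apply: Lint_if; [case: fA|exact: kx].
  by apply/funext => s; case: ifP => // _; rewrite (islin0 (kl s)).
- rewrite (_ : (fun s => _) = fun=> 0); first exact: Lint0.
  by apply/funext => s; rewrite (islin0 (kl s)).
- move=> f g _ _ hf hg; rewrite (_ : (fun s => _) = fun s => k s (f s) + k s (g s)).
    exact: LintD.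
  by apply/funext => s; rewrite (islinD (kl s)).
- move=> f hf h; apply: Lint_lim => e e0.
  have M1 : 0 < M + 1 by rewrite ltr_wpDl.
  have [g [hg kg fg]] := h _ (divr_gt0 e0 M1).
  exists (fun s => k s (g s)); split => //.
  apply: (@N1leW _ _ _ (M * (e / (M + 1)))); last first.
    by rewrite mulrA ler_pdivrMr// mulrC ler_wpM2l ?(ltW e0)// lerDl.
  by apply: N1le_dom (fg) => // s; rewrite -(islinB (kl s)).
Qed.

(** [g] stands in for the operator norm of [k t], which need not be measurable. *)
Definition maj k (g : R -> \bar R) := [/\ measurable_fun setT g, forall t, (0 <= g t)%E &
  forall t x, ((nrm (k t x))%:E <= g t * (nrm x)%:E)%E].

(** The uniform bound makes the convolution with an integrable function exist at every t, not just
    at almost every t. *)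
Definition bker k M := [/\ 0 <= M, forall t, islin (k t), forall x, Lint (k^~ x) &
  forall t x, nrm (k t x) <= M * nrm x].

Definition conv k f (t : R) : X := bint (fun s => k s (f (t - s))).

Lemma Lint_kconv k M f t : bker k M -> Lint f -> Lint (fun s => k s (f (t - s))).
Proof. by move=> [M0 kl kx kM] hf; apply: (Lint_kapp M0 kl kx kM); exact: Lint_refl. Qed.

Lemma convP k M f t : bker k M -> Lint f ->
  isI (fun s => k s (f (t - s))) (conv k f t).
Proof. by move=> bk hf; apply: bintP; exact: Lint_kconv bk hf. Qed.

Lemma conv_bound k M f c t : bker k M -> Lint f -> N1le f c ->
  nrm (conv k f t) <= M * c.
Proof.
move=> bk hf fc; apply: isI_bound (convP t bk hf) _.
by case: bk => M0 _ _ kM; apply: (N1le_dom M0) (N1le_refl t fc) => s.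
Qed.

Lemma convD k M f g t : bker k M -> Lint f -> Lint g ->
  conv k (fun t => f t + g t) t = conv k f t + conv k g t.
Proof.
move=> bk hf hg; apply: bintE.
have := isID (convP t bk hf) (convP t bk hg).
by case: bk => _ kl _ _; under eq_fun do rewrite -(islinD (kl _)).
Qed.

Lemma convB k M f g t : bker k M -> Lint f -> Lint g ->
  conv k (fun t => f t - g t) t = conv k f t - conv k g t.
Proof.
move=> bk hf hg; apply: bintE.
have := isIB (convP t bk hf) (convP t bk hg).
by case: bk => _ kl _ _; under eq_fun do rewrite -(islinB (kl _)).
Qed.

Lemma conv0 k M t : bker k M -> conv k (fun=> 0) t = 0.
Proof.
case=> _ kl _ _; apply: bintE; under eq_fun do rewrite (islin0 (kl _)).
exact: Lint_isI0.
Qed.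

Lemma conv_maj k M (g : R -> \bar R) f (h : R -> \bar R) t : bker k M -> maj k g -> Lint f ->
  measurable_fun setT h -> (forall t, (0 <= h t)%E) ->
  (forall t, ((nrm (f t))%:E <= h t)%E) ->
  ((nrm (conv k f t))%:E <= cvm g h t)%E.
Proof.
move=> bk [mg g0 kg] hf mh h0 fh.
have c0 : (0 <= cvm g h t)%E by exact: cvm_ge0.
move: c0; case E : (cvm g h t) => [c| |]; [|by move=> _; rewrite leey|by rewrite leeNy_eq].
move=> _; rewrite lee_fin; apply: isI_bound (convP t bk hf) _.
exists (fun s => g s * h (t - s)%R)%E; split.
- by apply: emeasurable_funM; [exact: mg|exact: (measurableT_comp mh (measurable_refl t))].
- by move=> s; rewrite mule_ge0.
- by move=> s; apply: (le_trans (kg _ _)); apply: lee_wpmul2l.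
- by rewrite -E.
Qed.

Lemma N1le_conv k M (g : R -> \bar R) c f d : bker k M -> maj k g -> (\int[mu]_t g t <= c%:E)%E ->
  Lint f -> N1le f d -> N1le (conv k f) (c * d).
Proof.
move=> bk kg gc hf [h [mh h0 fh hd]]; exists (cvm g h); case: (kg) => mg g0 _; split.
- exact: measurable_cvm.
- by move=> t; exact: cvm_ge0.
- by move=> t; exact: (conv_maj t bk kg hf mh h0 fh).
- rewrite integral_cvm// EFinM; apply: lee_pmul => //; exact: integral_ge0.
Qed.

Definition sk (m : R -> R) : R -> X -> X := fun t x => (m t)%:C%C *: x.

Lemma islin_scale (a : R[i]) : islin (fun x : X => a *: x).
Proof. by move=> b x y; rewrite scalerDr !scalerA mulrC. Qed.

Lemma bker_sk (m : R -> R) M c : measurable_fun setT m -> (forall t, 0 <= m t) ->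
  (forall t, m t <= M) -> (\int[mu]_t (m t)%:E = c%:E)%E -> bker (sk m) M.
Proof.
move=> mm m0 mM ic; split.
- exact: le_trans (m0 0) (mM 0).
- by move=> t; exact: islin_scale.
- by move=> x; exact: isI_Lint (isI_scalar x mm m0 ic).
- by move=> t x; rewrite nrmZr ger0_norm// ler_wpM2r ?nrm_ge0.
Qed.

Lemma maj_sk (m : R -> R) : measurable_fun setT m -> (forall t, 0 <= m t) -> maj (sk m) (EFin \o m).
Proof.
move=> mm m0; split.
- exact/measurable_EFinP.
- by move=> t; rewrite lee_fin.
- by move=> t x; rewrite nrmZr ger0_norm.
Qed.

Lemma indicE A (t : R) (v : X) : finm A ->
  (if `[< A t >] then v else 0) = ((\1_A t : R)%:C%C *: v).
Proof.
move=> _; rewrite indicE -[t \in A]/`[< A t >]; case: ifP => _; first by rewrite scale1r.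
by rewrite scale0r.
Qed.

Lemma integral_indicR A : finm A -> (\int[mu]_t (\1_A t)%:E = (fine (mu A))%:E)%E.
Proof. by move=> fA; rewrite (integral_indic mu measurableT) ?setIT ?fin_mu//; case: fA. Qed.

Lemma indic_ge0 A (t : R) : 0 <= (\1_A t : R). Proof. by []. Qed.
Lemma indic_le1 A (t : R) : (\1_A t : R) <= 1. Proof. by rewrite /indic lern1 leq_b1. Qed.
Lemma measurable_indicT A : finm A -> measurable_fun setT (\1_A : R -> R).
Proof. by case=> mA _; exact: measurable_indic. Qed.

Lemma bker_indic A : finm A -> bker (sk \1_A) 1.
Proof.
move=> fA; apply: (bker_sk (measurable_indicT fA) _ _ (integral_indicR fA)) => t.
  exact: indic_ge0.
exact: indic_le1.
Qed.

End Kernels.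

(** * Associativity of convolution *)

Section Associativity.
Context (R : realType) (X : completeNormedModType R[i]).
Local Notation mu := (@lebesgue_measure R).
Implicit Types (f g : R -> X) (k : R -> X -> X) (m : R -> R).

Definition nnk m M c := [/\ measurable_fun setT m, forall t, 0 <= m t,
  forall t, m t <= M & (\int[mu]_t (m t)%:E = c%:E)%E].

Definition scv m1 m2 t : R := fine (cvm (EFin \o m1) (EFin \o m2) t).

(** One factor is bounded and the other integrable, so the convolution is finite at every point and
    may be treated as real. *)
Lemma scvE m1 m2 M1 M2 c1 c2 t : nnk m1 M1 c1 -> nnk m2 M2 c2 ->
  cvm (EFin \o m1) (EFin \o m2) t = (scv m1 m2 t)%:E.
Proof.
move=> [mm1 p1 b1 i1] [mm2 p2 b2 i2]; rewrite /scv fineK// ge0_fin_numE; last first.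
  by apply: cvm_ge0 => s; rewrite /= lee_fin.
apply: (@le_lt_trans _ _ (\int[mu]_s (M2%:E * (m1 s)%:E))%E).
  apply: le_lower_integral => s; first by rewrite mule_ge0// lee_fin.
  by rewrite muleC lee_wpmul2r// lee_fin.
rewrite ge0_integralZl; last 4 first.
- exact: measurableT.
- exact/measurable_EFinP.
- by move=> s _; rewrite lee_fin.
- by rewrite lee_fin; apply: le_trans (p2 0) (b2 0).
by rewrite i1 -EFinM ltry.
Qed.

Lemma sc_scv m1 m2 M1 M2 c1 c2 : nnk m1 M1 c1 -> nnk m2 M2 c2 ->
  nnk (scv m1 m2) (M2 * c1) (c1 * c2).
Proof.
move=> h1 h2; have [mm1 p1 b1 i1] := h1; have [mm2 p2 b2 i2] := h2.
have em1 : measurable_fun setT (EFin \o m1) by exact/measurable_EFinP.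
have em2 : measurable_fun setT (EFin \o m2) by exact/measurable_EFinP.
have e1 t : (0 <= (EFin \o m1) t)%E by rewrite lee_fin.
have e2 t : (0 <= (EFin \o m2) t)%E by rewrite lee_fin.
split.
- apply/measurable_EFinP; rewrite (_ : _ \o _ = cvm (EFin \o m1) (EFin \o m2)).
    exact: measurable_cvm.
  by apply/funext => t; rewrite (scvE t h1 h2).
- by move=> t; apply/fine_ge0/cvm_ge0.
- move=> t; rewrite -lee_fin -(scvE t h1 h2).
  apply: (@le_trans _ _ (\int[mu]_s (M2%:E * (m1 s)%:E))%E).
    apply: le_lower_integral => s; first by rewrite mule_ge0.
    by rewrite muleC lee_wpmul2r// lee_fin.
  rewrite ge0_integralZl; last 4 first.
  + exact: measurableT.
  + exact/measurable_EFinP.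
  + by move=> s _; rewrite lee_fin.
  + by rewrite lee_fin; apply: le_trans (p2 0) (b2 0).
  by rewrite i1 -EFinM.
- under eq_integral do rewrite -(scvE _ h1 h2).
  by rewrite integral_cvm// i1 i2 -EFinM.
Qed.

Lemma sc_indic A : finm A -> nnk \1_A 1 (fine (mu A)).
Proof.
move=> fA; split; [exact: measurable_indicT|exact: indic_ge0|exact: indic_le1|].
exact: integral_indicR.
Qed.

Lemma sc_bker m M c : nnk m M c -> bker (@sk R X m) M.
Proof. by move=> [h1 h2 h3 h4]; exact: (bker_sk _ h1 h2 h3 h4). Qed.

Lemma sc_Lint m M c v : nnk m M c -> Lint (fun t => (m t)%:C%C *: v : X).
Proof. by move=> [mm m0 _ ic]; exact: isI_Lint (isI_scalar v mm m0 ic). Qed.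

(** The reflection s -> t - s exchanges the two factors: an operator kernel acting on a scalar
    function times v becomes a scalar kernel acting on the vector function k(.)v. *)
Lemma conv_scalar k K m M c v t : bker k K -> nnk m M c ->
  conv k (fun t => (m t)%:C%C *: v) t = conv (sk m) (k^~ v) t.
Proof.
move=> bk sm; have [_ kl kx _] := bk.
apply: bintE; have := isI_refl t (convP t (sc_bker sm) (kx v)).
rewrite (_ : (fun s => sk m (t - s) (k (t - (t - s)) v)) = (fun s => k s ((m (t - s))%:C%C *: v)))//.
by apply/funext => s; rewrite /sk (islinZ _ _ (kl s)) subKr.
Qed.

Lemma conv_sk_scalar m1 m2 M1 M2 c1 c2 (v : X) t : nnk m1 M1 c1 -> nnk m2 M2 c2 ->
  conv (sk m1) (fun t => (m2 t)%:C%C *: v) t = (scv m1 m2 t)%:C%C *: v.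
Proof.
move=> h1 h2; have [mm1 p1 b1 i1] := h1; have [mm2 p2 b2 i2] := h2.
apply: bintE; rewrite /sk.
rewrite (_ : (fun s => _) = fun s => (m1 s * m2 (t - s))%:C%C *: v); last first.
  by apply/funext => s; rewrite scalerA rmorphM.
apply: isI_scalar.
- apply: measurable_funM => //; exact: (measurableT_comp mm2 (measurable_refl t)).
- by move=> s; rewrite mulr_ge0.
- by rewrite -(scvE t h1 h2) /cvm; apply: eq_integral => s _; rewrite EFinM.
Qed.

Lemma indic_fun A (v : X) : finm A ->
  (fun t : R => if `[< A t >] then v else 0) = (fun t => (\1_A t)%:C%C *: v).
Proof. by move=> fA; apply/funext => t; rewrite indicE. Qed.

Lemma Lint_conv_gen k M (g : R -> \bar R) c : bker k M -> maj k g ->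
  (\int[mu]_t g t <= c%:E)%E ->
  (forall A v, finm A -> Lint (conv k (fun t => if `[< A t >] then v else 0))) ->
  forall f, Lint f -> Lint (conv k f).
Proof.
move=> bk kg gc kA; apply: Lint_rect => //.
- rewrite (_ : conv _ _ = fun=> 0); first exact: Lint0.
  by apply/funext => t; rewrite (conv0 t bk).
- move=> f g' hf hg lf lg.
  rewrite (_ : conv _ _ = fun t => conv k f t + conv k g' t); first exact: LintD.
  by apply/funext => t; rewrite (convD t bk).
- have c0 : 0 <= c.
    by rewrite -lee_fin; apply: le_trans gc; apply: integral_ge0; case: kg.
  move=> f hf h; apply: Lint_lim => e e0.
  have c1 : 0 < c + 1 by rewrite ltr_wpDl.
  have [g' [hg kg' fg]] := h _ (divr_gt0 e0 c1).
  exists (conv k g'); split => //.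
  have := N1le_conv bk kg gc (LintB hf hg) fg.
  rewrite (_ : conv _ _ = fun t => conv k f t - conv k g' t); last first.
    by apply/funext => t; rewrite (convB t bk).
  move=> hh; apply: N1leW hh _.
  by rewrite mulrA ler_pdivrMr// mulrC ler_wpM2l ?(ltW e0)// lerDl.
Qed.

Lemma sc_maj m M c : nnk m M c -> maj (@sk R X m) (EFin \o m).
Proof. by move=> [? ? _ _]; exact: maj_sk. Qed.

Lemma sc_le m M c : nnk m M c -> (\int[mu]_t (EFin \o m) t <= c%:E)%E.
Proof. by move=> [_ _ _ <-]. Qed.

Lemma Lint_conv_sk m M c f : nnk m M c -> Lint f -> Lint (conv (sk m) f).
Proof.
move=> sm; apply: (Lint_conv_gen (sc_bker sm) (sc_maj sm) (sc_le sm)) => A v fA.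
rewrite indic_fun//.
rewrite (_ : conv _ _ = fun t => (scv m \1_A t)%:C%C *: v).
  exact: sc_Lint (sc_scv sm (sc_indic fA)).
by apply/funext => t; rewrite (conv_sk_scalar v t sm (sc_indic fA)).
Qed.

(** It suffices to treat indicators times v, and for these [conv_scalar] leads back to a scalar
    kernel. *)
Lemma Lint_conv k M (g : R -> \bar R) c f : bker k M -> maj k g ->
  (\int[mu]_t g t <= c%:E)%E -> Lint f -> Lint (conv k f).
Proof.
move=> bk kg gc; apply: (Lint_conv_gen bk kg gc) => A v fA.
rewrite indic_fun// (_ : conv _ _ = conv (sk \1_A) (k^~ v)).
  by apply: (Lint_conv_sk (sc_indic fA)); case: bk.
by apply/funext => t; rewrite (conv_scalar v t bk (sc_indic fA)).
Qed.

(** Two additive maps that are continuous for the L^1 norm and agree on indicators agree everywhere.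
    This replaces Fubini for vector-valued functions. *)
Lemma Lint_agree (Phi Psi : (R -> X) -> X) C : 0 <= C ->
  (forall f g, Lint f -> Lint g -> Phi (fun t => f t - g t) = Phi f - Phi g) ->
  (forall f g, Lint f -> Lint g -> Psi (fun t => f t - g t) = Psi f - Psi g) ->
  (forall f c, Lint f -> N1le f c -> nrm (Phi f) <= C * c) ->
  (forall f c, Lint f -> N1le f c -> nrm (Psi f) <= C * c) ->
  (forall A v, finm A -> Phi (fun t => if `[< A t >] then v else 0) =
                         Psi (fun t => if `[< A t >] then v else 0)) ->
  forall f, Lint f -> Phi f = Psi f.
Proof.
move=> C0 PB QB Pb Qb PQ.
have P0 : Phi (fun=> 0) = 0.
  by have := PB _ _ (@Lint0 R X) (@Lint0 R X); rewrite /= !subrr.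
have Q0 : Psi (fun=> 0) = 0.
  by have := QB _ _ (@Lint0 R X) (@Lint0 R X); rewrite /= !subrr.
have LN f : Lint f -> Lint (fun t => 0 - f t) by move=> hf; exact: LintB (@Lint0 R X) hf.
have DN f g : (fun t => f t + g t) = (fun t : R => f t - (0 - g t)).
  by apply/funext => t; rewrite sub0r opprK.
refine (@Lint_rect R X (fun f => Phi f = Psi f) PQ _ _ _).
  by rewrite P0 Q0.
- move=> f g hf hg hPf hPg; have L0 := @Lint0 R X.
  by rewrite DN (PB _ _ hf (LN _ hg)) (QB _ _ hf (LN _ hg)) (PB _ _ L0 hg) (QB _ _ L0 hg) P0 Q0 hPf hPg.
- move=> f hf h; apply/eqP; rewrite -subr_eq0; apply/eqP/nrm_eq0.
  apply: (@eps0 _ _ _ (2 * C)) => [|e e0]; first by rewrite mulr_ge0.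
  have [g [hg PQg fg]] := h _ e0.
  rewrite (_ : Phi f - Psi f = (Phi f - Phi g) - (Psi f - Psi g)); last by rewrite PQg; zmod.
  rewrite -PB// -QB//.
  rewrite (le_trans (nrmB _ _))// (_ : 0 + 2 * C * e = C * e + C * e); last by ring.
  by apply: lerD; [apply: Pb|apply: Qb] => //; exact: LintB.
Qed.

Lemma N1le_maj k (g : R -> \bar R) c x : maj k g -> (\int[mu]_t g t <= c%:E)%E ->
  N1le (k^~ x) (c * nrm x).
Proof.
move=> [mg g0 kg] gc; exists (fun t => g t * (nrm x)%:E)%E; split.
- by apply: emeasurable_funM; [exact: mg|exact: measurable_cst].
- by move=> t; rewrite mule_ge0// lee_fin nrm_ge0.
- by move=> t; exact: kg.
- rewrite ge0_integralZr; last 4 first.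
  + exact: measurableT.
  + exact: mg.
  + by move=> t _; exact: g0.
  + by rewrite lee_fin nrm_ge0.
  by rewrite EFinM; apply: lee_wpmul2r => //; rewrite lee_fin nrm_ge0.
Qed.


(** [Lint_agree] is used twice, for [f] and then for the function k(.)w; what remains is
    associativity for three indicators, which is scalar. *)
Lemma conv_conv_indic k K (g : R -> \bar R) c A f t : bker k K -> maj k g ->
  (\int[mu]_t g t <= c%:E)%E -> finm A -> Lint f ->
  conv (sk \1_A) (conv k f) t = conv k (conv (sk \1_A) f) t.
Proof.
move=> bk kg gc fA hf.
have sA := sc_indic fA; have bA := @bker_indic R X A fA.
have mA := sc_maj sA; have lA := sc_le sA.
have Lk h : Lint h -> Lint (conv k h) by exact: (Lint_conv bk kg gc).
have LA (h : R -> X) : Lint h -> Lint (conv (sk \1_A) h) by exact: (Lint_conv_sk sA).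
have c0 : 0 <= c.
  by rewrite -lee_fin; apply: le_trans gc; apply: integral_ge0; case: kg.
have K0 : 0 <= K by case: bk.
have a0 : 0 <= fine (mu A) by rewrite fine_ge0.
have kB h h' : Lint h -> Lint h' -> conv k (fun t => h t - h' t) = fun t => conv k h t - conv k h' t.
  by move=> *; apply/funext => s; rewrite (convB s bk).
have AB (h h' : R -> X) : Lint h -> Lint h' -> conv (sk \1_A) (fun t => h t - h' t) = fun t => conv (sk \1_A) h t - conv (sk \1_A) h' t.
  by move=> *; apply/funext => s; rewrite (convB s bA).
move: f hf; apply: (@Lint_agree _ _ (1 * c + K * fine (mu A))).
- by rewrite addr_ge0// mulr_ge0.
- by move=> f f' hf hf'; rewrite kB// (convB t bA)//; exact: Lk.
- by move=> f f' hf hf'; rewrite AB// (convB t bk)//; exact: LA.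
- move=> f d hf fd; have d0 := N1le_ge0 fd.
  have := conv_bound t bA (Lk _ hf) (N1le_conv bk kg gc hf fd).
  move=> /le_trans; apply; rewrite mulrDl mulrA lerDl !mulr_ge0//.
- move=> f d hf fd; have d0 := N1le_ge0 fd.
  have := conv_bound t bk (LA _ hf) (N1le_conv bA mA lA hf fd).
  by move=> /le_trans; apply; rewrite mulrDl mulrA lerDr !mulr_ge0.
move=> B w fB; have sB := sc_indic fB; have bB := @bker_indic R X B fB.
have sAB := sc_scv sA sB.
rewrite indic_fun//.
have -> : conv k (fun t => (\1_B t)%:C%C *: w) = conv (sk \1_B) (k^~ w).
  by apply/funext => s; rewrite (conv_scalar w s bk sB).
have -> : conv (sk \1_A) (fun t => (\1_B t)%:C%C *: w) = fun t => (scv \1_A \1_B t)%:C%C *: w.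
  by apply/funext => s; rewrite (conv_sk_scalar w s sA sB).
rewrite (conv_scalar w t bk sAB).
have : Lint (k^~ w) by case: bk.
(* For fixed w, k(.)w is just another integrable function, so it may be generalised and density used
   once more. *)
move: (k^~ w); apply: (@Lint_agree _ _ (1 * fine (mu B) + 1 * fine (mu A))).
- by rewrite addr_ge0// mulr_ge0// fine_ge0.
- move=> f f' hf hf'; rewrite (_ : conv (sk \1_B) _ = fun t => conv (sk \1_B) f t - conv (sk \1_B) f' t).
    by rewrite (convB t bA)//; exact: (Lint_conv_sk sB).
  by apply/funext => s; rewrite (convB s bB).
- by move=> f f' hf hf'; rewrite (convB t (sc_bker sAB)).
- move=> f d hf fd; have d0 := N1le_ge0 fd.
  have := conv_bound t bA (Lint_conv_sk sB hf) (N1le_conv bB (sc_maj sB) (sc_le sB) hf fd).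
  by move=> /le_trans; apply; rewrite mulrDl mulrA lerDl !mulr_ge0// fine_ge0.
- move=> f d hf fd; have d0 := N1le_ge0 fd.
  have := conv_bound t (sc_bker sAB) hf fd.
  by move=> /le_trans; apply; rewrite !mul1r mulrDl lerDr mulr_ge0// fine_ge0.
move=> C z fC; have sC := sc_indic fC.
rewrite indic_fun//.
have -> : conv (sk \1_B) (fun t => (\1_C t)%:C%C *: z) = fun t => (scv \1_B \1_C t)%:C%C *: z.
  by apply/funext => s; rewrite (conv_sk_scalar z s sB sC).
have sBC := sc_scv sB sC.
rewrite (conv_sk_scalar z t sA sBC) (conv_sk_scalar z t sAB sC); congr ((_)%:C%C *: _).
apply: EFin_inj; rewrite -(scvE t sA sBC) -(scvE t sAB sC).
have -> : EFin \o scv \1_B \1_C = cvm (EFin \o \1_B) (EFin \o \1_C).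
  by apply/funext => s; rewrite (scvE s sB sC).
have -> : EFin \o scv \1_A \1_B = cvm (EFin \o \1_A) (EFin \o \1_B).
  by apply/funext => s; rewrite (scvE s sA sB).
by apply: cvm_assoc; [apply/measurable_EFinP; exact: measurable_indicT..| | |];
  move=> s; rewrite /= lee_fin indic_ge0.
Qed.

Definition cK k1 k2 : R -> X -> X := fun t x => conv k1 (k2^~ x) t.

Lemma bker_cK k1 k2 M1 M2 (g1 g2 : R -> \bar R) c1 c2 : bker k1 M1 -> bker k2 M2 ->
  maj k1 g1 -> maj k2 g2 ->
  (\int[mu]_t g1 t <= c1%:E)%E -> (\int[mu]_t g2 t <= c2%:E)%E ->
  bker (cK k1 k2) (M1 * c2).
Proof.
move=> bk1 bk2 kg1 kg2 gc1 gc2; have [M20 kl2 kx2 kM2] := bk2.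
have [M10 kl1 kx1 kM1] := bk1.
have c20 : 0 <= c2.
  by rewrite -lee_fin; apply: le_trans gc2; apply: integral_ge0; case: kg2.
split.
- exact: mulr_ge0.
- move=> t a x y; apply: bintE.
  have := isID (isIZ a (convP t bk1 (kx2 x))) (convP t bk1 (kx2 y)).
  rewrite (_ : (fun s => _ + _) = (fun s => k1 s (k2 (t - s) (a *: x + y))))//.
  by apply/funext => s; rewrite kl2 kl1.
- by move=> x; exact: Lint_conv bk1 kg1 gc1 (kx2 x).
- move=> t x; have := conv_bound t bk1 (kx2 x) (N1le_maj x kg2 gc2).
  by rewrite mulrA.
Qed.

Lemma maj_cK k1 k2 M1 M2 (g1 g2 : R -> \bar R) : bker k1 M1 -> bker k2 M2 ->
  maj k1 g1 -> maj k2 g2 -> maj (cK k1 k2) (cvm g1 g2).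
Proof.
move=> bk1 bk2 kg1 kg2; case: (kg1) => mg1 g10 kgg1; case: (kg2) => mg2 g20 kgg2; split.
- exact: measurable_cvm.
- by move=> t; exact: cvm_ge0.
- move=> t x; have [_ _ kx2 _] := bk2.
  have mh : measurable_fun setT (fun t => g2 t * (nrm x)%:E)%E.
    by apply: emeasurable_funM; [exact: mg2|exact: measurable_cst].
  have h0 s : (0 <= g2 s * (nrm x)%:E)%E by rewrite mule_ge0// lee_fin nrm_ge0.
  have := conv_maj t bk1 kg1 (kx2 x) mh h0 (fun t => kgg2 t x).
  rewrite /cvm; under eq_integral do rewrite muleA.
  rewrite ge0_integralZr//; last 3 first.
  + apply: emeasurable_funM; first exact: mg1.
    exact: (measurableT_comp mg2 (measurable_refl t)).
  + by move=> s _; rewrite mule_ge0.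
  + by rewrite lee_fin nrm_ge0.
Qed.

(** On an indicator, [conv_scalar] turns both sides into convolutions with a scalar kernel, and
    [conv_conv_indic] moves that kernel past [k1]. *)
Lemma conv_assoc k1 k2 M1 M2 (g1 g2 : R -> \bar R) c1 c2 f t : bker k1 M1 -> bker k2 M2 ->
  maj k1 g1 -> maj k2 g2 ->
  (\int[mu]_t g1 t <= c1%:E)%E -> (\int[mu]_t g2 t <= c2%:E)%E -> Lint f ->
  conv (cK k1 k2) f t = conv k1 (conv k2 f) t.
Proof.
move=> bk1 bk2 kg1 kg2 gc1 gc2.
have bk12 := bker_cK bk1 bk2 kg1 kg2 gc1 gc2.
have c20 : 0 <= c2.
  by rewrite -lee_fin; apply: le_trans gc2; apply: integral_ge0; case: kg2.
have M10 : 0 <= M1 by case: bk1.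
have L2 h : Lint h -> Lint (conv k2 h) by exact: (Lint_conv bk2 kg2 gc2).
move: f; apply: (@Lint_agree _ _ (M1 * c2)).
- exact: mulr_ge0.
- by move=> f f' hf hf'; rewrite (convB t bk12).
- move=> f f' hf hf'; rewrite (_ : conv k2 _ = fun t => conv k2 f t - conv k2 f' t).
    by rewrite (convB t bk1)//; exact: L2.
  by apply/funext => s; rewrite (convB s bk2).
- by move=> f d hf fd; exact: conv_bound bk12 hf fd.
- move=> f d hf fd.
  by have := conv_bound t bk1 (L2 _ hf) (N1le_conv bk2 kg2 gc2 hf fd); rewrite mulrA.
move=> A v fA; have sA := sc_indic fA; rewrite indic_fun//.
rewrite (conv_scalar v t bk12 sA).
have -> : conv k2 (fun t => (\1_A t)%:C%C *: v) = conv (sk \1_A) (k2^~ v).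
  by apply/funext => s; rewrite (conv_scalar v s bk2 sA).
rewrite -(conv_conv_indic t bk1 kg1 gc1 fA)//.
by case: bk2.
Qed.

End Associativity.

(** * Kernels with a weighted bound *)

Section WeightedKernels.
Context (R : realType) (X : completeNormedModType R[i]) (p : R).
Local Notation mu := (@lebesgue_measure R).
Implicit Types (k : R -> X -> X) (B : X -> X) (f : R -> X).

Definition isop B := islin B /\ exists2 M, 0 <= M & forall x, nrm (B x) <= M * nrm x.

(** Membership in W_X with strong measurability replaced by integrability; for functions below a
    multiple of the weight the two are interchangeable, see [inW_kern] and [kern_inW]. *)
Definition kern k := [/\ forall t, islin (k t), forall x, Lint (k^~ x) &
  exists2 A, 0 <= A & forall t x, nrm (k t x) <= A * wt p t * nrm x].

Definition wmaj A : R -> \bar R := fun t => (A * wt p t)%:E.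

Hypothesis p1 : 1 < p.

Let p0 : 0 <= p. Proof. exact: le_trans ler01 (ltW p1). Qed.

Lemma kern_bker k A : kern k -> 0 <= A ->
  (forall t x, nrm (k t x) <= A * wt p t * nrm x) -> bker k A.
Proof.
move=> [kl kx _] A0 kA; split => // t x; apply: le_trans (kA t x) _.
by rewrite ler_wpM2r ?nrm_ge0// ler_piMr// wt_le1.
Qed.

Lemma kern_maj k A : 0 <= A ->
  (forall t x, nrm (k t x) <= A * wt p t * nrm x) -> maj k (wmaj A).
Proof.
move=> A0 kA; split.
- by apply/measurable_EFinP; apply: measurable_funM; [exact: measurable_cst|exact: measurable_wt].
- by move=> t; rewrite lee_fin mulr_ge0// wt_ge0.
- by move=> t x; rewrite -EFinM lee_fin.
Qed.

Lemma wmaj_int A : 0 <= A -> (\int[mu]_t wmaj A t <= (A * cw p)%:E)%E.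
Proof.
move=> A0; rewrite /wmaj; under eq_integral do rewrite EFinM.
rewrite ge0_integralZl; last 4 first.
- exact: measurableT.
- by apply/measurable_EFinP; exact: measurable_wt.
- by move=> t _; rewrite lee_fin wt_ge0.
- by rewrite lee_fin.
by rewrite integral_wt// EFinM.
Qed.

Lemma kernP k : kern k -> exists A, [/\ 0 <= A, bker k A, maj k (wmaj A),
  (\int[mu]_t wmaj A t <= (A * cw p)%:E)%E &
  forall t x, nrm (k t x) <= A * wt p t * nrm x].
Proof.
move=> hk; have [_ _ [A A0 kA]] := hk; exists A; split => //.
- exact: kern_bker.
- exact: kern_maj.
- exact: wmaj_int.
Qed.

Lemma kern0 : kern (fun _ _ => 0).
Proof.
split.
- by move=> t a x y; rewrite scaler0 addr0.
- by move=> x; exact: Lint0.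
- by exists 0 => // t x; rewrite nrm0 !mul0r.
Qed.

Lemma kernD k1 k2 : kern k1 -> kern k2 -> kern (fun t x => k1 t x + k2 t x).
Proof.
move=> [l1 x1 [A1 A10 h1]] [l2 x2 [A2 A20 h2]]; split.
- by move=> t a x y; rewrite l1 l2 scalerDr addrACA.
- by move=> x; exact: LintD.
- exists (A1 + A2) => [|t x]; first exact: addr_ge0.
  by rewrite (le_trans (nrmD _ _))// !mulrDl lerD.
Qed.

Lemma kernN k : kern k -> kern (fun t x => - k t x).
Proof.
move=> [l1 x1 [A1 A10 h1]]; split.
- by move=> t a x y; rewrite l1 opprD scalerN.
- move=> x; have := LintB (@Lint0 R X) (x1 x).
  by under eq_fun do rewrite sub0r.
- by exists A1 => // t x; rewrite nrmN.
Qed.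

Lemma isI_isop B f w : isop B -> isI f w -> isI (fun t => B (f t)) (B w).
Proof.
move=> [Bl [M M0 BM]]; apply: (isI_op M0) => //; first exact: islinD.
by move=> c x; rewrite (islinZ _ _ Bl).
Qed.

Lemma Lint_isop B f : isop B -> Lint f -> Lint (fun t => B (f t)).
Proof. by move=> hB /bintP h; exact: isI_Lint (isI_isop hB h). Qed.

Lemma kern_opl B k : isop B -> kern k -> kern (fun t x => B (k t x)).
Proof.
move=> hB [kl kx [A A0 kA]]; have [Bl [M M0 BM]] := hB; split.
- by move=> t a x y; rewrite kl Bl.
- by move=> x; exact: Lint_isop.
- exists (M * A) => [|t x]; first exact: mulr_ge0.
  by rewrite (le_trans (BM _))// -!mulrA ler_wpM2l// mulrA.
Qed.

Lemma kern_opr B k : isop B -> kern k -> kern (fun t x => k t (B x)).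
Proof.
move=> [Bl [M M0 BM]] [kl kx [A A0 kA]]; split.
- by move=> t a x y; rewrite Bl kl.
- by move=> x; exact: kx.
- exists (M * A) => [|t x]; first exact: mulr_ge0.
  rewrite (le_trans (kA _ _))// (_ : M * A * _ * _ = A * wt p t * (M * nrm x)); last by ring.
  by rewrite ler_wpM2l// mulr_ge0// wt_ge0.
Qed.

(** The weighted constants A and the L^1 constants c are kept independent, so that c may be much
    smaller than what A alone would give. *)
Lemma kern_cK_bound k1 k2 (g1 g2 : R -> \bar R) A1 A2 c1 c2 M1 M2 t x :
  bker k1 M1 -> bker k2 M2 -> maj k1 g1 -> maj k2 g2 -> 0 <= A1 -> 0 <= A2 ->
  (forall t, (g1 t <= wmaj A1 t)%E) -> (forall t, (g2 t <= wmaj A2 t)%E) ->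
  (\int[mu]_t g1 t <= c1%:E)%E -> (\int[mu]_t g2 t <= c2%:E)%E ->
  nrm (cK k1 k2 t x) <= 2 `^ p * (A1 * c2 + A2 * c1) * wt p t * nrm x.
Proof.
move=> bk1 bk2 kg1 kg2 A10 A20 gA1 gA2 gc1 gc2.
have [mg1 g10 _] := kg1; have [mg2 g20 _] := kg2.
have [_ _ /(_ t x)] := maj_cK bk1 bk2 kg1 kg2.
rewrite -lee_fin => /le_trans; apply; rewrite EFinM.
apply: lee_wpmul2r; first by rewrite lee_fin nrm_ge0.
exact: cvm_wt.
Qed.

Lemma kern_cK k1 k2 : kern k1 -> kern k2 -> kern (cK k1 k2).
Proof.
move=> /kernP[A1 [A10 bk1 kg1 gc1 _]] /kernP[A2 [A20 bk2 kg2 gc2 _]].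
have [_ kl kx _] := bker_cK bk1 bk2 kg1 kg2 gc1 gc2; split => //.
exists (2 `^ p * (A1 * (A2 * cw p) + A2 * (A1 * cw p))) => [|t x].
  by rewrite mulr_ge0 ?powR_ge0// addr_ge0// !mulr_ge0// cw_ge0.
exact: (kern_cK_bound t x bk1 bk2 kg1 kg2 A10 A20 (fun _ => lexx _) (fun _ => lexx _) gc1 gc2).
Qed.

Lemma conv_opl B k M f t : isop B -> bker k M -> Lint f ->
  conv (fun s x => B (k s x)) f t = B (conv k f t).
Proof. by move=> hB bk hf; apply: bintE; exact: isI_isop (convP t bk hf). Qed.

Lemma conv_addk k1 k2 M1 M2 f t : bker k1 M1 -> bker k2 M2 -> Lint f ->
  conv (fun s x => k1 s x + k2 s x) f t = conv k1 f t + conv k2 f t.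
Proof. by move=> bk1 bk2 hf; apply: bintE; exact: isID (convP t bk1 hf) (convP t bk2 hf). Qed.

(* The element B delta_0 + k of B(X) delta_0 + W_X: the Fourier transform enters
   the argument as a multiple of delta_0, so scalar multiples do not suffice. *)
Record alg (q : 1 < p) := Alg {
  op : X -> X; ker : R -> X -> X; opP : isop op; kerP : kern ker }.

End WeightedKernels.

Arguments op {R X p q}. Arguments ker {R X p q}.

HB.instance Definition _ (R : realType) (X : completeNormedModType R[i]) (p : R) (q : 1 < p) :=
  gen_eqMixin (alg X q).
HB.instance Definition _ (R : realType) (X : completeNormedModType R[i]) (p : R) (q : 1 < p) :=
  gen_choiceMixin (alg X q).

(** * The algebra of sums of an operator at 0 and a kernel *)

Section AlgRing.
Context (R : realType) (X : completeNormedModType R[i]) (p : R) (p1 : 1 < p).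
Local Notation A := (alg X p1).
Implicit Types a b c : A.

(** Kernels are compared at every t, not almost everywhere, so each ring law is an identity between
    values of integrals. *)
Lemma alg_eq a b : (forall x, op a x = op b x) ->
  (forall t x, ker a t x = ker b t x) -> a = b.
Proof.
case: a => oa ka pa qa; case: b => ob kb pb qb /= ho hk.
have eo : oa = ob by apply/funext.
have ek : ka = kb by apply/funext => t; apply/funext.
by subst ob kb; rewrite (Prop_irrelevance pa pb) (Prop_irrelevance qa qb).
Qed.

Lemma isop0 : isop (fun _ : X => 0).
Proof.
split; first by move=> a x y; rewrite scaler0 addr0.
by exists 0 => // x; rewrite nrm0 mul0r.
Qed.

Lemma isop_id : isop (@id X).
Proof. by split => //; exists 1 => // x; rewrite mul1r. Qed.

Lemma isopD (B C : X -> X) : isop B -> isop C -> isop (fun x => B x + C x).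
Proof.
move=> [Bl [M M0 BM]] [Cl [N N0 CN]]; split.
  by move=> a x y; rewrite Bl Cl scalerDr addrACA.
exists (M + N) => [|x]; first exact: addr_ge0.
by rewrite (le_trans (nrmD _ _))// mulrDl lerD.
Qed.

Lemma isopN (B : X -> X) : isop B -> isop (fun x => - B x).
Proof.
move=> [Bl [M M0 BM]]; split; first by move=> a x y; rewrite Bl opprD scalerN.
by exists M => // x; rewrite nrmN.
Qed.

Lemma isopM (B C : X -> X) : isop B -> isop C -> isop (fun x => B (C x)).
Proof.
move=> [Bl [M M0 BM]] [Cl [N N0 CN]]; split; first by move=> a x y; rewrite Cl Bl.
exists (M * N) => [|x]; first exact: mulr_ge0.
by rewrite (le_trans (BM _))// -mulrA ler_wpM2l.
Qed.

Definition alg0 : A := Alg p1 isop0 (kern0 X p).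
Definition algD a b : A := Alg p1 (isopD (opP a) (opP b)) (kernD (kerP a) (kerP b)).
Definition algN a : A := Alg p1 (isopN (opP a)) (kernN (kerP a)).
Definition alg1 : A := Alg p1 isop_id (kern0 X p).
Definition algM a b : A := Alg p1 (isopM (opP a) (opP b))
  (kernD (kernD (kern_opl (opP a) (kerP b)) (kern_opr (opP b) (kerP a)))
     (kern_cK p1 (kerP a) (kerP b))).

Lemma algDA : associative algD.
Proof. by move=> a b c; apply: alg_eq => [x|t x] /=; rewrite addrA. Qed.
Lemma algDC : commutative algD.
Proof. by move=> a b; apply: alg_eq => [x|t x] /=; rewrite addrC. Qed.
Lemma alg0D : left_id alg0 algD.
Proof. by move=> a; apply: alg_eq => [x|t x] /=; rewrite add0r. Qed.
Lemma algND : left_inverse alg0 algN algD.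
Proof. by move=> a; apply: alg_eq => [x|t x] /=; rewrite addNr. Qed.

HB.instance Definition _ := GRing.isZmodule.Build A algDA algDC alg0D algND.

Lemma kerLint a x : Lint (ker a ^~ x). Proof. by case: (kerP a). Qed.
Lemma kerlin a t : islin (ker a t). Proof. by case: (kerP a). Qed.
Lemma oplin a : islin (op a). Proof. by case: (opP a). Qed.

Lemma conv_algM a b f t : Lint f ->
  conv (ker (algM a b)) f t = op a (conv (ker b) f t) +
    conv (ker a) (fun s => op b (f s)) t + conv (ker a) (conv (ker b) f) t.
Proof.
move=> hf.
have [Aa [_ ba ga ca _]] := kernP p1 (kerP a).
have [Ab [_ bb gb cb _]] := kernP p1 (kerP b).
have [A3 [_ b3 _ _ _]] := kernP p1 (kern_opl (opP a) (kerP b)).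
have [A4 [_ b4 _ _ _]] := kernP p1 (kern_opr (opP b) (kerP a)).
have [A5 [_ b5 _ _ _]] := kernP p1 (kern_cK p1 (kerP a) (kerP b)).
have [A6 [_ b6 _ _ _]] := kernP p1 (kernD (kern_opl (opP a) (kerP b)) (kern_opr (opP b) (kerP a))).
rewrite /= (conv_addk t b6 b5 hf) (conv_addk t b3 b4 hf).
by rewrite (conv_opl t (opP a) bb hf) (conv_assoc t ba bb ga gb ca cb hf).
Qed.

Lemma Lint_kerconv a f : Lint f -> Lint (conv (ker a) f).
Proof.
have [Aa [_ ba ga ca _]] := kernP p1 (kerP a).
exact: (Lint_conv ba ga ca).
Qed.

Lemma conv_kerD a f g t : Lint f -> Lint g ->
  conv (ker a) (fun t => f t + g t) t = conv (ker a) f t + conv (ker a) g t.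
Proof. by have [Aa [_ ba ga ca _]] := kernP p1 (kerP a); exact: (convD t ba). Qed.

Lemma algMA : associative algM.
Proof.
move=> a b c; apply: alg_eq => [//|t x].
have -> : ker (algM (algM a b) c) t x =
  op a (op b (ker c t x)) + ker (algM a b) t (op c x) + conv (ker (algM a b)) (ker c ^~ x) t by [].
have -> : ker (algM a (algM b c)) t x =
  op a (ker (algM b c) t x) + ker a t (op b (op c x)) + conv (ker a) (ker (algM b c) ^~ x) t by [].
have hc := kerLint c x.
rewrite conv_algM//=.
have h1 := Lint_isop (opP b) hc; have h2 := kerLint b (op c x); have h3 := Lint_kerconv b hc.
rewrite (conv_kerD a t (LintD h1 h2) h3) (conv_kerD a t h1 h2).
rewrite !(islinD (oplin a)) /cK; zmod.
Qed.

Lemma alg1M : left_id alg1 algM.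
Proof.
move=> a; apply: alg_eq => [//|t x] /=.
rewrite addr0 (_ : cK _ _ t x = 0) ?addr0//.
by apply: bintE; exact: Lint_isI0.
Qed.

Lemma algM1 : right_id alg1 algM.
Proof.
move=> a; apply: alg_eq => [//|t x] /=.
have [Aa [_ ba _ _ _]] := kernP p1 (kerP a).
by rewrite (islin0 (oplin a)) add0r /cK (conv0 t ba) addr0.
Qed.

Lemma algMDl : left_distributive algM algD.
Proof.
move=> a b c; apply: alg_eq => [//|t x] /=.
have [Aa [_ ba ga ca _]] := kernP p1 (kerP a).
have [Ab [_ bb gb cb _]] := kernP p1 (kerP b).
by rewrite /cK (conv_addk t ba bb (kerLint c x)); zmod.
Qed.

Lemma algMDr : right_distributive algM algD.
Proof.
move=> a b c; apply: alg_eq => [x|t x] /=; first by rewrite (islinD (oplin a)).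
rewrite /cK (conv_kerD a t (kerLint b x) (kerLint c x)).
rewrite (islinD (oplin a)) (islinD (kerlin a t)); zmod.
Qed.

HB.instance Definition _ := GRing.Zmodule_isPzRing.Build A algMA alg1M algM1 algMDl algMDr.

Lemma kerM a b t x : ker (a * b) t x =
  op a (ker b t x) + ker a t (op b x) + conv (ker a) (ker b ^~ x) t.
Proof. by []. Qed.

Lemma kerD a b t x : ker (a + b) t x = ker a t x + ker b t x. Proof. by []. Qed.
Lemma kerN a t x : ker (- a) t x = - ker a t x. Proof. by []. Qed.
Lemma opM a b x : op (a * b) x = op a (op b x). Proof. by []. Qed.

End AlgRing.

(** * Weighted and unweighted bounds on the algebra *)

Section Bounds.
Context (R : realType) (X : completeNormedModType R[i]) (p : R) (p1 : 1 < p).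
Local Notation A := (alg X p1).
Local Notation mu := (@lebesgue_measure R).
Implicit Types a b e : A.

Let p0 : 0 <= p. Proof. exact: le_trans ler01 (ltW p1). Qed.

(** The unweighted norm: operator norm of the multiple of delta_0 plus L^1 norm of the kernel. It is
    a relation, because the second term is known only through majorants. *)
Definition bd a (c : R) := exists M d, exists g : R -> \bar R,
  [/\ 0 <= M, 0 <= d, forall x, nrm (op a x) <= M * nrm x & maj (ker a) g] /\
  ((\int[mu]_t g t <= d%:E)%E /\ M + d <= c).

Lemma bd_ge0 a c : bd a c -> 0 <= c.
Proof. by move=> [M [d [g [[M0 d0 _ _] [_]]]]]; apply: le_trans; exact: addr_ge0. Qed.

Lemma bdW a c c' : c <= c' -> bd a c -> bd a c'.
Proof.
move=> cc [M [d [g [h [gd Md]]]]]; exists M, d, g; split => //; split => //.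
exact: le_trans Md cc.
Qed.

Lemma majD (k1 k2 : R -> X -> X) g1 g2 : maj k1 g1 -> maj k2 g2 ->
  maj (fun t x => k1 t x + k2 t x) (fun t => g1 t + g2 t)%E.
Proof.
move=> [m1 p1' h1] [m2 p2 h2]; split.
- exact: emeasurable_funD.
- by move=> t; rewrite adde_ge0.
- move=> t x; rewrite ge0_muleDl//.
  apply: le_trans (leeD (h1 t x) (h2 t x)).
  by rewrite -EFinD lee_fin nrmD.
Qed.

Lemma integralD_le (g1 g2 : R -> \bar R) d1 d2 : measurable_fun setT g1 -> measurable_fun setT g2 ->
  (forall t, (0 <= g1 t)%E) -> (forall t, (0 <= g2 t)%E) ->
  (\int[mu]_t g1 t <= d1%:E)%E -> (\int[mu]_t g2 t <= d2%:E)%E ->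
  (\int[mu]_t (g1 t + g2 t) <= (d1 + d2)%:E)%E.
Proof.
move=> m1 m2 g10 g20 h1 h2; rewrite ge0_integralD//.
by rewrite EFinD leeD.
Qed.

Lemma bdD a b c d : bd a c -> bd b d -> bd (a + b) (c + d).
Proof.
move=> [M [u [g [[M0 u0 aM kg] [gu Mu]]]]] [N [v [h [[N0 v0 bN kh] [hv Nv]]]]].
exists (M + N), (u + v), (fun t => g t + h t)%E; split; split.
- exact: addr_ge0.
- exact: addr_ge0.
- by move=> x; rewrite (le_trans (nrmD _ _))// mulrDl lerD.
- exact: majD.
- by case: kg => ? ? _; case: kh => ? ? _; exact: integralD_le.
- by rewrite addrACA lerD.
Qed.

Lemma bdN a c : bd a c -> bd (- a) c.
Proof.
move=> [M [u [g [[M0 u0 aM kg] [gu Mu]]]]]; exists M, u, g; split; split => //.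
- by move=> x; rewrite nrmN.
- by case: kg => mg g0 kg; split => // t x; rewrite nrmN.
Qed.

Lemma majZl (B : X -> X) M (k : R -> X -> X) g : 0 <= M ->
  (forall x, nrm (B x) <= M * nrm x) -> maj k g -> maj (fun t x => B (k t x)) (fun t => M%:E * g t)%E.
Proof.
move=> M0 BM [mg g0 kg]; split.
- exact: measurable_funeM.
- by move=> t; rewrite mule_ge0.
- move=> t x; rewrite -muleA; apply: le_trans (_ : M%:E * (nrm (k t x))%:E <= _)%E.
    by rewrite -EFinM lee_fin.
  by apply: lee_wpmul2l => //; rewrite lee_fin.
Qed.

Lemma majZr (B : X -> X) M (k : R -> X -> X) g : 0 <= M ->
  (forall x, nrm (B x) <= M * nrm x) -> maj k g -> maj (fun t x => k t (B x)) (fun t => M%:E * g t)%E.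
Proof.
move=> M0 BM [mg g0 kg]; split.
- exact: measurable_funeM.
- by move=> t; rewrite mule_ge0.
- move=> t x; rewrite [(M%:E * _)%E]muleC -muleA -EFinM; apply: le_trans (kg _ _) _.
  by apply: lee_wpmul2l => //; rewrite lee_fin.
Qed.

Lemma integralZ_le M (g : R -> \bar R) d : 0 <= M -> measurable_fun setT g ->
  (forall t, (0 <= g t)%E) -> (\int[mu]_t g t <= d%:E)%E ->
  (\int[mu]_t (M%:E * g t) <= (M * d)%:E)%E.
Proof.
move=> M0 mg g0 h; rewrite ge0_integralZl; last 4 first.
- exact: measurableT.
- exact: mg.
- by move=> t _; exact: g0.
- by rewrite lee_fin.
by rewrite EFinM lee_wpmul2l ?lee_fin.
Qed.

Lemma integral_cvm_le (g h : R -> \bar R) c d : measurable_fun setT g -> measurable_fun setT h ->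
  (forall t, (0 <= g t)%E) -> (forall t, (0 <= h t)%E) ->
  (\int[mu]_t g t <= c%:E)%E -> (\int[mu]_t h t <= d%:E)%E ->
  (\int[mu]_t cvm g h t <= (c * d)%:E)%E.
Proof.
move=> mg mh g0 h0 gc hd; rewrite integral_cvm// EFinM.
by apply: lee_pmul => //; exact: integral_ge0.
Qed.

Lemma bdM a b c d : bd a c -> bd b d -> bd (a * b) (c * d).
Proof.
move=> [M [u [g [[M0 u0 aM kg] [gu Mu]]]]] [N [v [h [[N0 v0 bN kh] [hv Nv]]]]].
have [mg g0 _] := kg; have [mh h0 _] := kh.
have [Aa [_ ba _ _ _]] := kernP p1 (kerP a).
have [Ab [_ bb _ _ _]] := kernP p1 (kerP b).
have k1 := majZl M0 aM kh; have k2 := majZr N0 bN kg.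
have k3 := maj_cK ba bb kg kh.
exists (M * N), (M * v + N * u + u * v), (fun t => M%:E * h t + N%:E * g t + cvm g h t)%E.
split; split.
- exact: mulr_ge0.
- by rewrite !addr_ge0// mulr_ge0.
- by move=> x; rewrite opM (le_trans (aM _))// -mulrA ler_wpM2l.
- exact: (majD (majD k1 k2) k3).
- have [m1 p1' _] := k1; have [m2 p2 _] := k2; have [m3 p3 _] := k3.
  have [m4 p4 _] := majD k1 k2.
  apply: integralD_le => //; last exact: integral_cvm_le.
  by apply: integralD_le => //; exact: integralZ_le.
- apply: le_trans (_ : (M + u) * (N + v) <= _).
    by rewrite le_eqVlt; apply/orP; left; apply/eqP; ring.
  by apply: ler_pM => //; rewrite addr_ge0.
Qed.

Lemma bd_ex a : exists c, bd a c.
Proof.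
have [Aa [A0 ba ga ca _]] := kernP p1 (kerP a); have [_ [M M0 aM]] := opP a.
exists (M + Aa * cw p), M, (Aa * cw p), (wmaj p Aa); split; split => //.
by rewrite mulr_ge0// cw_ge0.
Qed.

Lemma maj0 : maj (fun (_ : R) (_ : X) => (0 : X)) (fun=> 0%E).
Proof. by split => // t x; rewrite nrm0 mul0e. Qed.

Definition opA (B : X -> X) (hB : isop B) : A := Alg p1 hB (kern0 X p).

Lemma bd_opA (B : X -> X) (hB : isop B) M : 0 <= M -> (forall x, nrm (B x) <= M * nrm x) ->
  bd (opA hB) M.
Proof.
move=> M0 BM; exists M, 0, (fun=> 0%E); split; split => //.
- exact: maj0.
- by rewrite integral0.
- by rewrite addr0.
Qed.

Lemma bd1 : bd 1 1.
Proof.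
have := @bd_opA id (@isop_id R X) 1 ler01; apply => x; by rewrite mul1r.
Qed.

Lemma isop_scale (z : R[i]) : isop (fun x : X => z *: x).
Proof.
split; first exact: islin_scale.
by exists (cabs z) => [|x]; [exact: cabs_ge0|rewrite nrmZ].
Qed.

Definition scA (z : R[i]) : A := opA (isop_scale z).

Lemma bd_scA z : bd (scA z) (cabs z).
Proof. by apply: bd_opA => [|x]; [exact: cabs_ge0|rewrite nrmZ]. Qed.

Lemma ker_scAl z a t x : ker (scA z * a) t x = z *: ker a t x.
Proof.
rewrite kerM /= addr0 (_ : conv _ _ t = 0) ?addr0//.
by apply: bintE; exact: Lint_isI0.
Qed.

Lemma ker_opAl (B : X -> X) (hB : isop B) a t x : ker (opA hB * a) t x = B (ker a t x).
Proof.
rewrite kerM /= addr0 (_ : conv _ _ t = 0) ?addr0//.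
by apply: bintE; exact: Lint_isI0.
Qed.

Lemma ker_opAr (B : X -> X) (hB : isop B) a t x : ker (a * opA hB) t x = ker a t (B x).
Proof.
have [Aa [_ ba _ _ _]] := kernP p1 (kerP a).
by rewrite kerM /= (islin0 (oplin a)) add0r (conv0 t ba) addr0.
Qed.

Lemma scA_central z a : scA z * a = a * scA z.
Proof.
apply: alg_eq => [x|t x].
  by rewrite !opM /= (islinZ _ _ (oplin a)).
by rewrite ker_scAl ker_opAr (islinZ _ _ (kerlin a t)).
Qed.

(** The ideal W_X: no multiple of delta_0. *)
Definition inW0 a := forall x, op a x = 0.

Lemma inW0D a b : inW0 a -> inW0 b -> inW0 (a + b).
Proof. by move=> ha hb x; rewrite /= ha hb addr0. Qed.
Lemma inW0N a : inW0 a -> inW0 (- a).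
Proof. by move=> ha x; rewrite /= ha oppr0. Qed.
Lemma inW0Ml a b : inW0 a -> inW0 (a * b).
Proof. by move=> ha x; rewrite opM ha. Qed.
Lemma inW0Mr a b : inW0 b -> inW0 (a * b).
Proof. by move=> hb x; rewrite opM hb (islin0 (oplin a)). Qed.

Lemma ker_inW0 a b t x : inW0 a -> inW0 b -> ker (a * b) t x = cK (ker a) (ker b) t x.
Proof. by move=> ha hb; rewrite kerM ha hb (islin0 (kerlin a t)) !add0r. Qed.

(** A single majorant satisfies both bounds, as [cvm_wt] requires. *)
Definition bnd a (W d : R) := [/\ inW0 a, 0 <= W, 0 <= d & exists g : R -> \bar R,
  [/\ maj (ker a) g, forall t, (g t <= wmaj p W t)%E & (\int[mu]_t g t <= d%:E)%E]].

Lemma bndM a b W V c d : bnd a W c -> bnd b V d ->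
  bnd (a * b) (2 `^ p * (W * d + V * c)) (c * d).
Proof.
move=> [ia W0 c0 [g [kg gW gc]]] [ib V0 d0 [h [kh hV hd]]].
have [mg g0 _] := kg; have [mh h0 _] := kh.
have [Aa [_ ba _ _ _]] := kernP p1 (kerP a).
have [Ab [_ bb _ _ _]] := kernP p1 (kerP b).
split.
- exact: inW0Ml.
- by rewrite mulr_ge0 ?powR_ge0// addr_ge0// mulr_ge0.
- exact: mulr_ge0.
exists (cvm g h); split.
- have [m3 p3 k3] := maj_cK ba bb kg kh; split => // t x.
  by rewrite ker_inW0.
- by move=> t; exact: cvm_wt.
- exact: integral_cvm_le.
Qed.

Lemma bnd_wt a W d t x : bnd a W d -> nrm (ker a t x) <= W * wt p t * nrm x.
Proof.
move=> [_ _ _ [g [[_ _ kg] gW _]]]; rewrite -lee_fin (le_trans (kg t x))// EFinM.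
by apply: lee_wpmul2r => //; rewrite lee_fin nrm_ge0.
Qed.

(** The minimum of an integrable majorant and of the weighted one is still a majorant, and it
    inherits both bounds. *)
Lemma bd_bnd a c W : inW0 a -> bd a c -> 0 <= W ->
  (forall t x, nrm (ker a t x) <= W * wt p t * nrm x) -> bnd a W c.
Proof.
move=> ia ha W0 hW; have c0 := bd_ge0 ha.
case: ha => M [d [g [[M0 d0 _ [mg g0 kg]] [gd Md]]]]; split => //.
have [mw w0 kw] := kern_maj W0 hW.
exists (fun t => mine (g t) (wmaj p W t)); split.
- split; first exact: measurable_mine.
    by move=> t; rewrite le_min g0 w0.
  by move=> t x; rewrite /mine; case: ifP => _; [exact: kg|exact: kw].
- by move=> t; rewrite ge_min lexx orbT.
- apply: (@le_trans _ _ (\int[mu]_t g t)%E).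
    apply: le_lower_integral => t; first by rewrite le_min g0 w0.
    by rewrite ge_min lexx.
  by rewrite (le_trans gd)// lee_fin; lra.
Qed.

End Bounds.

Section GeometricLimit.
Context (R : realType) (X : completeNormedModType R[i]).

Lemma half_expn_lt (e : R) : 0 < e -> exists N, forall k, (N <= k)%N -> 2^-1 ^+ k < e.
Proof.
move=> e0; have /cvgrPdist_lt /(_ e e0) [N _ hN] :
    (fun k => 2^-1 ^+ k : R) @ \oo --> (0 : R).
  by apply: cvg_expr; rewrite ger0_norm ?invr_ge0// invf_lt1 ?ltr1n.
exists N => k Nk; have := hN k Nk.
by rewrite /= sub0r normrN gtr0_norm// exprn_gt0 ?invr_gt0.
Qed.

Lemma half_expn_scale (K e : R) : 0 <= K -> 0 < e -> exists n, K * 2^-1 ^+ n <= e.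
Proof.
move=> K0 e0; have K1 : 0 < K + 1 by rewrite ltr_wpDl.
have [N hN] := half_expn_lt (divr_gt0 e0 K1); exists N.
have := hN N (leqnn _); rewrite ltr_pdivlMr// => /ltW; apply: le_trans.
by rewrite mulrC ler_wpM2l ?exprn_ge0 ?invr_ge0// lerDl.
Qed.

Lemma geometric_cauchy (u : nat -> X) (K : R) :
  (forall n, nrm (u n.+1 - u n) <= K * 2^-1 ^+ n) ->
  exists l, forall n, nrm (l - u n) <= 2 * K * 2^-1 ^+ n.
Proof.
move=> h; have K0 : 0 <= K.
  by have := h 0; rewrite expr0 mulr1; apply: le_trans; exact: nrm_ge0.
have h2 m n : nrm (u (n + m)%N - u n) <= 2 * K * (2^-1 ^+ n - 2^-1 ^+ (n + m)).
  elim: m => [|m IH]; first by rewrite addn0 !subrr nrm0 mulr0.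
  have := h (n + m)%N; have := nrm_tri (u (n + m)%N) (u (n + m.+1)%N) (u n).
  rewrite addnS; move: IH; set x := _ ^+ n; rewrite exprS; set y := _ ^+ (n + m).
  lra.
have h3 m n : nrm (u (n + m)%N - u n) <= 2 * K * 2^-1 ^+ n.
  apply: le_trans (h2 m n) _; rewrite ler_wpM2l ?mulr_ge0// gerBl.
  by rewrite exprn_ge0 ?invr_ge0.
have [|l hl] := @nrm_complete _ X u.
  move=> e e0; have e2 : 0 < e / 4 by rewrite divr_gt0.
  have [N hN] := half_expn_scale (mulr_ge0 (ler0n R 2) K0) e2.
  exists N => m n Nm Nn.
  have := h3 (m - N)%N N; have := h3 (n - N)%N N; rewrite !subnKC// => a b.
  have := nrm_tri (u N) (u m) (u n); rewrite (nrm_distC (u N) (u n)).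
  lra.
exists l => n; apply: (@eps0 _ _ _ 1) => // e e0.
have [N hN] := (nrm_cvgP _ _).1 hl e e0.
have := nrm_tri (u (n + N)%N) l (u n); rewrite (nrm_distC l (u (n + N)%N)).
have := h3 N n; have := hN (n + N)%N (leq_addl _ _); lra.
Qed.
End GeometricLimit.

(** * Neumann series in the weighted norm *)

Section Neumann.
Context (R : realType) (X : completeNormedModType R[i]) (p : R) (p1 : 1 < p).
Local Notation A := (alg X p1).
Local Notation mu := (@lebesgue_measure R).
Implicit Types a b e f : A.

Let p0 : 0 <= p. Proof. exact: le_trans ler01 (ltW p1). Qed.

(* The L^1 size below which Neumann series converge in the weighted norm. *)
Definition kap : R := (4 * 2 `^ p)^-1.

Lemma two_p_ge1 : 1 <= 2 `^ p :> R.
Proof. by have := @ler_powR R 2 (ler1n _ _) 0 p p0; rewrite powRr0. Qed.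

Lemma kap_gt0 : 0 < kap.
Proof. by rewrite invr_gt0 mulr_gt0// powR_gt0. Qed.

Lemma kap_le : kap <= 4^-1.
Proof.
rewrite /kap invfM ler_piMr ?invr_ge0// invf_le1 ?two_p_ge1//.
Qed.

Definition wb a W := [/\ inW0 a, 0 <= W & forall t x, nrm (ker a t x) <= W * wt p t * nrm x].

Lemma wbM a b W V : wb a W -> wb b V -> wb (a * b) (2 `^ p * (W * (V * cw p) + V * (W * cw p))).
Proof.
move=> [ia W0 ha] [ib V0 hb]; split.
- exact: inW0Ml.
- by rewrite mulr_ge0 ?powR_ge0// addr_ge0// !mulr_ge0 ?cw_ge0.
move=> t x; rewrite ker_inW0//.
have ba := kern_bker p1 (kerP a) W0 ha; have bb := kern_bker p1 (kerP b) V0 hb.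
exact: (kern_cK_bound p1 t x ba bb (kern_maj W0 ha) (kern_maj V0 hb) W0 V0
  (fun=> lexx _) (fun=> lexx _) (wmaj_int p1 W0) (wmaj_int p1 V0)).
Qed.

Lemma wbB a b W V : wb a W -> wb b V -> wb (a - b) (W + V).
Proof.
move=> [ia W0 ha] [ib V0 hb]; split.
- by apply: inW0D => //; exact: inW0N.
- exact: addr_ge0.
- by move=> t x; rewrite kerD kerN (le_trans (nrmB _ _))// !mulrDl lerD.
Qed.

Lemma wb_eq0 a (K : R) : (forall n, wb a (K * 2^-1 ^+ n)) -> a = 0.
Proof.
move=> h; have [ia K0 _] := h 0; rewrite expr0 mulr1 in K0.
apply: alg_eq => [x|t x]; first by rewrite ia.
apply: nrm_eq0; apply/ler_addgt0Pr => e e0; rewrite add0r.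
have [n hn] := half_expn_scale (mulr_ge0 (mulr_ge0 K0 (wt_ge0 p t)) (nrm_ge0 x)) e0.
have [_ _ /(_ t x) hh] := h n; apply: le_trans hh _; apply: le_trans hn.
by rewrite le_eqVlt; apply/orP; left; apply/eqP; ring.
Qed.

(* The norm [k * W + 2^p * d], with W the weighted bound and d the L1 bound, is
   submultiplicative for every k > 0; k is chosen small after f is known, so
   that only the L1 size of f has to be small. *)
Lemma powers_wb f (c : R) : inW0 f -> bd f c -> c <= kap ->
  exists2 K, 0 <= K & forall n, wb (f ^+ n.+1) (K * 2^-1 ^+ n).
Proof.
move=> iff fc ck; have c0 := bd_ge0 fc.
have [_ _ [W W0 hW]] := kerP f.
pose C : R := 2 `^ p; have C1 : 1 <= C := two_p_ge1.
have C0 : 0 <= C by exact: le_trans ler01 C1.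
(* With this k, and c at most [kap], each of the two terms in the norm of [f] is at most 1/4, so
   powers decay like 2^-n. *)
pose k : R := (4 * (W + 1))^-1.
have k0 : 0 < k by rewrite invr_gt0 mulr_gt0// ltr_wpDl.
have kW : k * W <= 4^-1.
  rewrite /k invfM -mulrA ler_piMr ?invr_ge0//.
  by rewrite mulrC ler_pdivrMr ?ltr_wpDl// mul1r lerDl.
have Cc : C * c <= 4^-1.
  apply: le_trans (ler_wpM2l C0 ck) _; rewrite /kap invfM mulrCA mulfV ?mulr1//.
  by rewrite gt_eqF// (lt_le_trans ltr01).
have f1 : bnd f W c by exact: bd_bnd.
have key n : exists V d, bnd (f ^+ n.+1) V d /\ k * V + C * d <= 2^-1 ^+ n.+1.
  elim: n => [|n [V [d [hb hV]]]].
    by exists W, c; rewrite !expr1; split => //; lra.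
  exists (C * (V * c + W * d)), (d * c); rewrite exprSr; split; first exact: bndM.
  have [_ V0 d0 _] := hb.
  rewrite [leRHS]exprSr.
  apply: le_trans (_ : (k * V + C * d) * (k * W + C * c) <= _).
    rewrite -subr_ge0.
    have -> : (k * V + C * d) * (k * W + C * c) - (k * (C * (V * c + W * d)) + C * (d * c)) =
      k * V * (k * W) + C * (C - 1) * (d * c) by ring.
    by rewrite addr_ge0// !mulr_ge0 ?subr_ge0// ltW.
  have k0' := ltW k0; apply: ler_pM => //; [| |lra].
    by rewrite addr_ge0// mulr_ge0.
  by rewrite addr_ge0// mulr_ge0.
exists k^-1 => [|n]; first by rewrite invr_ge0 ltW.
have [V [d [hb hV]]] := key n; have [ib V0 d0 _] := hb.
split => //; first by apply: mulr_ge0; [rewrite invr_ge0 ltW|rewrite exprn_ge0 ?invr_ge0].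
move=> t x; apply: le_trans (bnd_wt t x hb) _.
rewrite ler_wpM2r ?nrm_ge0// ler_wpM2r ?wt_ge0// mulrC ler_pdivlMr// mulrC.
apply: le_trans (_ : 2^-1 ^+ n.+1 <= _).
  by apply: le_trans hV; rewrite lerDl mulr_ge0.
by rewrite exprS ler_piMl ?exprn_ge0 ?invr_ge0//; lra.
Qed.

(** The series is summed pointwise in (t, x). The geometric error is proportional to the weight, so
    linearity and integrability pass to the limit, and the two equations follow from those of the
    partial sums because an element with weighted bounds K 2^-n for all n is 0. *)
Lemma neumann_sum f (c : R) : inW0 f -> bd f c -> c <= kap ->
  exists S, [/\ inW0 S, S = f + f * S & S = f + S * f].
Proof.
move=> iff fc ck; have [K K0 hK] := powers_wb iff fc ck.
pose s n : A := \sum_(j < n) f ^+ j.+1.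
have sS n : s n.+1 = s n + f ^+ n.+1 by rewrite /s big_ord_recr.
have sW n : inW0 (s n).
  elim: n => [|n IH]; first by rewrite /s big_ord0.
  by rewrite sS; apply: inW0D => //; case: (hK n).
have sl n : s n.+1 = f + f * s n.
  elim: n => [|n IH]; first by rewrite sS /s big_ord0 mulr0 add0r addr0 expr1.
  by rewrite [in LHS]sS [in LHS]IH [in RHS]sS mulrDr -exprS addrA.
have sr n : s n.+1 = f + s n * f.
  elim: n => [|n IH]; first by rewrite sS /s big_ord0 mul0r add0r addr0 expr1.
  by rewrite [in LHS]sS [in LHS]IH [in RHS]sS mulrDl -exprSr addrA.
have /choice[S0 hS0] : forall z : R * X, exists l, forall n,
    nrm (l - ker (s n) z.1 z.2) <= 2 * (K * wt p z.1 * nrm z.2) * 2^-1 ^+ n.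
  move=> [t x] /=; apply: geometric_cauchy => n.
  rewrite sS kerD addrAC subrr add0r.
  have [_ _ /(_ t x)] := hK n => /le_trans; apply.
  by rewrite le_eqVlt; apply/orP; left; apply/eqP; ring.
pose kS t x := S0 (t, x).
have hS n t x : nrm (kS t x - ker (s n) t x) <= (2 * K) * 2^-1 ^+ n * wt p t * nrm x.
  apply: le_trans (hS0 (t, x) n) _ => /=.
  by rewrite le_eqVlt; apply/orP; left; apply/eqP; ring.
have lim (u v : X) (M : R) : 0 <= M -> (forall n, nrm (u - v) <= M * 2^-1 ^+ n) -> u = v.
  move=> M0 h; apply/eqP; rewrite -subr_eq0; apply/eqP/nrm_eq0.
  apply/ler_addgt0Pr => e e0; rewrite add0r.
  by have [n hn] := half_expn_scale M0 e0; exact: le_trans (h n) hn.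
have kSk : kern p kS.
  split.
  - move=> t a x y; pose M := 2 * K * wt p t.
    have M0 : 0 <= M by rewrite !mulr_ge0 ?wt_ge0.
    apply: (lim _ _ (M * nrm (a *: x + y) + cabs a * (M * nrm x) + M * nrm y)).
      by apply: addr_ge0; [apply: addr_ge0|]; do ?[exact: nrm_ge0 | exact: cabs_ge0 | exact: M0 | apply: mulr_ge0].
    move=> n.
    have -> : kS t (a *: x + y) - (a *: kS t x + kS t y) =
       (kS t (a *: x + y) - ker (s n) t (a *: x + y)) - (a *: (kS t x - ker (s n) t x) + (kS t y - ker (s n) t y)).
      have -> : ker (s n) t (a *: x + y) = a *: ker (s n) t x + ker (s n) t y by exact: kerlin.
      by rewrite scalerBr; zmod.
    have h1 := hS n t (a *: x + y); have h2 := hS n t x; have h3 := hS n t y.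
    have h4 := ler_wpM2l (cabs_ge0 a) h2.
    rewrite (le_trans (nrmB _ _))//.
    have := nrmD (a *: (kS t x - ker (s n) t x)) (kS t y - ker (s n) t y).
    rewrite nrmZ; move: h1 h3 h4; rewrite /M; set h := 2^-1 ^+ n; set w := wt p t.
    have -> : (2 * K * w * nrm (a *: x + y) + cabs a * (2 * K * w * nrm x) + 2 * K * w * nrm y) * h =
      2 * K * h * w * nrm (a *: x + y) + cabs a * (2 * K * h * w * nrm x) + 2 * K * h * w * nrm y by ring.
    lra.
  - move=> x; apply: Lint_lim => e e0.
    have [n hn] := half_expn_scale (mulr_ge0 (mulr_ge0 (mulr_ge0 (ler0n R 2) K0) (cw_ge0 p)) (nrm_ge0 x)) e0.
    exists (ker (s n) ^~ x); split; first exact: kerLint.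
    apply: N1leW hn.
    have M0 : 0 <= 2 * K * 2^-1 ^+ n by rewrite !mulr_ge0 ?exprn_ge0 ?invr_ge0.
    have := N1le_maj x (kern_maj M0 (fun t y => hS n t y)) (wmaj_int p1 M0).
    move=> h; apply: N1leW h _.
    by rewrite le_eqVlt; apply/orP; left; apply/eqP; ring.
  - exists (2 * K) => [|t x]; first exact: mulr_ge0.
    have := hS 0 t x; rewrite expr0 mulr1 (_ : ker (s 0) t x = 0) ?subr0//.
    by rewrite /s big_ord0.
pose S : A := Alg p1 (isop0 X) kSk.
have iS : inW0 S by [].
have wS n : wb (S - s n) (2 * K * 2^-1 ^+ n).
  split.
  - by apply: inW0D => //; exact: inW0N.
  - by rewrite !mulr_ge0 ?exprn_ge0 ?invr_ge0.
  - by move=> t x; rewrite kerD kerN; exact: hS.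
have [_ _ [W W0 hW]] := kerP f; have wf : wb f W by [].
pose K' := 2 * K + 2 `^ p * (W * (2 * K * cw p) + 2 * K * (W * cw p)).
have le1 n : 2 * K * 2^-1 ^+ n.+1 <= 2 * K * 2^-1 ^+ n :> R.
  by rewrite ler_wpM2l ?mulr_ge0// exprS ler_piMl ?exprn_ge0 ?invr_ge0//; lra.
exists S; split => //.
- apply/eqP; rewrite -subr_eq0; apply/eqP; apply: (@wb_eq0 _ K') => n.
  (* The recursion of the partial sums writes the defect through the errors of [s n.+1] and [s n]
     only. *)
  have -> : S - (f + f * S) = (S - s n.+1) - f * (S - s n).
    by rewrite sl mulrBr; zmod.
  have [i1 b1 h1] := wbB (wS n.+1) (wbM wf (wS n)).
  have bb : 2 * K * 2^-1 ^+ n.+1 + 2 `^ p * (W * (2 * K * 2^-1 ^+ n * cw p) + 2 * K * 2^-1 ^+ n * (W * cw p)) <= K' * 2^-1 ^+ n.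
    rewrite /K' [leRHS]mulrDl; apply: lerD; first exact: le1.
    by rewrite le_eqVlt; apply/orP; left; apply/eqP; ring.
  split => //; first exact: le_trans b1 bb.
  move=> t x; apply: le_trans (h1 t x) _.
  by rewrite ler_wpM2r ?nrm_ge0// ler_wpM2r ?wt_ge0.
- apply/eqP; rewrite -subr_eq0; apply/eqP; apply: (@wb_eq0 _ K') => n.
  have -> : S - (f + S * f) = (S - s n.+1) - (S - s n) * f.
    by rewrite sr mulrBl; zmod.
  have [i1 b1 h1] := wbB (wS n.+1) (wbM (wS n) wf).
  have bb : 2 * K * 2^-1 ^+ n.+1 + 2 `^ p * (2 * K * 2^-1 ^+ n * (W * cw p) + W * (2 * K * 2^-1 ^+ n * cw p)) <= K' * 2^-1 ^+ n.
    rewrite /K' [leRHS]mulrDl; apply: lerD; first exact: le1.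
    by rewrite le_eqVlt; apply/orP; left; apply/eqP; ring.
  split => //; first exact: le_trans b1 bb.
  move=> t x; apply: le_trans (h1 t x) _.
  by rewrite ler_wpM2r ?nrm_ge0// ler_wpM2r ?wt_ge0.
Qed.

(** The numerical bound on the inverse is unweighted and comes from S = - e - e S: any bound d of S
    improves to c + c d, and c is at most 1/4. *)
Lemma neumann e (c : R) : inW0 e -> bd e c -> c <= kap ->
  exists H, [/\ H * (1 + e) = 1, (1 + e) * H = 1 & bd H 2].
Proof.
move=> ie ec ck; have c0 := bd_ge0 ec.
have [S [iS SL SR]] := neumann_sum (inW0N ie) (bdN ec) ck.
exists (1 + S); split.
- rewrite mulrDl mul1r mulrDr mulr1 {1}SR mulrN; zmod.
- rewrite mulrDl mul1r mulrDr mulr1 {1}SL mulNr; zmod.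
have c4 : c <= 4^-1 := le_trans ck kap_le.
have [d hd] := bd_ex S.
(* 1/3 is the fixed point of d -> 1/4 + d/4; the a priori bound d is forgotten at rate 4^-n. *)
have iter n : bd S (3^-1 + 4^-1 ^+ n * d).
  elim: n => [|n IH]; first by apply: bdW hd; rewrite expr0; lra.
  rewrite SL; apply: bdW (bdD (bdN ec) (bdM (bdN ec) IH)).
  rewrite exprS; have d0 := bd_ge0 hd.
  have q0 : 0 <= 4^-1 ^+ n * d by rewrite mulr_ge0// exprn_ge0// invr_ge0.
  move: q0; rewrite -mulrA; set q := _ ^+ n * d => q0.
  have h3 : 0 <= 3^-1 + q by lra.
  have := ler_wpM2r h3 c4; lra.
have [n hn] : exists n, 4^-1 ^+ n * d <= 2^-1 :> R.
  have d0 := bd_ge0 hd.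
  have h2 : 0 < 2^-1 :> R by rewrite invr_gt0.
  have [n hn] := half_expn_scale d0 h2.
  exists n; apply: le_trans hn; rewrite mulrC ler_wpM2l//.
  by rewrite lerXn2r ?nnegrE ?invr_ge0//; lra.
rewrite (_ : 2 = 1 + 1)//; apply: bdD; first exact: bd1.
by apply: bdW (iter n); lra.
Qed.

End Neumann.

(** * One-sided exponentials *)

Section HalfLineExponentials.
Context (R : realType).
Local Notation mu := (@lebesgue_measure R).
Implicit Types (w v t s : R).

Definition rp w t : R := if 0 <= t then expR (- w * t) else 0.
Definition rm v t : R := if t < 0 then expR (v * t) else 0.

Lemma rp_ge0 w t : 0 <= rp w t.
Proof. by rewrite /rp; case: ifP => // _; exact: expR_ge0. Qed.

Lemma rm_ge0 w t : 0 <= rm w t.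
Proof. by rewrite /rm; case: ifP => // _; exact: expR_ge0. Qed.

Lemma measurable_expRM w : measurable_fun setT (fun t : R => expR (w * t)).
Proof.
apply: (@measurableT_comp _ _ _ _ _ _ (@expR R) _ (fun t => w * t)).
  exact: measurable_expR.
by apply: measurable_funM; [exact: measurable_cst|exact: measurable_id].
Qed.

Lemma measurable_rp w : measurable_fun setT (rp w).
Proof.
apply: measurable_fun_ifT; [|exact: measurable_expRM|exact: measurable_cst].
by apply: measurable_fun_ler; [exact: measurable_cst|exact: measurable_id].
Qed.

Lemma measurable_rm w : measurable_fun setT (rm w).
Proof.
apply: measurable_fun_ifT; [|exact: measurable_expRM|exact: measurable_cst].
by apply: measurable_fun_ltr; [exact: measurable_id|exact: measurable_cst].
Qed.

(** w times [rp w] is the density of the exponential law. An infinite integral is excluded before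
    dividing by w. *)
Lemma integral_rp w : 0 < w -> (\int[mu]_t (rp w t)%:E = (w^-1)%:E)%E.
Proof.
move=> w0; have := integral_exponential_pdf w0.
have -> : (fun t => (exponential_pdf w t)%:E) = (fun t => w%:E * (rp w t)%:E)%E.
  apply/funext => t; rewrite -EFinM /exponential_pdf /patch /rp; congr EFin.
  case: ifPn => [/set_mem|/negP]; rewrite ?inE/= in_itv/= andbT.
    by move=> ->.
  by move=> /negP/negbTE ->; rewrite mulr0.
rewrite ge0_integralZl; last 4 first.
- exact: measurableT.
- by apply/measurable_EFinP; exact: measurable_rp.
- by move=> t _; rewrite lee_fin rp_ge0.
- by rewrite lee_fin ltW.
move=> h; have : (\int[mu]_t (rp w t)%:E >= 0)%E.
  by apply: integral_ge0 => t _; rewrite lee_fin rp_ge0.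
move: h; case: (\int[mu]_t (rp w t)%:E)%E => [r| |]; last 2 first.
- by rewrite gt0_muley ?lte_fin.
- by rewrite leeNy_eq.
rewrite -EFinM => -[wr] _; congr EFin.
by rewrite -[LHS](mulKf (lt0r_neq0 w0)) wr mulr1.
Qed.

Lemma integral_rm w : 0 < w -> (\int[mu]_t (rm w t)%:E = (w^-1)%:E)%E.
Proof.
move=> w0; rewrite -(integral_rp w0).
have mrm : measurable_fun setT (fun t => (rm w t)%:E).
  by apply/measurable_EFinP; exact: measurable_rm.
have mrp : measurable_fun setT (fun t => (rp w t)%:E).
  by apply/measurable_EFinP; exact: measurable_rp.
rewrite -(integral_refl 0 mrm); last by move=> t; rewrite lee_fin rm_ge0.
transitivity (\int[mu]_(t in `]0%R, +oo[) (rp w t)%:E)%E.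
  rewrite [RHS]integral_mkcond; apply: eq_integral => t _.
  rewrite sub0r /rm /patch oppr_lt0; case: ifPn => [t0|].
    rewrite ifT; last by rewrite inE/= in_itv/= t0.
    by rewrite /rp ltW// mulrN mulNr.
  by move=> t0; rewrite ifF//; apply/negP; rewrite inE/= in_itv/= (negbTE t0).
(* The reflection of [rm] omits the point 0, where [rp] equals 1. *)
rewrite integral_itv_obnd_cbnd; last exact: measurable_funTS.
rewrite integral_mkcond; apply: eq_integral => t _.
rewrite /patch; case: ifPn => // /negP; rewrite inE/= in_itv/= andbT => /negP t0.
by rewrite /rp (negbTE t0).
Qed.

Lemma jbr_le1 t : jbr t <= 1 + `|t|.
Proof.
rewrite -(@ler_pXn2r _ 2) ?nnegrE ?(ltW (jbr_gt0 t))// ?addr_ge0//.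
rewrite jbr_sqr -[t ^+ 2]real_normK ?num_real// sqrrD expr1n mul1r.
by rewrite lerD2r lerDl mulrn_wge0.
Qed.

(** The bound <t> <= 1 + |t| <= exp(a|t|) / a, whose second half uses a <= 1, is raised to the power
    p. *)
Lemma expR_bound (a p t : R) : 0 < a -> 0 <= p -> a <= 1 ->
  expR (- (a * p) * `|t|) <= a^-1 `^ p * wt p t.
Proof.
move=> a0 p0 a1; have ai : 0 < a^-1 by rewrite invr_gt0.
have h1 : jbr t <= a^-1 * expR (a * `|t|).
  apply: le_trans (jbr_le1 t) _; rewrite ler_pdivlMl//.
  apply: le_trans (expR_ge1Dx _); rewrite mulrDr mulr1 lerD2r//.
have h2 : jbr t `^ p <= a^-1 `^ p * expR (a * p * `|t|).
  rewrite mulrAC expRM -powRM ?expR_ge0 ?(ltW ai)//.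
  by apply: ge0_ler_powR; rewrite ?nnegrE ?(ltW (jbr_gt0 t))// mulr_ge0 ?expR_ge0// ltW.
rewrite /wt ler_pdivlMr ?powR_gt0 ?jbr_gt0//.
apply: le_trans (ler_wpM2l (expR_ge0 _) h2) _.
by rewrite mulrCA -expRD mulNr addNr expR0 mulr1.
Qed.

Lemma expR_wt w p : 0 < w -> 0 < p -> exists2 C, 0 <= C &
  forall t, expR (- w * `|t|) <= C * wt p t.
Proof.
move=> w0 p0; pose a := Num.min 1 (w / p).
have a0 : 0 < a by rewrite lt_min ltr01 divr_gt0.
have a1 : a <= 1 by rewrite ge_min lexx.
have ap : a * p <= w by rewrite -ler_pdivlMr// ge_min lexx orbT.
exists (a^-1 `^ p) => [|t]; first exact: powR_ge0.
apply: le_trans (expR_bound t a0 (ltW p0) a1).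
by rewrite ler_expR !mulNr lerN2 ler_wpM2r.
Qed.

Lemma rp_le w t : rp w t <= expR (- w * `|t|).
Proof. by rewrite /rp; case: ifPn => [t0|_]; rewrite ?expR_ge0// ger0_norm. Qed.

Lemma rm_le w t : rm w t <= expR (- w * `|t|).
Proof.
by rewrite /rm; case: ifPn => [t0|_]; rewrite ?expR_ge0// ltr0_norm// mulrNN.
Qed.

(** The integrand lives on [0, t]. Adding the part beyond t, which is a reflected copy of [rm],
    completes it to a half-line exponential of rate w - v, so only half-line integrals are
    evaluated. *)
Lemma conv_rp_rp w v t : v < w ->
  (\int[mu]_s (rp w s * rp v (t - s))%:E = ((rp v t - rp w t) / (w - v))%:E)%E.
Proof.
move=> vw; pose u := w - v; have u0 : 0 < u by rewrite subr_gt0.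
have [t0|t0] := leP 0 t; last first.
  have rp0 z : rp z t = 0 by rewrite /rp leNgt t0.
  rewrite !rp0 subrr mul0r.
  apply: integral0_eq => s _; rewrite /rp; case: ifPn => s0; last by rewrite mul0r.
  by rewrite ifF ?mulr0//; apply/negbTE; rewrite -ltNge subr_lt0 (lt_le_trans t0).
have hs s : rp v t * rp u s = rp w s * rp v (t - s) + rp v t * (expR (- u * t) * rm u (t - s)).
  rewrite /rp t0 /rm subr_lt0; case: (leP 0 s) => s0; last first.
    by rewrite !mul0r add0r (ltNge t s) (le_trans (ltW s0) t0) /= !mulr0.
  rewrite subr_ge0; case: (leP s t) => st.
    by rewrite !mulr0 addr0 -!expRD; congr expR; rewrite /u; ring.
  by rewrite mulr0 add0r -!expRD; congr expR; rewrite /u; ring.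
have m1 : measurable_fun setT (fun s : R => (rp w s * rp v (t - s))%:E).
  apply/measurable_EFinP; apply: measurable_funM; first exact: measurable_rp.
  exact: (measurableT_comp (measurable_rp v) (measurable_refl t)).
have m3 : measurable_fun setT (fun s : R => (rm u (t - s))%:E).
  by apply/measurable_EFinP; exact: (measurableT_comp (measurable_rm u) (measurable_refl t)).
have m2 : measurable_fun setT (fun s : R => (rp v t * expR (- u * t))%:E * (rm u (t - s))%:E)%E.
  exact: measurable_funeM.
have c0 : 0 <= rp v t * expR (- u * t) by rewrite mulr_ge0 ?rp_ge0 ?expR_ge0.
have e1 : (\int[mu]_s ((rp v t)%:E * (rp u s)%:E) = (rp v t / u)%:E)%E.
  rewrite ge0_integralZl; last 4 first.
  - exact: measurableT.
  - by apply/measurable_EFinP; exact: measurable_rp.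
  - by move=> s _; rewrite lee_fin rp_ge0.
  - by rewrite lee_fin rp_ge0.
  by rewrite integral_rp.
have e2 : (\int[mu]_s ((rp v t * expR (- u * t))%:E * (rm u (t - s))%:E) = (rp v t * expR (- u * t) / u)%:E)%E.
  rewrite ge0_integralZl; last 4 first.
  - exact: measurableT.
  - exact: m3.
  - by move=> s _; rewrite lee_fin rm_ge0.
  - by rewrite lee_fin.
  rewrite (@integral_refl _ t (fun s => (rm u s)%:E)).
  - by rewrite integral_rm.
  - by apply/measurable_EFinP; exact: measurable_rm.
  - by move=> s; rewrite lee_fin rm_ge0.
have e3 : (\int[mu]_s (rp w s * rp v (t - s))%:E + (rp v t * expR (- u * t) / u)%:E = (rp v t / u)%:E)%E.
  rewrite -e1 -e2 -ge0_integralD.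
  - by apply: eq_integral => s _; rewrite -!EFinM -EFinD hs !mulrA.
  - exact: measurableT.
  - by move=> s _; rewrite lee_fin mulr_ge0 ?rp_ge0.
  - exact: m1.
  - by move=> s _; rewrite mule_ge0 ?lee_fin ?rm_ge0.
  - exact: m2.
have -> : rp w t = rp v t * expR (- u * t).
  by rewrite /rp t0 -expRD; congr expR; rewrite /u; ring.
by rewrite mulrBl EFinB -e3 addeK.
Qed.

Lemma conv_rp_rm w v t : 0 < w -> 0 < v ->
  (\int[mu]_s (rp w s * rm v (t - s))%:E = ((rp w t + rm v t) / (w + v))%:E)%E.
Proof.
move=> w0 v0; have u0 : 0 < w + v by rewrite addr_gt0.
have [t0|t0] := leP 0 t.
  transitivity (\int[mu]_s ((rp w t)%:E * (rm (w + v) (t - s))%:E))%E.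
    apply: eq_integral => s _; rewrite -EFinM; congr EFin.
    rewrite /rm subr_lt0; case: ifPn => st; last by rewrite !mulr0.
    by rewrite /rp t0 (le_trans t0 (ltW st)) -!expRD; congr expR; ring.
  rewrite ge0_integralZl; last 4 first.
  - exact: measurableT.
  - by apply/measurable_EFinP; exact: (measurableT_comp (measurable_rm (w + v)) (measurable_refl t)).
  - by move=> s _; rewrite lee_fin rm_ge0.
  - by rewrite lee_fin rp_ge0.
  rewrite (@integral_refl _ t (fun s => (rm (w + v) s)%:E)).
  - by rewrite integral_rm// -EFinM (_ : rm v t = 0) ?addr0// /rm ltNge t0.
  - by apply/measurable_EFinP; exact: measurable_rm.
  - by move=> s; rewrite lee_fin rm_ge0.
transitivity (\int[mu]_s ((rm v t)%:E * (rp (w + v) s)%:E))%E.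
  apply: eq_integral => s _; rewrite -EFinM; congr EFin.
  rewrite /rp; case: ifPn => s0; last by rewrite mul0r mulr0.
  rewrite /rm t0 subr_lt0 (lt_le_trans t0 s0) -!expRD; congr expR; ring.
rewrite ge0_integralZl; last 4 first.
- exact: measurableT.
- by apply/measurable_EFinP; exact: measurable_rp.
- by move=> s _; rewrite lee_fin rp_ge0.
- by rewrite lee_fin rm_ge0.
by rewrite integral_rp// -EFinM (_ : rp w t = 0) ?add0r// /rp leNgt t0.
Qed.

End HalfLineExponentials.

(** * Modulated scalar kernels as central elements *)

Section ScalarKernels.
Context (R : realType) (X : completeNormedModType R[i]) (p : R) (p1 : 1 < p).
Local Notation A := (alg X p1).
Local Notation mu := (@lebesgue_measure R).
Implicit Types (r : R -> R) (t lam : R).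

Definition ei (th : R) : R[i] := (cos th +i* sin th)%C.

Lemma eiD a b : ei (a + b) = ei a * ei b.
Proof. by rewrite /ei cosD sinD; simpc; congr (_ +i* _)%C; rewrite addrC. Qed.

Lemma ei0 : ei 0 = 1. Proof. by rewrite /ei cos0 sin0. Qed.

Lemma cabs_ei th : cabs (ei th) = 1.
Proof. by rewrite /cabs normc_def /= cos2Dsin2 sqrtr1. Qed.

Definition rgood r := measurable_fun setT r /\ exists2 C, 0 <= C & forall t, `|r t| <= C * wt p t.

(** Adding a multiple of the weight makes r nonnegative, the case treated by [isI_scalar]. *)
Lemma Lint_real r (x : X) : rgood r -> Lint (fun t => (r t)%:C%C *: x).
Proof.
move=> [mr [C C0 rC]].
have mw : measurable_fun setT (fun t => C * wt p t).
  by apply: measurable_funM; [exact: measurable_cst|exact: measurable_wt].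
have w0 t : 0 <= C * wt p t by rewrite mulr_ge0// wt_ge0.
have L (h : R -> R) D : measurable_fun setT h -> 0 <= D -> (forall t, 0 <= h t) ->
    (forall t, h t <= D * wt p t) -> Lint (fun t => (h t)%:C%C *: x).
  move=> mh D0 h0 hD.
  have fin : (\int[mu]_t (h t)%:E \is a fin_num)%E.
    rewrite ge0_fin_numE; last by apply: integral_ge0 => t _; rewrite lee_fin.
    apply: le_lt_trans (ltry (D * cw p)); apply: le_trans (wmaj_int p1 D0).
    by apply: le_lower_integral => t; rewrite lee_fin.
  by apply: isI_Lint (isI_scalar x mh h0 (esym (fineK fin))).
rewrite (_ : (fun t => _) = fun t => (r t + C * wt p t)%:C%C *: x - (C * wt p t)%:C%C *: x).
  apply: LintB; last exact: L mw C0 w0 (fun t => lexx _).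
  apply: (L _ (C + C)) => [||t|t].
  - exact: measurable_funD.
  - exact: addr_ge0.
  - by have := rC t; rewrite ler_norml => /andP[]; lra.
  - by have := rC t; rewrite ler_norml mulrDl => /andP[_]; lra.
by apply/funext => t; rewrite -scalerBl -rmorphB/= addrK.
Qed.

Lemma measurable_trig lam : measurable_fun setT (fun t : R => cos (lam * t)) /\
  measurable_fun setT (fun t : R => sin (lam * t)).
Proof.
have ml : measurable_fun setT (fun t : R => lam * t).
  by apply: measurable_funM; [exact: measurable_cst|exact: measurable_id].
split.
  apply: (@measurableT_comp _ _ _ _ _ _ (@cos R) _ (fun t => lam * t)) => //.
  by apply: continuous_measurable_fun; exact: continuous_cos.
apply: (@measurableT_comp _ _ _ _ _ _ (@sin R) _ (fun t => lam * t)) => //.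
by apply: continuous_measurable_fun; exact: continuous_sin.
Qed.

Definition modk lam r t : R[i] := ei (lam * t) * (r t)%:C%C.

Lemma kern_modk lam r : rgood r -> kern p (fun t (x : X) => modk lam r t *: x).
Proof.
move=> [mr [C C0 rC]]; have [mc ms] := measurable_trig lam; split.
- by move=> t; exact: islin_scale.
- move=> x; rewrite (_ : (fun t => _) = fun t => (cos (lam * t) * r t)%:C%C *: x +
      'i%C *: ((sin (lam * t) * r t)%:C%C *: x)).
    apply: LintD.
      apply: (Lint_real x (r := fun t => cos (lam * t) * r t)); split; first exact: measurable_funM.
      exists C => // t; rewrite normrM; apply: le_trans (rC t).
      by rewrite ler_piMl// cos_max.
    apply: LintZ; apply: (Lint_real x (r := fun t => sin (lam * t) * r t)); split; first exact: measurable_funM.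
    exists C => // t; rewrite normrM; apply: le_trans (rC t).
    by rewrite ler_piMl// sin_max.
  apply/funext => t; rewrite scalerA -scalerDl; congr (_ *: _).
  by rewrite /modk /ei; simpc.
- exists C => // t x; rewrite nrmZ cabsM cabs_ei mul1r cabsR.
  by rewrite ler_wpM2r ?nrm_ge0.
Qed.

Definition modA lam r (h : rgood r) : A := Alg p1 (isop0 X) (kern_modk lam h).

(** Scalars pass through operators, and the reflection s -> t - s exchanges the factors of the
    convolution. *)
Lemma modA_central lam r (h : rgood r) (a : A) : modA lam h * a = a * modA lam h.
Proof.
apply: alg_eq => [x|t x].
  by rewrite !opM /= (islin0 (oplin a)).
have [Aa [_ ba _ _ _]] := kernP p1 (kerP a).
have [Ab [_ bb _ _ _]] := kernP p1 (kern_modk lam h).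
rewrite !kerM /= add0r (islinZ _ _ (oplin a)) (islin0 (kerlin a t)) addr0; congr (_ + _).
have := isI_refl t (convP t bb (kerLint a x)); set w := conv _ _ _ => hw.
apply/esym/bintE.
rewrite (_ : (fun s => modk lam r (t - s) *: ker a (t - (t - s)) x) =
  (fun s => ker a s (modk lam r (t - s) *: x))) in hw; last first.
  by apply/funext => s; rewrite subKr (islinZ _ _ (kerlin a s)).
exact: hw.
Qed.

(** The factors exp(i lam s) and exp(i lam (t - s)) multiply to exp(i lam t), which leaves the
    integral; a convolution of real functions remains. *)
Lemma modA_mul lam r1 r2 r3 (h1 : rgood r1) (h2 : rgood r2) (h3 : rgood r3) :
  (forall t, 0 <= r1 t) -> (forall t, 0 <= r2 t) ->
  (forall t, (\int[mu]_s (r1 s * r2 (t - s))%:E = (r3 t)%:E)%E) ->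
  modA lam h1 * modA lam h2 = modA lam h3.
Proof.
move=> p1' p2 e; apply: alg_eq => [x|t x]; first by rewrite opM.
have [m1 _] := h1; have [m2 _] := h2.
rewrite kerM /= scaler0 !add0r; apply: bintE.
rewrite /modk -scalerA; rewrite (_ : (fun s => _) =
  (fun s => ei (lam * t) *: ((r1 s * r2 (t - s))%:C%C *: x))); last first.
  apply/funext => s; rewrite !scalerA; congr (_ *: _).
  by rewrite mulrACA -eiD -mulrDr [s + _]addrC subrK -rmorphM.
apply: isIZ; apply: isI_scalar => //; last by move=> s; rewrite mulr_ge0.
by apply: measurable_funM => //; exact: (measurableT_comp m2 (measurable_refl t)).
Qed.

Lemma bd_modA lam r (h : rgood r) d : (\int[mu]_t (`|r t|)%:E <= d%:E)%E -> bd (modA lam h) d.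
Proof.
move=> hd; have [mr _] := h.
have d0 : 0 <= d.
  by rewrite -lee_fin; apply: le_trans hd; apply: integral_ge0 => t _; rewrite lee_fin.
exists 0, d, (fun t => (`|r t|)%:E); split; split => //.
- by move=> x; rewrite /= nrm0 mul0r.
- split.
  + apply/measurable_EFinP.
    by apply: (@measurableT_comp _ _ _ _ _ _ (fun y : R => `|y|) _ r); [exact: normr_measurable|exact: mr].
  + by move=> t; rewrite lee_fin.
  + by move=> t x; rewrite /= nrmZ cabsM cabs_ei mul1r cabsR EFinM.
- by rewrite add0r.
Qed.

Definition sc (z : R) : A := scA X p1 z%:C%C.

Lemma scA_D (y z : R[i]) : scA X p1 (y + z) = scA X p1 y + scA X p1 z.
Proof. by apply: alg_eq => [x|t x] /=; rewrite ?scalerDl// addr0. Qed.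

Lemma scA_M (y z : R[i]) : scA X p1 (y * z) = scA X p1 y * scA X p1 z.
Proof. by apply: alg_eq => [x|t x]; rewrite ?opM ?ker_scAl /= ?scalerA// scaler0. Qed.

Lemma scD (y z : R) : sc (y + z) = sc y + sc z.
Proof. by rewrite /sc rmorphD scA_D. Qed.
Lemma scM (y z : R) : sc (y * z) = sc y * sc z.
Proof. by rewrite /sc rmorphM scA_M. Qed.
Lemma sc1 : sc 1 = 1.
Proof. by apply: alg_eq => [x|t x] //=; rewrite scale1r. Qed.
Lemma scN (y : R) : sc (- y) = - sc y.
Proof. by apply: alg_eq => [x|t x] /=; rewrite ?rmorphN ?scaleNr ?oppr0. Qed.
Lemma sc_central (y : R) (a : A) : sc y * a = a * sc y.
Proof. exact: scA_central. Qed.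
Lemma bd_sc (y : R) : bd (sc y) `|y|.
Proof. by rewrite -cabsR; exact: bd_scA. Qed.

Lemma rgood_rp w : 0 < w -> rgood (rp w).
Proof.
move=> w0; split; first exact: measurable_rp.
have [C C0 hC] := expR_wt w0 (lt_trans ltr01 p1); exists C => // t.
by rewrite ger0_norm ?rp_ge0// (le_trans (rp_le _ _)).
Qed.

Lemma rgood_rm w : 0 < w -> rgood (rm w).
Proof.
move=> w0; split; first exact: measurable_rm.
have [C C0 hC] := expR_wt w0 (lt_trans ltr01 p1); exists C => // t.
by rewrite ger0_norm ?rm_ge0// (le_trans (rm_le _ _)).
Qed.

Definition eP lam w (w0 : 0 < w) : A := modA lam (rgood_rp w0).
Definition eM lam w (w0 : 0 < w) : A := modA lam (rgood_rm w0).

Lemma bd_eP lam w (w0 : 0 < w) : bd (eP lam w0) w^-1.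
Proof.
apply: bd_modA; under eq_integral do rewrite ger0_norm ?rp_ge0//.
by rewrite integral_rp.
Qed.

Lemma rgood_lin (a b : R) r1 r2 : rgood r1 -> rgood r2 -> rgood (fun t => a * r1 t + b * r2 t).
Proof.
move=> [m1 [C C0 h1]] [m2 [D D0 h2]]; split.
  by apply: measurable_funD; apply: measurable_funM => //; exact: measurable_cst.
exists (`|a| * C + `|b| * D) => [|t]; first by rewrite addr_ge0// mulr_ge0.
by rewrite (le_trans (ler_normD _ _))// !normrM mulrDl -!mulrA lerD// ler_wpM2l.
Qed.

Lemma modA_lin lam (a b : R) r1 r2 (h1 : rgood r1) (h2 : rgood r2) :
  modA lam (rgood_lin a b h1 h2) = sc a * modA lam h1 + sc b * modA lam h2.
Proof.
apply: alg_eq => [x|t x]; first by rewrite /= !scaler0 addr0.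
rewrite kerD !ker_scAl /= /modk !scalerA -scalerDl; congr (_ *: _).
by rewrite rmorphD !rmorphM/= mulrDr [in RHS]mulrCA [X in _ = _ + X]mulrCA.
Qed.

(** The resolvent identity (w - v)/((w + z)(v + z)) = 1/(v + z) - 1/(w + z) on the Fourier side. *)
Lemma eP_eP lam w v (w0 : 0 < w) (v0 : 0 < v) : v < w ->
  sc (w - v) * (eP lam w0 * eP lam v0) = eP lam v0 - eP lam w0.
Proof.
move=> vw; have u0 : 0 < w - v by rewrite subr_gt0.
rewrite (modA_mul lam (rgood_rp w0) (rgood_rp v0) (rgood_lin (w - v)^-1 (- (w - v)^-1) (rgood_rp v0) (rgood_rp w0)) (rp_ge0 _) (rp_ge0 _)).
  rewrite modA_lin mulrDr !mulrA -!scM mulrN mulfV ?gt_eqF// sc1 mul1r scN sc1 mulN1r//.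
by move=> t; rewrite conv_rp_rp//; congr EFin; rewrite mulrBl mulrC mulNr [rp w t * _]mulrC.
Qed.

Lemma eP_eM lam w v (w0 : 0 < w) (v0 : 0 < v) :
  sc (w + v) * (eP lam w0 * eM lam v0) = eP lam w0 + eM lam v0.
Proof.
have u0 : 0 < w + v by rewrite addr_gt0.
rewrite (modA_mul lam (rgood_rp w0) (rgood_rm v0) (rgood_lin (w + v)^-1 (w + v)^-1 (rgood_rp w0) (rgood_rm v0)) (rp_ge0 _) (rm_ge0 _)).
  by rewrite modA_lin mulrDr !mulrA -!scM mulfV ?gt_eqF// sc1 !mul1r.
by move=> t; rewrite conv_rp_rm//; congr EFin; rewrite mulrDl ![_ * (w + v)^-1]mulrC.
Qed.

End ScalarKernels.

(** * The algebraic part of the argument *)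

Section AbstractWiener.
Context (R : realFieldType) (A : pzRingType) (W : A -> Prop) (bd : A -> R -> Prop)
  (sc : R -> A) (kap : R) (P M : R -> R -> A).

(** The facts on which the algebraic argument rests, collected so that it can be run in [alg] and in
    the opposite ring without being repeated. *)
Record frame : Prop := Frame {
  bdW_ : forall a c c', c <= c' -> bd a c -> bd a c';
  bdD_ : forall a b c d, bd a c -> bd b d -> bd (a + b) (c + d);
  bdN_ : forall a c, bd a c -> bd (- a) c;
  bdM_ : forall a b c d, bd a c -> bd b d -> bd (a * b) (c * d);
  bd1_ : bd 1 1;
  bdsc_ : forall r, bd (sc r) `|r|;
  bdge0_ : forall a c, bd a c -> 0 <= c;
  bdex_ : forall a, exists c, bd a c;
  scD_ : forall r s, sc (r + s) = sc r + sc s;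
  scN_ : forall r, sc (- r) = - sc r;
  sc1_ : sc 1 = 1;
  sccent_ : forall r a, sc r * a = a * sc r;
  WD_ : forall a b, W a -> W b -> W (a + b);
  WN_ : forall a, W a -> W (- a);
  WMl_ : forall a b, W a -> W (a * b);
  WMr_ : forall a b, W b -> W (a * b);
  kap0_ : 0 < kap;
  neumann_ : forall e c, W e -> bd e c -> c <= kap ->
    exists H, [/\ H * (1 + e) = 1, (1 + e) * H = 1 & bd H 2];
  Pcent_ : forall l w a, 0 < w -> P l w * a = a * P l w;
  Mcent_ : forall l w a, 0 < w -> M l w * a = a * M l w;
  WP_ : forall l w, 0 < w -> W (P l w);
  bdP_ : forall l w, 0 < w -> bd (P l w) w^-1;
  PP_ : forall l v w, 0 < v -> v < w -> sc (w - v) * (P l w * P l v) = P l v - P l w;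
  PM_ : forall l v w, 0 < w -> 0 < v -> sc (w + v) * (P l w * M l v) = P l w + M l v }.

(* [F] is the Fourier transform of [T] at [l] and [G] the inverse of [1 + F]. *)
Definition parametrix (T : A) := forall L : R, 0 < L -> exists g eps,
  [/\ 0 < g, 0 < eps, eps < 1 & forall l, `|l| <= L -> exists F G,
    [/\ G * (1 + F) = 1, (1 + F) * G = 1, bd F g & bd G g] /\
    bd (sc eps * P l eps * (T - F * P l 1)) (kap / g)].

(** L and the mass C do not depend on d: the error O(d) at each frequency is multiplied by C, and d
    is chosen afterwards. *)
Definition approx_unit (T : A) (N : nat) := forall eta : R, 0 < eta -> exists L C,
  [/\ 0 < L, 0 <= C & forall d1, 0 < d1 -> exists d (s : seq (R * R)),
    [/\ 0 < d, d < d1, forall z, z \in s -> `|z.1| <= L /\ 0 <= z.2,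
      \sum_(z <- s) z.2 <= C &
      bd (T ^+ N - (\sum_(z <- s) sc z.2 * (P z.1 d + M z.1 d)) * T ^+ N) eta]].

Hypothesis fr : frame.

Lemma bdB_ a b c d : bd a c -> bd b d -> bd (a - b) (c + d).
Proof. by move=> ha hb; apply: (bdD_ fr) => //; exact: (bdN_ fr). Qed.

(** With V = T - F P_{l,1} and E = eps P_{l,eps} V one has 1 + T = (1 + F) + (V U - F)(1 - P_{l,1})
    + E. Multiplying by G on the left turns 1 + F into 1, and 1 + G E is inverted by a Neumann
    series. *)
Lemma parametrix_local T g eps l F G t : W T -> bd T t -> 0 < g -> 0 < eps -> eps < 1 ->
  G * (1 + F) = 1 -> bd F g -> bd G g ->
  bd (sc eps * P l eps * (T - F * P l 1)) (kap / g) ->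
  exists B Y, 1 = B * (1 + T) + Y * (1 - P l 1) /\
    bd Y (2 * g * ((t + g * 1) * (1 + (1 - eps) * eps^-1) + g)).
Proof.
move=> WT bT g0 e0 e1 GF bF bG bE.
set p1 := P l 1; set pe := P l eps; set V := T - F * p1; set E := sc eps * pe * V.
have P1 := bdP_ fr l ltr01; rewrite invr1 -/p1 in P1.
have Pe := bdP_ fr l e0; rewrite -/pe in Pe.
have cpe a : pe * a = a * pe by exact: (Pcent_ fr).
have cp1 a : p1 * a = a * p1 by exact: (Pcent_ fr).
have rel : sc (1 - eps) * (p1 * pe) = pe - p1 by exact: (PP_ fr).
have WV : W V.
  apply: (WD_ fr) => //; apply: (WN_ fr); apply: (WMr_ fr); exact: (WP_ fr).
have WE : W E by exact: (WMr_ fr).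
have bV : bd V (t + g * 1) by apply: bdB_ => //; exact: (bdM_ fr).
(* On the Fourier side (1 + z)/(eps + z), the multiplier that takes 1 - P_{l,1} = z/(1 + z) to 1 -
   eps P_{l,eps} = z/(eps + z). *)
pose U := 1 + sc (1 - eps) * pe.
have bU : bd U (1 + (1 - eps) * eps^-1).
  apply: (bdD_ fr); first exact: (bd1_ fr).
  apply: (bdM_ fr) => //; have := bdsc_ fr (1 - eps).
  by rewrite ger0_norm// subr_ge0 ltW.
have Uq : U * (1 - p1) = 1 - sc eps * pe.
  rewrite /U mulrBr mulr1 mulrDl mul1r -mulrA (cpe p1) rel (scD_ fr) (scN_ fr) (sc1_ fr).
  by rewrite mulrBl mul1r; zmod.
have VE : V * U * (1 - p1) + E = V.
  have -> : E = V * (sc eps * pe) by rewrite /E -mulrA cpe mulrA (sccent_ fr) -mulrA.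
  by rewrite -mulrA Uq mulrBr mulr1; zmod.
have TE : 1 + T = (1 + F) + (V * U - F) * (1 - p1) + E.
  rewrite mulrBl -addrA [_ - _ + E]addrAC VE /V mulrBr mulr1; zmod.
have bGE : bd (G * E) kap.
  apply: (bdW_ fr) (bdM_ fr bG bE); by rewrite mulrC divfK// gt_eqF.
have [H [H1 _ bH]] := neumann_ fr (WMr_ fr G WE) bGE (lexx _).
exists (H * G), (- (H * G * (V * U - F))); split; last first.
  apply: (bdN_ fr); apply: (bdM_ fr); first exact: (bdM_ fr).
  by apply: bdB_ => //; exact: (bdM_ fr).
have e : H * G * (1 + T) = 1 + H * G * (V * U - F) * (1 - p1).
  rewrite TE addrAC mulrDr; congr (_ + _); last by rewrite mulrA.
  by rewrite -mulrA mulrDr GF H1.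
by rewrite e mulNr; zmod.
Qed.

(** Multiplying the parametrix identity by P_{l,d} and by M_{l,d} gives, with X = Y P_{l,1}, the
    elements (1 + dX) P_{l,d} and (1 - dX) M_{l,d} modulo left multiples of 1 + T, with remainders X
    and -X that are bounded but not small. Inserting both in 2d P_{l,d} M_{l,d} leaves 2d times a
    product of two remainders of size 2K each. *)
Lemma resolvent_mod T l d B Y K : 1 = B * (1 + T) + Y * (1 - P l 1) -> bd Y K ->
  0 < d -> d < 1 -> d * K <= kap ->
  exists y D, P l d + M l d = y * (1 + T) + D /\ bd D (8 * d * K ^+ 2).
Proof.
move=> par bY d0 d1 dK.
set p1 := P l 1; set pd := P l d; set md := M l d.
have P1 := bdP_ fr l ltr01; rewrite invr1 -/p1 in P1.
have cp a : pd * a = a * pd by exact: (Pcent_ fr).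
have cm a : md * a = a * md by exact: (Mcent_ fr).
have relp : sc (1 - d) * (p1 * pd) = pd - p1 by exact: (PP_ fr).
have relm : sc (1 + d) * (p1 * md) = p1 + md by exact: (PM_ fr).
have rel : sc (d + d) * (pd * md) = pd + md by exact: (PM_ fr).
set X := Y * p1; set r := sc d.
have cr a : r * a = a * r by exact: (sccent_ fr).
have bX : bd X K by have := bdM_ fr bY P1; rewrite mulr1.
have WX : W X by apply: (WMr_ fr); exact: (WP_ fr).
have Wr : W (r * X) by exact: (WMr_ fr).
have br : bd (r * X) (d * K).
  apply: (bdM_ fr) => //; have := bdsc_ fr d; by rewrite gtr0_norm.
have [H1 [h1 _ bH1]] := neumann_ fr Wr br dK.
have [H2 [h2 _ bH2]] := neumann_ fr (WN_ fr Wr) (bdN_ fr br) dK.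
have ep : (1 + r * X) * pd = B * pd * (1 + T) + X.
  have qp : (1 - p1) * pd = p1 - r * (p1 * pd).
    rewrite mulrBl mul1r; move: relp; rewrite (scD_ fr) (scN_ fr) (sc1_ fr) mulrBl mul1r -/r => relp.
    have e : pd = p1 + (p1 * pd - r * (p1 * pd)) by rewrite relp; zmod.
    by rewrite {1}e; zmod.
  have h : pd = B * pd * (1 + T) + (X - r * X * pd).
    have e1 : B * pd * (1 + T) = B * (1 + T) * pd by rewrite -!mulrA (cp (1 + T)).
    have e2 : X - r * X * pd = Y * ((1 - p1) * pd).
      by rewrite qp mulrBr mulrA -(cr Y) /X -!mulrA.
    by rewrite e1 e2 mulrA -mulrDl -par mul1r.
  by rewrite mulrDl mul1r {1}h; zmod.
have em : (1 - r * X) * md = B * md * (1 + T) - X.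
  have qm : (1 - p1) * md = r * (p1 * md) - p1.
    rewrite mulrBl mul1r; move: relm; rewrite (scD_ fr) (sc1_ fr) mulrDl mul1r -/r => relm.
    have e : md = p1 * md + r * (p1 * md) - p1 by rewrite relm; zmod.
    by rewrite {1}e; zmod.
  have h : md = B * md * (1 + T) + (r * X * md - X).
    have e1 : B * md * (1 + T) = B * (1 + T) * md by rewrite -!mulrA (cm (1 + T)).
    have e2 : r * X * md - X = Y * ((1 - p1) * md).
      by rewrite qm mulrBr mulrA -(cr Y) /X -!mulrA.
    by rewrite e1 e2 mulrA -mulrDl -par mul1r.
  by rewrite mulrBl mul1r {1}h; zmod.
have hp : pd = H1 * (B * pd) * (1 + T) + H1 * X.
  have := congr1 ( *%R H1) ep; rewrite /= mulrA h1 mul1r => {1}->.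
  by rewrite mulrDr mulrA.
have hm : md = H2 * (B * md) * (1 + T) - H2 * X.
  have := congr1 ( *%R H2) em; rewrite /= mulrA h2 mul1r => {1}->.
  by rewrite mulrBr mulrA.
pose y1 := H1 * (B * pd); pose y2 := H2 * (B * md).
exists (sc (d + d) * (pd * y2 - H2 * X * y1)), (- (sc (d + d) * (H2 * X * (H1 * X)))); split.
  rewrite -rel -[in RHS](mulrA (sc (d + d))) -[RHS]mulrBr; congr (_ * _).
  have e1 : pd * (H2 * X) = H2 * X * y1 * (1 + T) + H2 * X * (H1 * X).
    by rewrite cp {1}hp mulrDr [in LHS]mulrA.
  have e2 : pd * md = pd * y2 * (1 + T) - pd * (H2 * X).
    by rewrite {1}hm -/y2 mulrBr (mulrA pd y2).
  by rewrite e2 e1 mulrBl; zmod.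
have bb := bdM_ fr (bdsc_ fr (d + d)) (bdM_ fr (bdM_ fr bH2 bX) (bdM_ fr bH1 bX)).
apply: (bdW_ fr) (bdN_ fr bb).
rewrite gtr0_norm ?addr_gt0//.
by rewrite le_eqVlt; apply/orP; left; apply/eqP; ring.
Qed.

Lemma left_invertible T N : W T -> (0 < N)%N -> parametrix T -> approx_unit T N ->
  exists B, B * (1 + T) = 1.
Proof.
move=> WT N0 par app.
have [t bT] := bdex_ fr T; have [tau bTN] := bdex_ fr (T ^+ N).
have t0 := bdge0_ fr bT; have tau0 := bdge0_ fr bTN; have k0 := kap0_ fr.
have k2 : 0 < kap / 2 by rewrite divr_gt0.
have [L [C [L0 C0 hC]]] := app _ k2.
have [g [eps [g0 e0 e1 hpar]]] := par L L0.
pose K := 2 * g * ((t + g * 1) * (1 + (1 - eps) * eps^-1) + g).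
have K0 : 0 <= K.
  have e1' : 0 <= 1 - eps by rewrite subr_ge0 ltW.
  have ei0 : 0 <= eps^-1 by rewrite invr_ge0 ltW.
  by rewrite !mulr_ge0 ?addr_ge0 ?mulr_ge0 ?addr_ge0 ?mulr_ge0 ?(ltW g0).
(* The three bounds serve the resolvent identity between d and 1, the inversion of 1 + dX and 1 -
   dX, and the accumulated error, which gets kap/2; the other half of kap goes to the approximate
   unit. *)
pose d1 := Num.min 1 (Num.min (kap / (K + 1)) (kap / 2 / (tau * C * (8 * K ^+ 2) + 1))).
have D0 : 0 < tau * C * (8 * K ^+ 2) + 1.
  have K20 : 0 <= 8 * K ^+ 2 by apply: mulr_ge0 => //; exact: exprn_ge0.
  by apply: ltr_wpDl => //; apply: mulr_ge0 => //; exact: mulr_ge0.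
have K1 : 0 < K + 1 by rewrite ltr_wpDl.
have d10 : 0 < d1 by rewrite !lt_min ltr01 !divr_gt0.
have [d [s [d0 dd hs sC bs]]] := hC _ d10.
move: dd; rewrite !lt_min => /and3P[dlt1 dK dtau].
have dK' : d * K <= kap.
  move: dK; rewrite ltr_pdivlMr// => h; apply: le_trans (ltW h).
  by rewrite ler_wpM2l ?(ltW d0)// lerDl.
have step z : z \in s -> exists y D, P z.1 d + M z.1 d = y * (1 + T) + D /\ bd D (8 * d * K ^+ 2).
  move=> /hs [zL _]; have [F [G [[GF _ bF bG] bE]]] := hpar _ zL.
  have [B [Y [eq1 bY]]] := parametrix_local WT bT g0 e0 e1 GF bF bG bE.
  exact: resolvent_mod eq1 bY d0 dlt1 dK'.
have [y [D [eq2 bD]]] : exists y D, \sum_(z <- s) sc z.2 * (P z.1 d + M z.1 d) = y * (1 + T) + D /\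
   bd D ((\sum_(z <- s) z.2) * (8 * d * K ^+ 2)).
  move: {sC bs} hs step; elim: s => [|z s IH] hs step.
    exists 0, 0; rewrite !big_nil !mul0r addr0; split => //.
    have h := scD_ fr 0 0; rewrite addr0 in h.
    have s0 : sc 0 = 0 by apply: (addrI (sc 0)); rewrite -h addr0.
    by have := bdsc_ fr 0; rewrite s0 normr0.
  have [||y [D [e bD]]] := IH.
  - by move=> u us; apply: hs; rewrite inE us orbT.
  - by move=> u us; apply: step; rewrite inE us orbT.
  have zs : z \in z :: s by rewrite inE eqxx.
  have [y' [D' [e' bD']]] := step z zs; have [_ z0] := hs z zs.
  exists (sc z.2 * y' + y), (sc z.2 * D' + D); rewrite !big_cons e e'; split.
    by rewrite mulrDr mulrDl !mulrA; zmod.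
  rewrite mulrDl; apply: (bdD_ fr) => //; apply: (bdM_ fr) => //.
  by have := bdsc_ fr z.2; rewrite ger0_norm.
set kapp := \sum_(z <- s) _ in eq2 bs.
have ck : kapp * T ^+ N = T ^+ N * kapp.
  rewrite /kapp mulr_suml mulr_sumr; apply: eq_bigr => z _.
  by rewrite -mulrA mulrDl (Pcent_ fr)// (Mcent_ fr)// -mulrDr mulrA (sccent_ fr) -mulrA.
pose e2 := (T ^+ N - kapp * T ^+ N) + T ^+ N * D.
have WTN : W (T ^+ N) by case: N N0 {bTN app bs ck e2 hC} => // N _; rewrite exprS; exact: (WMl_ fr).
have We2 : W e2.
  apply: (WD_ fr); last exact: (WMl_ fr).
  by apply: (WD_ fr) => //; apply: (WN_ fr); exact: (WMr_ fr).
have be2 : bd e2 kap.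
  apply: (bdW_ fr) (bdD_ fr bs (bdM_ fr bTN bD)).
  rewrite [leRHS]splitr lerD2l.
  apply: le_trans (_ : tau * (C * (8 * d * K ^+ 2)) <= _).
    have q0 : 0 <= 8 * d * K ^+ 2.
      by apply: mulr_ge0; [apply: mulr_ge0 => //; exact: ltW|exact: exprn_ge0].
    by apply: ler_wpM2l => //; exact: ler_wpM2r.
  move: dtau; rewrite ltr_pdivlMr// => h; apply: le_trans (ltW h).
  have -> : tau * (C * (8 * d * K ^+ 2)) = d * (tau * C * (8 * K ^+ 2)) by ring.
  by rewrite ler_wpM2l ?(ltW d0)// lerDl.
have TNe : T ^+ N = T ^+ N * y * (1 + T) + e2.
  by rewrite /e2 ck eq2 (mulrDr (T ^+ N)) (mulrA _ y); zmod.
(* The geometric sum exhibits 1 - (-T)^N as a multiple of 1 + T, so that only the N-th power needs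
   an approximate unit. *)
pose c := \sum_(i < N) (- T) ^+ i.
have cT : c * (1 + T) = 1 - (- T) ^+ N.
  have h := subrX1 (- T) N.
  have cc : (- T - 1) * c = c * (- T - 1).
    by apply: commr_sum => i _; apply: commrX; apply: commr_sym; apply: commrB; [exact: commr_refl|exact: commr1].
  have -> : 1 - (- T) ^+ N = - ((- T) ^+ N - 1) by rewrite opprB.
  by rewrite h cc -mulrN; congr (_ * _); zmod.
pose sg : A := (-1) ^+ N.
have sgT : (- T) ^+ N = sg * T ^+ N by rewrite exprNn.
have bsg : bd (- (sg * e2)) kap.
  apply: (bdN_ fr); rewrite /sg -signr_odd; case: (odd N); rewrite ?expr1 ?expr0 ?mul1r//.
  by rewrite mulN1r; exact: (bdN_ fr).
have [H [h1 _ _]] := neumann_ fr (WN_ fr (WMr_ fr sg We2)) bsg (lexx _).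
exists (H * (c + sg * (T ^+ N * y))).
have e : (c + sg * (T ^+ N * y)) * (1 + T) = 1 - sg * e2.
  have e3 : sg * T ^+ N = sg * (T ^+ N * y) * (1 + T) + sg * e2.
    by rewrite {1}TNe (mulrDr sg) (mulrA sg).
  by rewrite mulrDl cT sgT e3; zmod.
by rewrite -mulrA e h1.
Qed.

End AbstractWiener.

(** * Elementary trigonometric bounds *)

Section Trigonometry.
Context (R : realType).
Implicit Types x y : R.

Lemma norm_sin_le x : `|sin x| <= `|x|.
Proof.
have key y : 0 < y -> `|sin y| <= y.
  move=> y0; have [|c _] := @MVT R sin cos 0 y y0 (fun z _ => is_derive_sin z).
    by apply: continuous_subspaceT; exact: continuous_sin.
  rewrite sin0 !subr0 => ->; rewrite normrM (gtr0_norm y0).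
  by rewrite ler_piMl ?cos_max// ltW.
have [x0|x0|<-] := ltgtP 0 x.
- by rewrite (gtr0_norm x0) key.
- by rewrite (ltr0_norm x0) -normrN -sinN key// oppr_gt0.
- by rewrite sin0 normr0.
Qed.

Lemma cos_half x : cos x = 1 - 2 * sin (x / 2) ^+ 2.
Proof.
have h := cos2Dsin2 (x / 2); rewrite {1}(splitr x) cosD -!expr2.
have -> : cos (x / 2) ^+ 2 = 1 - sin (x / 2) ^+ 2 by lra.
ring.
Qed.

Lemma cos_lower x : 1 - x ^+ 2 / 2 <= cos x.
Proof.
rewrite cos_half lerD2l lerN2.
have h : sin (x / 2) ^+ 2 <= (x / 2) ^+ 2.
  by rewrite -[leLHS]real_normK ?num_real// -[leRHS]real_normK ?num_real// lerXn2r ?nnegrE// norm_sin_le.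
apply: le_trans (ler_wpM2l (ler0n R 2) h) _.
by rewrite le_eqVlt; apply/orP; left; apply/eqP; field.
Qed.

Lemma sin_lower x : 0 <= x -> x <= 1 -> x / 2 <= sin x.
Proof.
move=> x0 x1; have [->|xn0] := eqVneq x 0; first by rewrite sin0 mul0r.
have xp : 0 < x by rewrite lt_def xn0.
have [|c cx] := @MVT R sin cos 0 x xp (fun z _ => is_derive_sin z).
  by apply: continuous_subspaceT; exact: continuous_sin.
rewrite sin0 !subr0 => ->; rewrite mulrC ler_wpM2r//.
move: cx; rewrite in_itv/= => /andP[c0 cx].
apply: le_trans (cos_lower c); have : c ^+ 2 <= 1.
  by rewrite expr_le1// ?(ltW c0)// (le_trans (ltW cx)).
lra.
Qed.

Lemma cabs_ei_sub x y : cabs (ei x - ei y) = 2 * `|sin ((x - y) / 2)|.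
Proof.
have -> : ei x - ei y = ei y * (ei (x - y) - 1).
  by rewrite mulrBr mulr1 -eiD [y + _]addrC subrK.
rewrite cabsM cabs_ei mul1r /cabs normc_def.
set z := x - y.
have -> : complex.Re (ei z - 1) = cos z - 1 by rewrite /ei; simpc.
have -> : complex.Im (ei z - 1) = sin z by rewrite /ei; simpc.
rewrite /=.
have -> : (cos z - 1) ^+ 2 + sin z ^+ 2 = (2 * sin (z / 2)) ^+ 2.
  have h := cos2Dsin2 z; have hz := cos_half z.
  have -> : (cos z - 1) ^+ 2 + sin z ^+ 2 = (cos z ^+ 2 + sin z ^+ 2) + 1 - 2 * cos z by ring.
  by rewrite h hz; ring.
by rewrite sqrtr_sqr normrM ger0_norm.
Qed.

Lemma cabs_ei_le2 x y : cabs (ei x - ei y) <= 2.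
Proof. by rewrite cabs_ei_sub ler_piMr// sin_max. Qed.

Lemma cabs_ei_lip x y : cabs (ei x - ei y) <= `|x - y|.
Proof.
rewrite cabs_ei_sub; apply: le_trans (ler_wpM2l (ler0n R 2) (norm_sin_le _)) _.
by rewrite normrM (ger0_norm (x := 2^-1)) ?invr_ge0// mulrC divfK ?pnatr_eq0.
Qed.
End Trigonometry.

(** * The algebra and its opposite as frames *)

Section Frames.
Context (R : realType) (X : completeNormedModType R[i]) (p : R) (p1 : 1 < p).
Local Notation A := (alg X p1).

(** [eP] takes a proof of positivity as argument. The value 0 for other w makes it total, and the
    laws of a frame ask for positive parameters only. *)
Definition gP (l w : R) : A := if pselect (0 < w) is left h then eP X p1 l h else 0.
Definition gM (l w : R) : A := if pselect (0 < w) is left h then eM X p1 l h else 0.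

Lemma gPE l w (w0 : 0 < w) : gP l w = eP X p1 l w0.
Proof. by rewrite /gP; case: pselect => // h; rewrite (Prop_irrelevance h w0). Qed.
Lemma gME l w (w0 : 0 < w) : gM l w = eM X p1 l w0.
Proof. by rewrite /gM; case: pselect => // h; rewrite (Prop_irrelevance h w0). Qed.

Lemma gP_central l w (a : A) : 0 < w -> gP l w * a = a * gP l w.
Proof. by move=> w0; rewrite gPE modA_central. Qed.
Lemma gM_central l w (a : A) : 0 < w -> gM l w * a = a * gM l w.
Proof. by move=> w0; rewrite gME modA_central. Qed.

Lemma alg_frame : frame (@inW0 R X p p1) (@bd R X p p1) (sc X p1) (kap p) gP gM.
Proof.
split.
- by move=> a c c'; exact: bdW.
- by move=> a b c d; exact: bdD.
- by move=> a c; exact: bdN.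
- by move=> a b c d; exact: bdM.
- exact: bd1.
- exact: bd_sc.
- by move=> a c; exact: bd_ge0.
- exact: bd_ex.
- exact: scD.
- exact: scN.
- exact: sc1.
- exact: sc_central.
- exact: inW0D.
- exact: inW0N.
- exact: inW0Ml.
- exact: inW0Mr.
- exact: kap_gt0.
- by move=> e c; exact: neumann.
- by move=> l w a; exact: gP_central.
- by move=> l w a; exact: gM_central.
- by move=> l w w0; rewrite gPE.
- by move=> l w w0; rewrite gPE; exact: bd_eP.
- by move=> l v w v0 vw; rewrite (gPE l v0) (gPE l (lt_trans v0 vw)); exact: eP_eP.
- by move=> l v w w0 v0; rewrite (gPE l w0) (gME l v0); exact: eP_eM.
Qed.

(** The scalars and the P and M are central, and [neumann] gives two-sided inverses, so reversing
    products preserves every law. *)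
Lemma alg_frame_conv : @frame R A^c (@inW0 R X p p1) (@bd R X p p1) (sc X p1) (kap p) gP gM.
Proof.
have cM (a b : A) : (a : A^c) * (b : A^c) = b * a :> A by [].
split.
- by move=> a c c'; exact: bdW.
- by move=> a b c d; exact: bdD.
- by move=> a c; exact: bdN.
- by move=> a b c d ha hb; rewrite mulrC; exact: (@bdM _ _ _ p1 b a).
- exact: bd1.
- exact: bd_sc.
- by move=> a c; exact: bd_ge0.
- exact: bd_ex.
- exact: scD.
- exact: scN.
- exact: sc1.
- by move=> r a; exact: (esym (@sc_central _ X _ p1 r a)).
- exact: inW0D.
- exact: inW0N.
- by move=> a b; exact: (@inW0Mr _ X _ p1 b a).
- by move=> a b; exact: (@inW0Ml _ X _ p1 b a).
- exact: kap_gt0.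
- by move=> e c We be ce; have [H [h1 h2 h3]] := neumann We be ce; exists H.
- by move=> l w a w0; exact: (esym (gP_central l a w0)).
- by move=> l w a w0; exact: (esym (gM_central l a w0)).
- by move=> l w w0; rewrite gPE.
- by move=> l w w0; rewrite gPE; exact: bd_eP.
- move=> l v w v0 vw; have w0 := lt_trans v0 vw.
  have := eP_eP X p1 l w0 v0 vw; rewrite -(gPE l v0) -(gPE l w0) => <-.
  by rewrite !cM -sc_central gP_central.
- move=> l v w w0 v0.
  have := eP_eM X p1 l w0 v0; rewrite -(gPE l w0) -(gME l v0) => <-.
  by rewrite !cM -sc_central gM_central.
Qed.

End Frames.

(** * The parametrix *)

Section NonnegIntegrals.
Context (R : realType).
Local Notation mu := (@lebesgue_measure R).
Implicit Types (f g : R -> R).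

Definition int_le f c := [/\ measurable_fun setT f, forall t, 0 <= f t &
  (\int[mu]_t (f t)%:E <= c%:E)%E].

Lemma int_leD f g c d : int_le f c -> int_le g d -> int_le (fun t => f t + g t) (c + d).
Proof.
move=> [mf f0 fc] [mg g0 gd]; split.
- exact: measurable_funD.
- by move=> t; rewrite addr_ge0.
- under eq_integral do rewrite EFinD.
  apply: integralD_le fc gd.
  + exact/measurable_EFinP.
  + exact/measurable_EFinP.
  + by move=> t; rewrite lee_fin.
  + by move=> t; rewrite lee_fin.
Qed.

Lemma int_leZ a f c : 0 <= a -> int_le f c -> int_le (fun t => a * f t) (a * c).
Proof.
move=> a0 [mf f0 fc]; split.
- by apply: measurable_funM => //; exact: measurable_cst.
- by move=> t; rewrite mulr_ge0.
- under eq_integral do rewrite EFinM.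
  apply: integralZ_le a0 _ _ fc; first exact/measurable_EFinP.
  by move=> t; rewrite lee_fin.
Qed.

Lemma int_le_wt p : 1 < p -> int_le (wt p) (cw p).
Proof.
by move=> p1; split; [exact: measurable_wt|exact: wt_ge0|rewrite integral_wt].
Qed.

Lemma int_le_rp (w : R) : 0 < w -> int_le (rp w) w^-1.
Proof. by move=> w0; split; [exact: measurable_rp|exact: rp_ge0|rewrite integral_rp]. Qed.

Lemma integral_flat (r : R) : 0 <= r ->
  (\int[mu]_t (if `|t| <= r then 1 else 0)%:E = (2 * r)%:E)%E.
Proof.
move=> r0; rewrite (_ : (fun t => _) = (fun t => (\1_(`[- r, r]%classic) t)%:E)); last first.
  apply/funext => t; rewrite /indic; congr EFin.
  by rewrite mem_setE in_itv/= -ler_norml; case: ifP.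
rewrite integral_indic ?setIT; [|exact: measurableT|exact: measurable_itv].
have := @lebesgue_measure_itv R (Interval (BLeft (- r)) (BRight r)); rewrite /= lte_fin => ->.
case: ifPn => h; first by rewrite -EFinD; congr EFin; ring.
by congr EFin; move: h; rewrite -leNgt; lra.
Qed.

Lemma int_le_flat (r : R) : 0 <= r -> int_le (fun t => if `|t| <= r then 1 else 0) (2 * r).
Proof.
move=> r0; split; last by rewrite integral_flat.
- apply: measurable_fun_ifT; [|exact: measurable_cst|exact: measurable_cst].
  by apply: measurable_fun_ler; [exact: normr_measurable|exact: measurable_cst].
- by move=> t; case: ifP.
Qed.

Lemma nnk_int_le f M c : nnk f M c -> int_le f c.
Proof. by move=> [mf f0 _ fc]; split => //; rewrite fc. Qed.

Lemma int_le_nnk f M c : (forall t, f t <= M) -> int_le f c ->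
  exists2 d, nnk f M d & d <= c.
Proof.
move=> fM [mf f0 fc].
have fin : (\int[mu]_t (f t)%:E \is a fin_num)%E.
  rewrite ge0_fin_numE; last by apply: integral_ge0 => t _; rewrite lee_fin.
  exact: le_lt_trans fc (ltry _).
exists (fine (\int[mu]_t (f t)%:E)); last by rewrite -lee_fin fineK.
by split => //; rewrite fineK.
Qed.

Lemma N1le_int (X : normedModType R[i]) (h : R -> X) f c :
  (forall t, nrm (h t) <= f t) -> int_le f c -> N1le h c.
Proof.
move=> hf [mf f0 fc]; exists (EFin \o f); split.
- exact/measurable_EFinP.
- by move=> t; rewrite lee_fin.
- by move=> t; rewrite lee_fin.
- exact: fc.
Qed.

Lemma bd_int (X : completeNormedModType R[i]) (p : R) (p1 : 1 < p) (a : alg X p1) f c :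
  inW0 a -> (forall t x, nrm (ker a t x) <= f t * nrm x) -> int_le f c -> bd a c.
Proof.
move=> ia af [mf f0 fc]; exists 0, c, (EFin \o f); split; split.
- by [].
- by rewrite -lee_fin; apply: le_trans fc; apply: integral_ge0 => t _; rewrite lee_fin.
- by move=> x; rewrite ia nrm0 mul0r.
- split.
  + exact/measurable_EFinP.
  + by move=> t; rewrite lee_fin.
  + by move=> t x; rewrite -EFinM lee_fin.
- exact: fc.
- by rewrite add0r.
Qed.

Definition wtr p r t : R := if r < `|t| then wt p t else 0.

Lemma wtr_ge0 p r t : 0 <= wtr p r t.
Proof. by rewrite /wtr; case: ifP => // _; exact: wt_ge0. Qed.

Lemma measurable_wtr p r : measurable_fun setT (wtr p r).
Proof.
apply: measurable_fun_ifT; [|exact: measurable_wt|exact: measurable_cst].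
by apply: measurable_fun_ltr; [exact: measurable_cst|exact: normr_measurable].
Qed.

Lemma int_le_wtr p e : 1 < p -> 0 < e -> exists2 r, 0 < r & int_le (wtr p r) e.
Proof.
move=> p1 e0; have [r r0 h] := wt_tail p1 e0; exists r => //; split => //.
- exact: measurable_wtr.
- exact: wtr_ge0.
Qed.

Lemma expR_sub1 (y : R) : 0 <= y -> y <= 2^-1 -> expR y - 1 <= 2 * y.
Proof.
move=> y0 y1; have h : (1 - y) * expR y <= 1.
  have := expR_ge1Dx (- y); rewrite -(ler_pM2r (expR_gt0 y)) -expRD addNr expR0.
  by rewrite mulrBl -mulNr -mulrDl.
have e0 : 1 <= expR y by have := expR_ge1Dx y; lra.
have e1 : expR y <= 2 by nra.
nra.
Qed.

Lemma expR_sub_le (y r : R) : `|y| <= r -> `|expR y - 1| <= expR r - 1.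
Proof.
move=> yr; have r0 : 0 <= r := le_trans (normr_ge0 _) yr.
have := yr; rewrite ler_norml => /andP[y1 y2].
have h1 : expR y <= expR r by rewrite ler_expR.
have h2 : expR (- r) <= expR y by rewrite ler_expR.
have h3 : expR (- r) + expR r >= 2.
  by have := expR_ge1Dx r; have := expR_ge1Dx (- r); lra.
by rewrite ler_norml; apply/andP; split; lra.
Qed.

(** A shift by at most r crosses the jump at 0 only if |t| <= r, where the difference is at most 1;
    elsewhere the two values differ by the factor exp(ws). *)
Lemma rp_shift (w r s t : R) : 0 < w -> `|s| <= r ->
  `|rp w (t - s) - rp w t| <= (if `|t| <= r then 1 else 0) + (expR (w * r) - 1) * rp w t.
Proof.
move=> w0 sr; have r0 : 0 <= r := le_trans (normr_ge0 _) sr.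
have c0 : 0 <= expR (w * r) - 1.
  by rewrite subr_ge0 -expR0 ler_expR mulr_ge0// ltW.
have le1 u : 0 <= u -> expR (- w * u) <= 1.
  by move=> u0; rewrite -expR0 ler_expR mulNr oppr_le0 mulr_ge0// ltW.
have := sr; rewrite ler_norml => /andP[s1 s2].
rewrite /rp; have [t0|t0] := leP 0 t; have [u0|u0] := leP 0 (t - s).
- rewrite (_ : expR _ - _ = (expR (w * s) - 1) * expR (- w * t)); last first.
    by rewrite mulrBl mul1r -expRD; congr (expR _ - _); ring.
  rewrite normrM (gtr0_norm (expR_gt0 _)).
  have h : `|expR (w * s) - 1| <= expR (w * r) - 1.
    by apply: expR_sub_le; rewrite normrM gtr0_norm// ler_wpM2l// ltW.
  have h2 := ler_wpM2r (ltW (expR_gt0 (- w * t))) h.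
  by case: ifP => _; lra.
- rewrite (ger0_norm t0) ifT; last by lra.
  rewrite sub0r normrN ger0_norm ?expR_ge0//.
  have := le1 _ t0; have := mulr_ge0 c0 (expR_ge0 (- w * t)); lra.
- rewrite (ltr0_norm t0) ifT; last by lra.
  rewrite subr0 ger0_norm ?expR_ge0// mulr0 addr0; exact: le1.
- by rewrite subrr normr0 mulr0 addr0; case: ifP.
Qed.

Lemma norm_rpB (w s t : R) : `|rp w s - rp w t| <= rp w s + rp w t.
Proof. by rewrite (le_trans (ler_normB _ _))// !ger0_norm ?rp_ge0. Qed.

Lemma rp_le1 (w t : R) : 0 < w -> rp w t <= 1.
Proof.
by move=> w0; rewrite /rp; case: ifP => // t0; rewrite -expR0 ler_expR mulNr oppr_le0 mulr_ge0// ltW.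
Qed.

End NonnegIntegrals.

(** * Kernels whose transform vanishes at one frequency *)

Section VanishingTransform.
Context (R : realType) (X : completeNormedModType R[i]) (p : R) (p1 : 1 < p).
Local Notation A := (alg X p1).
Local Notation mu := (@lebesgue_measure R).

Let p0 : 0 <= p. Proof. exact: le_trans ler01 (ltW p1). Qed.

Lemma int_le_conv (f g : R -> R) M1 M2 c1 c2 t : nnk f M1 c1 -> nnk g M2 c2 ->
  int_le (fun s => f s * g (t - s)) (scv f g t).
Proof.
move=> hf hg; have [mf f0 _ _] := hf; have [mg g0 _ _] := hg; split.
- by apply: measurable_funM => //; exact: (measurableT_comp mg (measurable_refl t)).
- by move=> s; rewrite mulr_ge0.
- have -> : (\int[mu]_s (f s * g (t - s))%:E)%E = cvm (EFin \o f) (EFin \o g) t.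
    by apply: eq_integral => s _; rewrite /= EFinM.
  by rewrite (scvE t hf hg).
Qed.

Lemma norm_modk_shift (l w t s : R) (x : X) (V : X -> X) : islin V ->
  nrm (V (modk l (rp w) (t - s) *: x) - (ei (l * t) * (rp w t)%:C%C) *: (ei (- (l * s)) *: V x))
  = `|rp w (t - s) - rp w t| * nrm (V x).
Proof.
move=> Vl; rewrite (islinZ _ _ Vl) scalerA -scalerBl nrmZ; congr (_ * _).
rewrite (_ : _ - _ = ei (l * (t - s)) * (rp w (t - s) - rp w t)%:C%C).
  by rewrite cabsM cabs_ei mul1r cabsR.
by rewrite /modk mulrAC -eiD -mulrBr -mulrBr rmorphB.
Qed.

(** As the transform of V vanishes at l, [rp w (t - s)] may be replaced by its difference with
    [rp w t] under the integral. That difference is small for |s| <= r by [rp_shift]; for larger s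
    the tail of the weight is used. *)
Lemma bd_vanishing (V : A) (l w M r e : R) : inW0 V -> 0 <= M ->
  (forall s x, nrm (ker V s x) <= M * wt p s * nrm x) ->
  (forall x, isI (fun s => ei (- (l * s)) *: ker V s x) 0) -> 0 < w -> 0 < r -> int_le (wtr p r) e ->
  bd (sc X p1 w * gP X p1 l w * V) (M * ((2 * r * w + (expR (w * r) - 1)) * cw p + 2 * e)).
Proof.
move=> iV M0 VM HV w0 r0 he.
have [c1 h1 c1e] : exists2 d, nnk (wtr p r) 1 d & d <= e.
  apply: int_le_nnk he => t; rewrite /wtr; case: ifP => // _; exact: wt_le1.
have [c2 h2 c2w] := int_le_nnk (fun t => rp_le1 t w0) (int_le_rp w0).
have hs := sc_scv h1 h2.
have c10 : 0 <= c1 by case: h1 => _ a0 _ ic; rewrite -lee_fin -ic; apply: integral_ge0 => t _; rewrite lee_fin.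
have e0 : 0 <= expR (w * r) - 1.
  by rewrite subr_ge0 -expR0 ler_expR mulr_ge0// ltW.
pose H t := (if `|t| <= r then 1 else 0) + (expR (w * r) - 1) * rp w t.
have H0 t : 0 <= H t by rewrite /H addr_ge0 ?mulr_ge0 ?rp_ge0//; case: ifP.
have iH : int_le H (2 * r + (expR (w * r) - 1) * w^-1).
  apply: int_leD; first exact: int_le_flat (ltW r0).
  exact: int_leZ e0 (int_le_rp w0).
pose G t := w * M * (cw p * H t + (scv (wtr p r) (rp w) t + c1 * rp w t)).
have iG : int_le G (w * M * (cw p * (2 * r + (expR (w * r) - 1) * w^-1) + (c1 * c2 + c1 * w^-1))).
  apply: int_leZ; first by rewrite mulr_ge0// ltW.
  apply: int_leD; first exact: int_leZ (cw_ge0 p) iH.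
  apply: int_leD; first exact: nnk_int_le hs.
  exact: int_leZ c10 (int_le_rp w0).
have bV := kern_bker p1 (kerP V) M0 VM.
rewrite -mulrA gP_central//.
apply: (bdW _ (bd_int (f := G) _ _ iG)); last first.
- move=> t x; rewrite ker_scAl nrmZ cabsR (gtr0_norm w0) kerM iV add0r gPE /=.
  rewrite (islin0 (kerlin V t)) add0r.
  have k1 := convP t bV (kerLint (eP X p1 l w0) x).
  have k2 := isIZ (ei (l * t) * (rp w t)%:C%C) (HV x).
  (* [k2] is a multiple of the vanishing transform, so subtracting it changes the integrand but not
     the integral. *)
  have k3 := isIB k1 k2; rewrite scaler0 subr0 in k3.
  apply: le_trans (_ : w * (M * nrm x * (H t * cw p + (scv (wtr p r) (rp w) t + rp w t * c1))) <= _); last first.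
    by rewrite le_eqVlt; apply/orP; left; apply/eqP; rewrite /G; ring.
  rewrite ler_wpM2l ?(ltW w0)//; apply: (isI_bound k3).
  apply: (@N1le_int _ _ _ (fun s => M * nrm x * (H t * wt p s + (wtr p r s * rp w (t - s) + rp w t * wtr p r s)))).
    move=> s; rewrite norm_modk_shift; last exact: kerlin.
    have kk : `|rp w (t - s) - rp w t| * wt p s <= H t * wt p s + (wtr p r s * rp w (t - s) + rp w t * wtr p r s).
      have [sr|sr] := leP `|s| r.
        apply: ler_wpDr; first by rewrite addr_ge0// mulr_ge0 ?rp_ge0 ?wtr_ge0.
        by rewrite ler_wpM2r ?wt_ge0// rp_shift.
      rewrite /wtr sr; apply: ler_wpDl; first by rewrite mulr_ge0// wt_ge0.
      by rewrite [X in _ <= X + _]mulrC -mulrDl ler_wpM2r ?wt_ge0// norm_rpB.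
    apply: le_trans (ler_wpM2l (normr_ge0 _) (VM s x)) _.
    have := ler_wpM2l (mulr_ge0 M0 (nrm_ge0 x)) kk.
    by apply: le_trans; rewrite le_eqVlt; apply/orP; left; apply/eqP; ring.
  apply: int_leZ; first by rewrite mulr_ge0// nrm_ge0.
  apply: int_leD; first exact: int_leZ (H0 t) (int_le_wt p1).
  apply: int_leD; first exact: int_le_conv h1 h2.
  exact: int_leZ (rp_ge0 w t) (nnk_int_le h1).
- by move=> x; rewrite !opM iV /= scaler0.
- have wc : w * c2 <= 1.
    by have := ler_wpM2l (ltW w0) c2w; rewrite divff// gt_eqF.
  have -> : w * M * (cw p * (2 * r + (expR (w * r) - 1) / w) + (c1 * c2 + c1 / w)) =
    M * ((2 * r * w + (expR (w * r) - 1)) * cw p + (c1 * (w * c2) + c1)) by field; rewrite gt_eqF.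
  rewrite ler_wpM2l// lerD2l; have := ler_wpM2l c10 wc; lra.
Qed.

(** w depends on the weighted bound M and on eta, but not on V or l; this is the uniformity in l. *)
Lemma bd_vanishing_small (M eta : R) : 0 <= M -> 0 < eta -> exists w, [/\ 0 < w, w < 1 &
  forall (V : A) l, inW0 V -> (forall s x, nrm (ker V s x) <= M * wt p s * nrm x) ->
    (forall x, isI (fun s => ei (- (l * s)) *: ker V s x) 0) ->
    bd (sc X p1 w * gP X p1 l w * V) eta].
Proof.
move=> M0 eta0; have M1 : 0 < M + 1 by rewrite ltr_wpDl.
have c1 : 0 < cw p + 1 by rewrite ltr_wpDl// cw_ge0.
have e0 : 0 < eta / (4 * (M + 1)) by rewrite divr_gt0// mulr_gt0.
have [r r0 hr] := int_le_wtr p1 e0.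
have D0 : 0 < 8 * (M + 1) * r * (cw p + 1) by rewrite !mulr_gt0.
(* The radius r already makes the tail at most eta/2. Then w r <= 1/2 permits the linear bound on
   exp(w r) - 1, and the last term makes the rest at most eta/2. *)
pose w := Num.min (2^-1) (Num.min ((2 * r)^-1) (eta / (8 * (M + 1) * r * (cw p + 1)))).
have w0 : 0 < w.
  by rewrite !lt_min (divr_gt0 eta0 D0) !invr_gt0 (mulr_gt0 _ r0)// ltr0n.
have w1 : w <= 2^-1 by rewrite !ge_min lexx.
have w2 : w * r <= 2^-1.
  have : w <= (2 * r)^-1 by rewrite !ge_min lexx orbT.
  by move/(ler_wpM2r (ltW r0)); rewrite invfM -mulrA mulVf ?gt_eqF// mulr1.
have w3 : w * (8 * (M + 1) * r * (cw p + 1)) <= eta.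
  by rewrite -ler_pdivlMr// !ge_min lexx !orbT.
exists w; split => //; first by lra.
move=> V l iV VM HV; apply: (bdW _ (bd_vanishing iV M0 VM HV w0 r0 hr)).
have wr0 : 0 <= w * r by rewrite mulr_ge0// ltW.
have h1 := expR_sub1 wr0 w2.
have h2 : (2 * r * w + (expR (w * r) - 1)) * cw p <= (4 * (w * r)) * (cw p + 1).
  have a1 : 2 * r * w + (expR (w * r) - 1) <= 4 * (w * r) by lra.
  have a2 : 0 <= 4 * (w * r) by rewrite mulr_ge0.
  by apply: le_trans (ler_wpM2r (cw_ge0 p) a1) _; rewrite ler_wpM2l// lerDl.
have h3 : 0 <= 4 * (w * r) * (cw p + 1) + 2 * (eta / (4 * (M + 1))).
  by rewrite addr_ge0// mulr_ge0 ?(ltW c1) ?(ltW e0)// mulr_ge0.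
apply: le_trans (_ : (M + 1) * (4 * (w * r) * (cw p + 1) + 2 * (eta / (4 * (M + 1)))) <= _).
  have M2 : M <= M + 1 by rewrite lerDl.
  apply: le_trans (ler_wpM2l M0 _) (ler_wpM2r h3 M2).
  by rewrite lerD2r.
rewrite mulrDr (_ : (M + 1) * (2 * _) = eta / 2); last by field; rewrite gt_eqF.
rewrite (_ : (M + 1) * _ = w * (8 * (M + 1) * r * (cw p + 1)) / 2); last by field.
lra.
Qed.

End VanishingTransform.

(** * The Fourier transform and uniform bounds for the inverses *)

Section Parametrix.
Context (R : realType) (X : completeNormedModType R[i]) (p : R) (p1 : 1 < p).
Local Notation A := (alg X p1).
Variables (a : A) (K : R) (F : R -> X -> X).
Hypothesis K0 : 0 <= K.
Hypothesis aK : forall t x, nrm (ker a t x) <= K * wt p t * nrm x.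
Hypothesis aF : forall l x, isI (fun t => ei (- (l * t)) *: ker a t x) (F l x).

Lemma fourier_bound l x : nrm (F l x) <= K * cw p * nrm x.
Proof.
apply: (isI_bound (aF l x)); rewrite mulrAC.
apply: (@N1le_int _ _ _ (fun t => K * nrm x * wt p t)).
  by move=> t; rewrite nrmZ cabs_ei mul1r mulrAC.
by apply: int_leZ; [rewrite mulr_ge0// nrm_ge0|exact: int_le_wt].
Qed.

Lemma fourier_isop l : isop (F l).
Proof.
split.
  move=> c x y; apply: (isI_uniq (aF l _)).
  have := isID (isIZ c (aF l x)) (aF l y); congr isI; apply/funext => t.
  by rewrite (kerlin a t) scalerDr !scalerA mulrC.
by exists (K * cw p); [rewrite mulr_ge0// cw_ge0|exact: fourier_bound].
Qed.

(** For p <= 2 the function t T(t) need not be integrable, so the Lipschitz bound of the exponential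
    is used for |t| <= r only, and the trivial bound 2 on the tail. *)
Lemma fourier_lip r e l l' x : 0 < r -> int_le (wtr p r) e ->
  nrm (F l x - F l' x) <= K * (`|l - l'| * r * cw p + 2 * e) * nrm x.
Proof.
move=> r0 he; have := isIB (aF l x) (aF l' x) => h.
rewrite mulrAC; apply: (isI_bound h).
apply: (@N1le_int _ _ _ (fun t => K * nrm x * (`|l - l'| * r * wt p t + 2 * wtr p r t))).
  move=> t; rewrite -scalerBl nrmZ.
  have kk : cabs (ei (- (l * t)) - ei (- (l' * t))) * wt p t <= `|l - l'| * r * wt p t + 2 * wtr p r t.
    rewrite /wtr; have [tr|tr] := ltP r `|t|.
      apply: ler_wpDl; first by rewrite !mulr_ge0 ?wt_ge0// ltW.
      by rewrite ler_wpM2r ?wt_ge0// cabs_ei_le2.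
    rewrite mulr0 addr0 ler_wpM2r ?wt_ge0//.
    apply: le_trans (cabs_ei_lip _ _) _.
    by rewrite -opprD normrN -mulNr -mulrDl normrM ler_wpM2l.
  apply: le_trans (ler_wpM2l (cabs_ge0 _) (aK t x)) _.
  have := ler_wpM2l (mulr_ge0 K0 (nrm_ge0 x)) kk.
  by apply: le_trans; rewrite le_eqVlt; apply/orP; left; apply/eqP; ring.
apply: int_leZ; first by rewrite mulr_ge0// nrm_ge0.
apply: int_leD; apply: int_leZ => //; last exact: int_le_wt.
by rewrite mulr_ge0// ltW.
Qed.

Hypothesis invF : forall l, exists2 G, isop G &
  (forall x, G (x + F l x) = x) /\ (forall x, G x + F l (G x) = x).

(** If F(l) - F(l0) has norm at most 1/(2(B + 1)), it absorbs half of the lower bound at l0, whose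
    constant doubles. Invertibility at each l is assumed; only the size of the inverse is at
    stake. *)
Lemma inverse_bound_near l0 : exists g d, [/\ 0 < g, 0 < d &
  forall l, `|l - l0| < d -> forall x, nrm x <= g * nrm (x + F l x)].
Proof.
have [G [Gl [B B0 GB]] [G1 _]] := invF l0.
have B1 : 0 < B + 1 by rewrite ltr_wpDl.
have K1 : 0 < K + 1 by rewrite ltr_wpDl.
have e0 : 0 < (8 * (K + 1) * (B + 1))^-1 by rewrite invr_gt0 !mulr_gt0.
have [r r0 hr] := int_le_wtr p1 e0.
have c1 : 0 < cw p + 1 by rewrite ltr_wpDl// cw_ge0.
have D0 : 0 < 4 * (K + 1) * (B + 1) * r * (cw p + 1) by rewrite !mulr_gt0.
exists (2 * (B + 1)), (4 * (K + 1) * (B + 1) * r * (cw p + 1))^-1; split.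
- by rewrite mulr_gt0.
- by rewrite invr_gt0.
move=> l ll x; have h := fourier_lip l l0 x r0 hr.
set d := `|l - l0| in ll h; set e := _^-1 in e0 hr h.
have om : K * (d * r * cw p + 2 * e) <= (2 * (B + 1))^-1.
  have d0 : 0 <= d := normr_ge0 _.
  have h1 : d * (4 * (K + 1) * (B + 1) * r * (cw p + 1)) <= 1.
    by rewrite -ler_pdivlMr// div1r ltW.
  have q0 : 0 <= d * r * (cw p + 1) + 2 * e.
    by rewrite addr_ge0// ?mulr_ge0 ?(ltW e0) ?(ltW c1) ?(ltW r0).
  apply: le_trans (_ : (K + 1) * (d * r * (cw p + 1) + 2 * e) <= _).
    apply: (le_trans _ (ler_wpM2r q0 (_ : K <= K + 1))); last by rewrite lerDl.
    by rewrite ler_wpM2l// lerD2r ler_wpM2l ?lerDl// mulr_ge0// ltW.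
  rewrite mulrDr (_ : (K + 1) * (2 * e) = (4 * (B + 1))^-1); last first.
    by rewrite /e; field; rewrite !gt_eqF.
  have h2 : (K + 1) * (d * r * (cw p + 1)) <= (4 * (B + 1))^-1.
    rewrite -[leRHS]mul1r ler_pdivlMr ?mulr_gt0//; apply: le_trans h1.
    by rewrite le_eqVlt; apply/orP; left; apply/eqP; ring.
  apply: le_trans (lerD h2 (lexx _)) _.
  by rewrite le_eqVlt; apply/orP; left; apply/eqP; field; rewrite gt_eqF.
have h0 : nrm x <= (B + 1) * nrm (x + F l0 x).
  rewrite -{1}(G1 x); apply: le_trans (GB _) _.
  by rewrite ler_wpM2r ?nrm_ge0// lerDl.
have h1 : nrm (x + F l0 x) <= nrm (x + F l x) + nrm (F l x - F l0 x).
  rewrite (_ : x + F l0 x = (x + F l x) - (F l x - F l0 x)); last by zmod.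
  by rewrite (le_trans (nrmB _ _)).
have h2 : nrm (F l x - F l0 x) <= (2 * (B + 1))^-1 * nrm x.
  by apply: le_trans h _; rewrite ler_wpM2r ?nrm_ge0.
have h3 := ler_wpM2l (ltW B1) (le_trans h1 (lerD (lexx _) h2)).
rewrite mulrDr mulrA (_ : (B + 1) * _^-1 = 2^-1) in h3; last by field; rewrite gt_eqF.
have := le_trans h0 h3; set u := nrm x; set v := nrm _; lra.
Qed.

(** Compactness of [-L, L] in covering form, with the constant as an integer tending to infinity:
    each local bound holds for all large integers, hence one integer serves all l. *)
Lemma inverse_bound L : exists2 g, 0 < g &
  forall l, `|l| <= L -> forall x, nrm x <= g * nrm (x + F l x).
Proof.
have cK : compact [set` `[- L, L]%R] by exact: segment_compact.
move/compact_near_coveringP: cK => /(_ nat \oo (fun n l => forall x, nrm x <= n%:R * nrm (x + F l x)) _)[].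
  move=> l0 _; have [g [d [g0 d0 h]]] := inverse_bound_near l0.
  exists (ball l0 d, [set n | (Num.truncn g < n)%N]).
    split => /=; first exact: nbhsx_ballx.
    by exists (Num.truncn g).+1.
  move=> [l n]/= [ll ln] x; apply: le_trans (h l _ x) _.
    by rewrite distrC.
  by rewrite ler_wpM2r ?nrm_ge0// ltW// (lt_le_trans (truncnS_gt _))// ler_nat.
(* The successor makes the constant positive. *)
move=> n _ h; exists (n.+1)%:R => // l lL x.
apply: le_trans (h n _ l _ x) _ => //=.
  by rewrite in_itv/= -ler_norml.
by rewrite ler_wpM2r ?nrm_ge0// ler_nat.
Qed.

End Parametrix.

Section ParametrixExists.
Context (R : realType) (X : completeNormedModType R[i]) (p : R) (p1 : 1 < p).
Local Notation A := (alg X p1).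
Variables (a : A) (K : R) (F : R -> X -> X).
Hypothesis ia : inW0 a.
Hypothesis K0 : 0 <= K.
Hypothesis aK : forall t x, nrm (ker a t x) <= K * wt p t * nrm x.
Hypothesis aF : forall l x, isI (fun t => ei (- (l * t)) *: ker a t x) (F l x).
Hypothesis invF : forall l, exists2 G, isop G &
  (forall x, G (x + F l x) = x) /\ (forall x, G x + F l (G x) = x).

Lemma parametrix_pointwise (L : R) : 0 < L -> exists g eps,
  [/\ 0 < g, 0 < eps, eps < 1 & forall l, `|l| <= L -> exists F G : A,
    [/\ G * (1 + F) = 1, (1 + F) * G = 1, bd F g & bd G g] /\
    bd (sc X p1 eps * gP X p1 l eps * (a - F * gP X p1 l 1)) (kap p / g)].
Proof.
move=> L0; have [g0 g00 hg] := inverse_bound K0 aK aF invF L.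
pose tau := K * cw p.
have tau0 : 0 <= tau by rewrite mulr_ge0// cw_ge0.
(* [g0] bounds the inverses and [tau] the transforms; the sum serves for both. *)
pose g := g0 + tau.
have gp : 0 < g by rewrite ltr_wpDr.
have [C C0 hC] : exists2 C, 0 <= C & forall t, `|rp 1 t| <= C * wt p t by case: (@rgood_rp R p p1 1 ltr01).
have M0 : 0 <= K + tau * C by rewrite addr_ge0// mulr_ge0.
have [eps [e0 e1 heps]] := @bd_vanishing_small R X p p1 (K + tau * C) (kap p / g) M0 (divr_gt0 (kap_gt0 p) gp).
exists g, eps; split => // l lL.
have hF : isop (F l) by exact: (fourier_isop K0 aK aF l).
have FK : forall x, nrm (F l x) <= tau * nrm x by exact: (fourier_bound K0 aK aF l).
have [G hG [G1 G2]] := invF l.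
exists (opA p1 hF), (opA p1 hG); split; first split.
- by apply: alg_eq => [x|t x]; [rewrite opM/= G1|rewrite ker_opAl/= addr0 (islin0 hG.1)].
- by apply: alg_eq => [x|t x]; [rewrite opM/= G2|rewrite ker_opAr/= addr0].
- apply: bdW (bd_opA _ hF _ FK) => //; by rewrite /g lerDr ltW.
- apply: (bdW (c := g0)); first by rewrite /g lerDl.
  apply: bd_opA; first exact: ltW.
  by move=> x; apply: le_trans (hg l lL (G x)) _; rewrite G2.
have kV t x : ker (a - opA p1 hF * gP X p1 l 1) t x = ker a t x - F l (modk l (rp 1) t *: x).
  by rewrite kerD kerN ker_opAl (gPE X p1 l ltr01).
apply: heps.
- move=> x; rewrite /= ia (gPE X p1 l ltr01) /= (islin0 hF.1) subr0//.
- move=> t x; rewrite kV; apply: le_trans (nrmB _ _) _.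
  rewrite !mulrDl lerD//; apply: le_trans (FK _) _.
  rewrite nrmZ cabsM cabs_ei mul1r cabsR -[X in _ <= X * _]mulrA -[leRHS]mulrA.
  by rewrite ler_wpM2l// ler_wpM2r ?nrm_ge0.
- move=> x.
  have mrp := measurable_rp (1 : R).
  (* [rp 1] has integral 1, so F P_{l,1} has transform F at l and cancels that of [a]. *)
  have h1 : isI (fun t => (rp 1 t)%:C%C *: F l x) (1%:C%C *: F l x).
    apply: isI_scalar => //; first exact: rp_ge0.
    by rewrite integral_rp ?invr1.
  have h := isIB (aF l x) h1; rewrite scale1r subrr in h.
  move: h; congr isI; apply/funext => t; rewrite kV scalerBr; congr (_ - _).
  rewrite (islinZ _ _ hF.1) scalerA; congr (_ *: _).
  by rewrite /modk mulrA -eiD addNr ei0 mul1r.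
Qed.

Lemma parametrix_alg :
  parametrix (@bd R X p p1) (sc X p1) (kap p) (gP X p1) a.
Proof. exact: parametrix_pointwise. Qed.

(** The same F, G and eps serve: G is a two-sided inverse, and the scalar kernels commute with F and
    with the remainder. *)
Lemma parametrix_conv :
  @parametrix R A^c (@bd R X p p1) (sc X p1) (kap p) (gP X p1) a.
Proof.
move=> L L0; have [g [eps [g0 e0 e1 h]]] := parametrix_pointwise L0.
exists g, eps; split => // l lL; have [F' [G' [[h1 h2 h3 h4] h5]]] := h l lL.
exists F', G'; split; first by split.
have cM (u v : A) : (u : A^c) * (v : A^c) = v * u :> A by [].
rewrite !cM (gP_central l F' ltr01) -(sc_central _ (gP X p1 l eps)) mulrA.
by rewrite -(sc_central _ (a - _)) -mulrA -gP_central// mulrA.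
Qed.

End ParametrixExists.

(** * The approximate unit *)

Section Fejer.
Context (R : realType).
Local Notation mu := (@lebesgue_measure R).
Implicit Types (t h d L : R) (n : nat).

Definition csum n h t : R := \sum_(j < n) cos (j%:R * h * t).
Definition ssum n h t : R := \sum_(j < n) sin (j%:R * h * t).
Definition dsum n h t : R[i] := (csum n h t +i* ssum n h t)%C.
(** The squared modulus of the sum of exp(ijht) over j < n, that is n times a Fejer kernel with
    frequency spacing h. *)
Definition fejer n h t : R := csum n h t ^+ 2 + ssum n h t ^+ 2.

Lemma dsumE n h t : dsum n h t = \sum_(j < n) ei (j%:R * h * t).
Proof.
rewrite /dsum /csum /ssum; elim: n => [|n IH]; first by rewrite !big_ord0.
by rewrite !big_ord_recr /= -IH /ei; simpc.
Qed.

Lemma dsumNE n h t : (csum n h t -i* ssum n h t)%C = \sum_(j < n) ei (- (j%:R * h * t)).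
Proof.
rewrite /csum /ssum; elim: n => [|n IH]; first by rewrite !big_ord0 oppr0.
by rewrite !big_ord_recr /= -IH /ei cosN sinN opprD; simpc.
Qed.

Lemma fejer_ge0 n h t : 0 <= fejer n h t.
Proof. by rewrite addr_ge0// sqr_ge0. Qed.

(** Displays the kernel as a combination of exponentials with nonnegative coefficients and
    frequencies at most nh in absolute value. *)
Lemma fejer_expand n h t :
  (fejer n h t)%:C%C = \sum_(j < n) \sum_(l < n) ei ((j%:R - l%:R) * h * t).
Proof.
have -> : \sum_(j < n) \sum_(l < n) ei ((j%:R - l%:R) * h * t) =
    (\sum_(j < n) ei (j%:R * h * t)) * (\sum_(l < n) ei (- (l%:R * h * t))).
  rewrite big_distrlr /=; apply: eq_bigr => j _; apply: eq_bigr => l _.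
  by rewrite -eiD; congr ei; ring.
rewrite -dsumE -dsumNE /fejer /dsum; simpc; congr (_ +i* _)%C; ring.
Qed.

Lemma fejer_cabs n h t : fejer n h t = cabs (dsum n h t) ^+ 2.
Proof. by rewrite /cabs normc_def /= sqr_sqrtr// fejer_ge0. Qed.

Lemma dsum_geometric n h t : dsum n h t * (ei (h * t) - ei 0) = ei (n%:R * h * t) - ei 0.
Proof.
rewrite dsumE; elim: n => [|n IH]; first by rewrite big_ord0 !mul0r subrr.
rewrite big_ord_recr /= mulrDl IH (_ : n.+1%:R * h * t = n%:R * h * t + h * t).
  by rewrite eiD ei0; ring.
by rewrite -natr1; ring.
Qed.

(** The geometric sum times exp(iht) - 1 has modulus at most 2, and exp(iht) - 1 has modulus at
    least |ht|/2 as long as |ht| <= 1. *)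
Lemma fejer_upper n h t : h * `|t| <= 1 -> 0 < h -> fejer n h t * (h * t) ^+ 2 <= 16.
Proof.
move=> ht h0; have := congr1 (@cabs R) (dsum_geometric n h t); rewrite cabsM => e.
have hn : `|h * t| <= 1 by rewrite normrM gtr0_norm.
have s0 : `|h * t| / 2 <= cabs (ei (h * t) - ei 0).
  rewrite cabs_ei_sub subr0.
  have hh : `|h * t| / 2 / 2 <= sin (`|h * t| / 2).
    have v0 := normr_ge0 (h * t).
    apply: sin_lower; move: v0 hn; set v := `|h * t|; lra.
  have -> : `|sin (h * t / 2)| = `|sin (`|h * t| / 2)|.
    have [p|p] := leP 0 (h * t); first by rewrite (ger0_norm p).
    by rewrite (ltr0_norm p) mulNr sinN normrN.
  have := ler_norm (sin (`|h * t| / 2)); lra.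
have e2 : cabs (dsum n h t) * cabs (ei (h * t) - ei 0) <= 2 by rewrite e cabs_ei_le2.
have e3 : cabs (dsum n h t) * `|h * t| <= 4.
  have := ler_wpM2l (cabs_ge0 (dsum n h t)) s0; lra.
rewrite fejer_cabs -[(h * t) ^+ 2]real_normK ?num_real// -exprMn.
have -> : (16 : R) = 4 ^+ 2 by ring.
by rewrite lerXn2r ?nnegrE// mulr_ge0 ?cabs_ge0.
Qed.

Lemma fejer_le n h t : fejer n h t <= n%:R ^+ 2.
Proof.
rewrite fejer_cabs lerXn2r ?nnegrE ?cabs_ge0//.
rewrite dsumE; elim: n => [|n IH]; first by rewrite big_ord0 /cabs normr0.
rewrite big_ord_recr /= -natr1; apply: le_trans (cabsD _ _) _.
by rewrite cabs_ei lerD2r.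
Qed.

Lemma fejer_lower n h t : n%:R * h * `|t| <= 1 -> 0 < h -> n%:R ^+ 2 / 4 <= fejer n h t.
Proof.
move=> nht h0.
have c2 : n%:R / 2 <= csum n h t.
  have -> : n%:R / 2 = \sum_(j < n) (2^-1 : R) by rewrite sumr_const card_ord -[RHS]mulr_natl.
  apply: ler_sum => j _; apply: le_trans (cos_lower _).
  have : (j%:R * h * t) ^+ 2 <= 1.
    rewrite -real_normK ?num_real// expr_le1// !normrM (gtr0_norm h0) normr_nat.
    apply: le_trans nht; rewrite -!mulrA ler_wpM2r ?mulr_ge0// ?(ltW h0)//.
    by rewrite ler_nat ltnW.
  lra.
have : (n%:R / 2) ^+ 2 <= csum n h t ^+ 2.
  by rewrite lerXn2r ?nnegrE// (le_trans _ c2).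
rewrite /fejer; have := sqr_ge0 (ssum n h t); lra.
Qed.

Lemma measurable_fejer n h : measurable_fun setT (fejer n h).
Proof.
have mc j : measurable_fun setT (fun t : R => cos (j%:R * h * t)) by case: (measurable_trig (j%:R * h)).
have ms j : measurable_fun setT (fun t : R => sin (j%:R * h * t)) by case: (measurable_trig (j%:R * h)).
by apply: measurable_funD; apply: measurable_funX; apply: measurable_sum.
Qed.


Lemma wt_nat m t : wt m%:R t = (jbr t ^+ m)^-1.
Proof. by rewrite /wt powR_mulrn// ltW// jbr_gt0. Qed.

(** With spacing h = L/n the Fejer sum is periodic, with unwanted peaks at multiples of 2 pi / h;
    the damping makes them harmless once n is large in terms of d. The n^2 coefficients are 1/(nI),
    I being the normalising integral, so their sum n/I is at most 4L for every d and n. *)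
Lemma fejer_kernel L (dl d : R) : 0 < L -> 0 < dl -> 0 < d -> d <= L / 2 ->
  exists (s : seq (R * R)) k M, [/\ nnk k M 1,
    forall z, z \in s -> `|z.1| <= L /\ 0 <= z.2,
    \sum_(z <- s) z.2 <= 4 * L,
    forall t, \sum_(z <- s) z.2%:C%C * ei (z.1 * t) * (expR (- d * `|t|))%:C%C = (k t)%:C%C &
    int_le (fun t => if `|t| < dl then 0 else k t) (64 * (1 + dl ^- 2) * cw 2 / L)].
Proof.
move=> L0 dl0 d0 dL.
have [C C0 hC] := expR_wt d0 (ltr0n R 4).
(* Large enough for the damping, at most C <t>^-4, to win beyond |t| = 1/h. *)
pose n := (Num.truncn (L ^+ 4 * C)).+1.
have nR : 0 < n%:R :> R by rewrite ltr0n.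
have hn : L ^+ 4 * C <= n%:R by rewrite ltW// truncnS_gt.
have n1 : 1 <= n%:R :> R by rewrite ler1n.
pose h := L / n%:R.
have h0 : 0 < h by rewrite divr_gt0.
have nh : n%:R * h = L by rewrite /h mulrC divfK// gt_eqF.
pose k0 t := expR (- d * `|t|) * fejer n h t / n%:R.
have k00 t : 0 <= k0 t by rewrite /k0 !mulr_ge0 ?expR_ge0 ?fejer_ge0 ?invr_ge0.
have me : measurable_fun setT (fun t : R => expR (- d * `|t|)).
  apply: (@measurableT_comp _ _ _ _ _ _ (@expR R) _ (fun t => - d * `|t|)); first exact: measurable_expR.
  by apply: measurable_funM; [exact: measurable_cst|exact: normr_measurable].
have mk0 : measurable_fun setT k0.
  apply: measurable_funM; last exact: measurable_cst.
  by apply: measurable_funM => //; exact: measurable_fejer.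
have k0e t : k0 t <= n%:R * expR (- d * `|t|).
  rewrite /k0 ler_pdivrMr// mulrAC -expr2 mulrC.
  by rewrite ler_wpM2r ?expR_ge0// fejer_le.
have ik0 : int_le k0 (n%:R * (d^-1 + d^-1)).
  have i1 : int_le (fun t => n%:R * expR (- d * `|t|)) (n%:R * (d^-1 + d^-1)).
    apply: int_leZ; first exact: ltW.
    rewrite (_ : (fun t => _) = fun t => rp d t + rm d t).
      apply: int_leD; first exact: int_le_rp.
      by split; [exact: measurable_rm|exact: rm_ge0|rewrite integral_rm].
    apply/funext => t; rewrite /rp /rm; have [t0|t0] := leP 0 t; first by rewrite (ger0_norm t0) addr0.
    by rewrite (ltr0_norm t0) add0r mulrN mulNr opprK.
  case: i1 => m1 p1 i1; split => //; apply: le_trans i1.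
  by apply: le_lower_integral => t; rewrite lee_fin.
have k0n t : k0 t <= n%:R.
  apply: le_trans (k0e t) _; rewrite ler_piMr ?(ltW nR)//.
  by rewrite -expR0 ler_expR mulNr oppr_le0 mulr_ge0// ltW.
have [I hI _] := int_le_nnk k0n ik0.
(* On |t| <= 1/L the Fejer sum is at least n^2/4, and d <= L/2 keeps the damping above 1/2; so [k0]
   is at least n/8 on an interval of length 2/L. *)
have Il : n%:R / (4 * L) <= I.
  have := integral_flat (ltW (_ : 0 < L^-1)); rewrite invr_gt0 => /(_ L0) fl.
  case: hI => _ _ _ eI.
  rewrite -lee_fin -eI.
  have -> : n%:R / (4 * L) = n%:R / 8 * (2 * L^-1) by field; rewrite gt_eqF.
  rewrite EFinM -fl -ge0_integralZl; last 4 first.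
  - exact: measurableT.
  - by case: (int_le_flat (ltW (_ : 0 < L^-1))) => [|? _ _]; [rewrite invr_gt0|apply/measurable_EFinP].
  - by move=> t _; rewrite lee_fin; case: ifP.
  - by rewrite lee_fin divr_ge0// ltW.
  apply: le_lower_integral => t; first by rewrite -EFinM lee_fin mulr_ge0 ?divr_ge0 ?(ltW nR)//; case: ifP.
  rewrite -EFinM lee_fin; case: ifPn => tL; last by rewrite mulr0.
  have tL' : L * `|t| <= 1 by rewrite -ler_pdivlMl// mulr1.
  have f1 := @fejer_lower n h t; rewrite nh in f1; have {}f1 := f1 tL' h0.
  have e1 : 2^-1 <= expR (- d * `|t|).
    apply: le_trans (expR_ge1Dx _).
    have := ler_wpM2r (normr_ge0 t) dL; lra.
  rewrite mulr1 /k0 ler_pdivlMr//.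
  have := ler_wpM2r (fejer_ge0 n h t) e1.
  set u := expR _ * _; rewrite expr2 in f1; lra.
have I0 : 0 < I by apply: lt_le_trans Il; rewrite divr_gt0// mulr_gt0.
have Ii : I^-1 <= 4 * L / n%:R.
  by rewrite -[leRHS]invrK lef_pV2 ?posrE ?invr_gt0 ?divr_gt0 ?mulr_gt0// invf_div.
pose w := (n%:R * I)^-1.
have w0 : 0 <= w by rewrite invr_ge0 mulr_ge0// ltW.
exists [seq ((j%:R - l%:R) * h, w) | j : 'I_n <- index_enum 'I_n, l : 'I_n <- index_enum 'I_n],
  (fun t => I^-1 * k0 t), (I^-1 * n%:R).
have kt t : k0 t * (L ^+ 2 * t ^+ 2) <= 16 * n%:R.
  have t2 : 0 <= t ^+ 2 := sqr_ge0 t.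
  have [ht|ht] := leP (h * `|t|) 1.
    have f1 := fejer_upper n ht h0.
    have e1 : k0 t <= fejer n h t / n%:R.
      rewrite ler_wpM2r ?invr_ge0 ?(ltW nR)// ler_piMl ?fejer_ge0//.
      by rewrite -expR0 ler_expR mulNr oppr_le0 mulr_ge0// ltW.
    have e2 : 0 <= L ^+ 2 * t ^+ 2 by rewrite mulr_ge0// sqr_ge0.
    apply: le_trans (ler_wpM2r e2 e1) _.
    rewrite [leLHS](_ : _ = fejer n h t * (h * t) ^+ 2 * n%:R); first by rewrite ler_wpM2r// ltW.
    by rewrite /h; field; rewrite gt_eqF.
  (* Here |ht| > 1: the trivial bound n^2 on the Fejer sum is combined with the damping, and the
     factor (ht)^2 >= 1 supplies the two missing powers of t. *)
  have e1 : k0 t <= n%:R * (C * wt 4 t).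
    by apply: le_trans (k0e t) _; rewrite ler_wpM2l// ltW.
  have e2 : wt 4 t * t ^+ 4 <= 1.
    rewrite (wt_nat 4) mulrC ler_pdivrMr ?exprn_gt0 ?jbr_gt0// mul1r.
    by rewrite (exprM t 2 2) (exprM (jbr t) 2 2) jbr_sqr lerXn2r ?nnegrE ?addr_ge0// lerDr.
  have e3 : 1 <= h ^+ 2 * t ^+ 2.
    rewrite -exprMn -real_normK ?num_real// exprn_ege1// normrM gtr0_norm//; exact: ltW.
  have q0 : 0 <= L ^+ 2 * t ^+ 2 by rewrite mulr_ge0// sqr_ge0.
  apply: le_trans (ler_wpM2r q0 e1) _.
  have a0 : 0 <= n%:R * C * L ^+ 2 * wt 4 t * t ^+ 2.
    by rewrite (mulr_ge0 (mulr_ge0 (mulr_ge0 (mulr_ge0 (ltW nR) C0) (sqr_ge0 L)) (wt_ge0 4 t)) (sqr_ge0 t)).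
  have := ler_wpM2l a0 e3; rewrite mulr1.
  rewrite (_ : _ * (h ^+ 2 * _) = n%:R * C * L ^+ 2 * h ^+ 2 * (wt 4 t * t ^+ 4)); last by ring.
  have b0 : 0 <= n%:R * C * L ^+ 2 * h ^+ 2 by rewrite (mulr_ge0 (mulr_ge0 (mulr_ge0 (ltW nR) C0) (sqr_ge0 L)) (sqr_ge0 h)).
  have := ler_wpM2l b0 e2; rewrite mulr1.
  have -> : n%:R * C * L ^+ 2 * h ^+ 2 = L ^+ 4 * C / n%:R.
    by rewrite /h; field; rewrite gt_eqF.
  have : L ^+ 4 * C / n%:R <= 1 by rewrite ler_pdivrMr// mul1r.
  move=> c1 c2 c3; rewrite [leLHS](_ : _ = n%:R * C * L ^+ 2 * wt 4 t * t ^+ 2); last by ring.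
  apply: (le_trans c3); apply: (le_trans c2); apply: (le_trans c1); lra.
have kk0 t : 0 <= I^-1 * k0 t by rewrite mulr_ge0// invr_ge0 ltW.
split.
- case: hI => _ _ _ eI; split => //.
  + by apply: measurable_funM => //; exact: measurable_cst.
  + by move=> t; rewrite ler_wpM2l// invr_ge0 ltW.
  + under eq_integral do rewrite EFinM.
    rewrite ge0_integralZl; last 4 first.
    * exact: measurableT.
    * exact/measurable_EFinP.
    * by move=> t _; rewrite lee_fin.
    * by rewrite lee_fin invr_ge0 ltW.
    by rewrite eI -EFinM mulVf// gt_eqF.
- move=> z /allpairsP[[j l] /= [_ _ ->]] /=; split => //.
  rewrite normrM (gtr0_norm h0) -nh ler_wpM2r ?(ltW h0)//.
  have : (j%:R : R) <= n%:R by rewrite ler_nat ltnW.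
  have : (l%:R : R) <= n%:R by rewrite ler_nat ltnW.
  have : 0 <= (j%:R : R) by []; have : 0 <= (l%:R : R) by [].
  by rewrite ler_norml => ? ? ? ?; apply/andP; split; lra.
- rewrite big_allpairs_dep /=; under eq_bigr do rewrite sumr_const.
  rewrite sumr_const card_ord -mulrnA -[leLHS]mulr_natl natrM /w.
  have -> : n%:R * n%:R / (n%:R * I) = n%:R * I^-1 by field; rewrite !gt_eqF.
  apply: le_trans (ler_wpM2l (ltW nR) Ii) _.
  by rewrite le_eqVlt; apply/orP; left; apply/eqP; field; rewrite gt_eqF.
- move=> t; rewrite big_allpairs_dep /=.
  transitivity (w%:C%C * (\sum_(j < n) \sum_(l < n) ei ((j%:R - l%:R) * h * t)) * (expR (- d * `|t|))%:C%C).
    rewrite mulr_sumr mulr_suml; apply: eq_bigr => j _.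
    by rewrite mulr_sumr mulr_suml.
  rewrite -fejer_expand -!rmorphM; congr (_ %:C)%C.
  by rewrite /k0 /w; field; rewrite !gt_eqF.
(* Away from 0 the normalised kernel is at most 64/(L t^2), and t^-2 <= (1 + dl^-2) <t>^-2 when |t|
   >= dl. *)
- pose c := 64 * (1 + dl ^- 2) / L.
  have i1 : int_le (fun t => c * wt 2 t) (64 * (1 + dl ^- 2) * cw 2 / L).
    rewrite (_ : _ * _ / _ = c * cw 2); last by rewrite /c mulrAC.
    apply: int_leZ; last by apply: int_le_wt; rewrite ltr1n.
    by rewrite !mulr_ge0 ?addr_ge0 ?invr_ge0 ?exprn_ge0// ltW.
  have kc t : (if `|t| < dl then 0 else I^-1 * k0 t) <= c * wt 2 t.
    case: ifPn => [_|]; first by case: i1.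
    rewrite -leNgt => td; have t0 : 0 < `|t| := lt_le_trans dl0 td.
    have t2 : 0 < t ^+ 2 by rewrite -real_normK ?num_real// exprn_gt0.
    have e1 : k0 t <= 16 * n%:R / (L ^+ 2 * t ^+ 2).
      by rewrite ler_pdivlMr ?(mulr_gt0 (exprn_gt0 2 L0) t2).
    have e2 : (t ^+ 2)^-1 <= (1 + dl ^- 2) * wt 2 t.
      have p2 : 0 < 1 + t ^+ 2 by rewrite ltr_pwDl// ltW.
      rewrite (wt_nat 2) jbr_sqr ler_pdivlMr//.
      have -> : (t ^+ 2)^-1 * (1 + t ^+ 2) = 1 + (t ^+ 2)^-1 by field; rewrite -normr_gt0.
      rewrite lerD2l lef_pV2 ?posrE ?(exprn_gt0 2 dl0)//.
      by rewrite -[t ^+ 2]real_normK ?num_real// lerXn2r ?nnegrE// ltW.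
    have I0' : 0 <= I^-1 by rewrite invr_ge0 ltW.
    have e3 := ler_pM I0' (k00 t) Ii e1. apply: (le_trans e3).
    have -> : 4 * L / n%:R * (16 * n%:R / (L ^+ 2 * t ^+ 2)) = 64 / L * (t ^+ 2)^-1.
      have tn : t != 0 by rewrite -normr_gt0.
      by field; rewrite ?tn ?[_%:R == 0]gt_eqF ?[L == 0]gt_eqF.
    have -> : c * wt 2 t = 64 / L * ((1 + dl ^- 2) * wt 2 t) by rewrite /c; ring.
    by rewrite ler_wpM2l// divr_ge0// ltW.
  have i0 t : 0 <= (if `|t| < dl then 0 else I^-1 * k0 t) by case: ifP.
  case: i1 => m1 _ i1; split => //; last first.
    by apply: le_trans i1; apply: le_lower_integral => t; rewrite lee_fin.
  apply: measurable_fun_ifT; [|exact: measurable_cst|].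
    by apply: measurable_fun_ltr; [exact: normr_measurable|exact: measurable_cst].
  by apply: measurable_funM => //; exact: measurable_cst.
Qed.

End Fejer.

(** * The damped Fejer kernel acting on the N-th power *)

Section ApproximateUnit.
Context (R : realType) (X : completeNormedModType R[i]) (p : R) (p1 : 1 < p).
Local Notation A := (alg X p1).
Local Notation mu := (@lebesgue_measure R).

Let p0 : 0 <= p. Proof. exact: le_trans ler01 (ltW p1). Qed.

Lemma nnk_wt : nnk (@wt R p) 1 (cw p).
Proof.
by split; [exact: measurable_wt|exact: wt_ge0|move=> t; exact: wt_le1|rewrite integral_wt].
Qed.

(** As k has integral 1, the difference at t is the integral of k(s)(B(t) - B(t - s)). For |s| < dl
    translation continuity gives e, and the remaining mass tau of k meets twice the bound of B. *)
Lemma bd_approx (B U : A) (k : R -> R) (Mk K dl e tau : R) : inW0 B -> inW0 U ->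
  (forall t x, ker U t x = (k t)%:C%C *: x) -> nnk k Mk 1 -> 0 <= K -> 0 <= e ->
  (forall t x, nrm (ker B t x) <= K * wt p t * nrm x) ->
  (forall s t x, `|s| < dl -> nrm (ker B t x - ker B (t - s) x) <= e * wt p t * nrm x) ->
  int_le (fun t => if `|t| < dl then 0 else k t) tau ->
  bd (B - U * B) (e * cw p + 2 * K * tau * cw p).
Proof.
move=> iB iU Uk hk K0 e0 BK tr htau.
have [mk k0 kM ik] := hk.
pose kd (t : R) := if `|t| < dl then 0 else k t.
have kdM t : kd t <= Mk by rewrite /kd; case: ifP => // _; exact: le_trans (k0 t) (kM t).
have [c1 h1 c1t] := int_le_nnk kdM htau.
have kd0 t : 0 <= kd t by case: h1.
have hs := sc_scv h1 nnk_wt.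
have c10 : 0 <= c1 by case: h1 => _ a0 _ ic; rewrite -lee_fin -ic; apply: integral_ge0 => t _; rewrite lee_fin.
have [AU [AU0 bU _ _ _]] := kernP p1 (kerP U).
pose G t := e * wt p t + K * (c1 * wt p t + scv kd (wt p) t).
have iG : int_le G (e * cw p + K * (c1 * cw p + c1 * cw p)).
  apply: int_leD; first exact: int_leZ e0 (int_le_wt p1).
  apply: int_leZ => //; apply: int_leD; first exact: int_leZ c10 (int_le_wt p1).
  exact: nnk_int_le hs.
apply: (bdW _ (bd_int (f := G) _ _ iG)).
- rewrite lerD2l (_ : K * _ = 2 * K * (c1 * cw p)); last by ring.
  by rewrite -[leRHS]mulrA ler_wpM2l ?mulr_ge0// ler_wpM2r// cw_ge0.
- by apply: inW0D => //; apply: inW0N; exact: inW0Ml.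
- move=> t x; rewrite kerD kerN kerM iU iB (islin0 (kerlin U t)) !add0r.
  have i1 := convP t bU (kerLint B x).
  have i2 : isI (fun s => (k s)%:C%C *: ker B t x) (1%:C%C *: ker B t x) by exact: isI_scalar.
  have i3 := isIB i2 i1; rewrite scale1r in i3.
  apply: le_trans (_ : nrm x * (e * wt p t * 1 + K * (wt p t * c1 + scv kd (wt p) t)) <= _); last first.
    by rewrite le_eqVlt; apply/orP; left; apply/eqP; rewrite /G; ring.
  apply: (isI_bound i3).
  apply: (@N1le_int _ _ _ (fun s => nrm x * (e * wt p t * k s + K * (wt p t * kd s + kd s * wt p (t - s))))).
    move=> s; rewrite Uk -scalerBr nrmZ cabsR ger0_norm//.
    have := k0 s; have := wt_ge0 p t; have := wt_ge0 p (t - s); have := nrm_ge0 x.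
    rewrite /kd; case: ifPn => [sd|_] x0 w1 w2 ks.
      rewrite !(mulr0, mul0r, addr0); apply: le_trans (ler_wpM2l ks (tr s t x sd)) _.
      by rewrite le_eqVlt; apply/orP; left; apply/eqP; ring.
    have := le_trans (nrmB _ _) (lerD (BK t x) (BK (t - s) x)).
    move/(ler_wpM2l ks) => /le_trans; apply.
    have q0 : 0 <= nrm x * (e * wt p t * k s) by rewrite !mulr_ge0.
    rewrite [leRHS]mulrDr; apply: ler_wpDl => //.
    by rewrite le_eqVlt; apply/orP; left; apply/eqP; ring.
  apply: int_leZ; first exact: nrm_ge0.
  apply: int_leD; first by apply: int_leZ (nnk_int_le hk); rewrite mulr_ge0// wt_ge0.
  apply: int_leZ => //; apply: int_leD; first exact: int_leZ (wt_ge0 p t) (nnk_int_le h1).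
  exact: int_le_conv h1 nnk_wt.
Qed.

Definition expsum (d : R) (s : seq (R * R)) : A :=
  \sum_(z <- s) sc X p1 z.2 * (gP X p1 z.1 d + gM X p1 z.1 d).

Lemma inW0_expsum d s : 0 < d -> inW0 (expsum d s).
Proof.
move=> d0; rewrite /expsum; elim: s => [|z s IH]; first by rewrite big_nil.
rewrite big_cons; apply: inW0D => //; apply: inW0Mr; apply: inW0D; rewrite ?gPE ?gME//.
Qed.

Lemma ker_expsum d s t x : 0 < d -> ker (expsum d s) t x =
  (\sum_(z <- s) z.2%:C%C * ei (z.1 * t) * (expR (- d * `|t|))%:C%C) *: x.
Proof.
move=> d0; rewrite /expsum; elim: s => [|z s IH]; first by rewrite !big_nil scale0r.
rewrite !big_cons kerD IH scalerDl; congr (_ + _).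
rewrite ker_scAl kerD (gPE X p1 z.1 d0) (gME X p1 z.1 d0) /= /modk -scalerDl scalerA; congr (_ *: _).
rewrite -mulrDr -mulrA -rmorphD; congr (_ * (_ * _%:C)%C).
rewrite /rp /rm; have [t0|t0] := leP 0 t; first by rewrite (ger0_norm t0) addr0.
by rewrite (ltr0_norm t0) add0r mulrN mulNr opprK.
Qed.

Lemma expsum_central d s (b : A) : 0 < d -> expsum d s * b = b * expsum d s.
Proof.
move=> d0; rewrite /expsum mulr_suml mulr_sumr; apply: eq_bigr => z _.
by rewrite -mulrA mulrDl gP_central// gM_central// -mulrDr mulrA sc_central -mulrA.
Qed.

Variables (a : A) (N : nat) (K : R).
Hypothesis iN : inW0 (a ^+ N).
Hypothesis K0 : 0 <= K.
Hypothesis aK : forall t x, nrm (ker (a ^+ N) t x) <= K * wt p t * nrm x.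
Hypothesis tr : forall e, 0 < e -> exists2 dl, 0 < dl & forall s t x, `|s| < dl ->
  nrm (ker (a ^+ N) t x - ker (a ^+ N) (t - s) x) <= e * wt p t * nrm x.

Lemma approx_pointwise (eta : R) : 0 < eta -> exists L C,
  [/\ 0 < L, 0 <= C & forall d1, 0 < d1 -> exists d (s : seq (R * R)),
    [/\ 0 < d, d < d1, forall z, z \in s -> `|z.1| <= L /\ 0 <= z.2,
      \sum_(z <- s) z.2 <= C &
      bd (a ^+ N - expsum d s * a ^+ N) eta]].
Proof.
move=> eta0; have c1 : 0 < cw p + 1 by rewrite ltr_wpDl// cw_ge0.
have e0 : 0 < eta / (2 * (cw p + 1)) by rewrite divr_gt0// mulr_gt0.
have [dl dl0 hdl] := tr e0; set e := _ / _ in e0 hdl.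
(* Chosen so that the far part of the error is Q/(2L), hence at most eta/2 once L >= Q/eta. *)
pose Q := 256 * K * (1 + dl ^- 2) * cw 2 * cw p.
have D0 : 0 <= 1 + dl ^- 2 by rewrite addr_ge0// invr_ge0 exprn_ge0// ltW.
have Q0 : 0 <= Q.
  by rewrite /Q; apply: mulr_ge0 (cw_ge0 p); apply: mulr_ge0 (cw_ge0 2); apply: mulr_ge0 => //; exact: mulr_ge0.
pose L := Q / eta + 1.
have L0 : 0 < L by rewrite ltr_wpDl// divr_ge0// ltW.
have QL : Q / L <= eta.
  rewrite ler_pdivrMr// /L mulrDr mulr1 mulrC divfK ?gt_eqF//.
  by rewrite lerDl ltW.
exists L, (4 * L); split => //; first by rewrite mulr_ge0// ltW.
(* Half of the minimum is both below d1 and at most L/2, the range allowed for the damping. *)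
move=> d1 d10; pose d := Num.min d1 L / 2.
have m0 : 0 < Num.min d1 L by rewrite lt_min d10.
have d0 : 0 < d by rewrite divr_gt0.
have dL : d <= L / 2 by rewrite ler_wpM2r ?invr_ge0// ge_min lexx orbT.
have dd1 : d < d1.
  by apply: lt_le_trans (_ : Num.min d1 L <= _); [rewrite /d; lra|rewrite ge_min lexx].
have [s [k [Mk [hk hs sC ks kt]]]] := fejer_kernel L0 dl0 d0 dL.
exists d, s; split => //.
apply: (bdW _ (bd_approx (U := expsum d s) iN _ _ hk K0 (ltW e0) aK hdl kt)).
- have -> : 2 * K * (64 * (1 + dl ^- 2) * cw 2 / L) * cw p = Q / L / 2.
    by rewrite /Q; field; rewrite !gt_eqF.
  have : e * cw p <= eta / 2.
    have -> : eta / 2 = e * (cw p + 1) by rewrite /e; field; rewrite gt_eqF.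
    by rewrite ler_wpM2l ?lerDl// ltW.
  lra.
- exact: inW0_expsum.
- by move=> t x; rewrite ker_expsum// ks.
Qed.

Lemma approx_unit_alg :
  approx_unit (@bd R X p p1) (sc X p1) (gP X p1) (gM X p1) a N.
Proof. exact: approx_pointwise. Qed.

Lemma exprc n : (a : A^c) ^+ n = a ^+ n :> A.
Proof. by elim: n => [|n IH] //; rewrite exprS exprSr -IH. Qed.

Lemma approx_unit_conv :
  @approx_unit R A^c (@bd R X p p1) (sc X p1) (gP X p1) (gM X p1) a N.
Proof.
move=> eta eta0; have [L [C [L0 C0 h]]] := approx_pointwise eta0.
exists L, C; split => // d1 d10; have [d [s [d0 dd1 hs sC hb]]] := h d1 d10.
exists d, s; split => //; rewrite exprc.
have cM (u v : A) : (u : A^c) * (v : A^c) = v * u :> A by [].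
suff e : (\sum_(z <- s) (sc X p1 z.2 : A^c) * (gP X p1 z.1 d + gM X p1 z.1 d)) = expsum d s :> A.
  by rewrite e cM -expsum_central.
by apply: eq_bigr => z _; rewrite cM sc_central.
Qed.

End ApproximateUnit.

(** * Translation between the hypotheses on W_X and the algebra *)

Section Translation.
Context (R : realType) (X : completeNormedModType R[i]) (p : R) (p1 : 1 < p).
Local Notation A := (alg X p1).

Lemma bounded_op_isop (B : X -> X) : is_bounded_op B -> isop B.
Proof.
move=> [Bl [C BC]]; split => //; exists `|C| => // x.
by apply: le_trans (BC x) _; rewrite ler_wpM2r ?nrm_ge0// ler_norm.
Qed.

Lemma isop_bounded_op (B : X -> X) : isop B -> is_bounded_op B.
Proof. by move=> [Bl [C _ BC]]; split => //; exists C. Qed.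

(** [Wnorm] only sees the unit ball, so x is rescaled by its norm; norm 0 is treated apart. *)
Lemma Wnorm_bound (U : R -> X -> X) (K : R) : (forall t, islin (U t)) ->
  (Wnorm p U <= K%:E)%E -> forall t x, nrm (U t x) <= K * wt p t * nrm x.
Proof.
move=> Ul UK t x.
have unit_bound y : nrm y <= 1 -> nrm (U t y) <= K * wt p t.
  move=> y1; rewrite /wt ler_pdivlMr ?powR_gt0 ?jbr_gt0// mulrC -lee_fin.
  by apply: le_trans UK; apply: ereal_sup_ubound; exists (t, y).
have [x0|x0] := eqVneq (nrm x) 0.
  by rewrite x0 mulr0 (@nrm_eq0 _ _ x) ?x0// (islin0 (Ul t)) nrm0.
have xp : 0 < nrm x by rewrite lt_def x0 nrm_ge0.
have := unit_bound ((nrm x)^-1%:C%C *: x).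
rewrite (islinZ _ _ (Ul t)) !nrmZr normfV (gtr0_norm xp) mulVf// => /(_ (lexx _)).
by rewrite mulrC ler_pdivrMr.
Qed.

Lemma Wnorm_lty (U : R -> X -> X) (K : R) : 0 <= K ->
  (forall t x, nrm (U t x) <= K * wt p t * nrm x) -> (Wnorm p U < +oo)%E.
Proof.
move=> K0 UK; apply: le_lt_trans (ltry K).
apply: ge_ereal_sup => _ [[t x] /= x1 <-]; rewrite lee_fin.
have j0 : 0 < jbr t `^ p by rewrite powR_gt0// jbr_gt0.
apply: le_trans (ler_wpM2l (ltW j0) (UK t x)) _.
rewrite /wt [leLHS](_ : _ = K * nrm x); last by field; rewrite gt_eqF.
by rewrite ler_piMr.
Qed.

Lemma inW_kern (T : R -> X -> X) : inW p T -> kern p T.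
Proof.
move=> [Tb [Tm TW]].
have Tl t : islin (T t) by case: (Tb t).
have W0 : (0 <= Wnorm p T)%E.
  apply: ereal_sup_ubound; exists (0, 0) => /=; first by rewrite nrm0.
  by rewrite (islin0 (Tl 0)) nrm0 mulr0.
have WE : Wnorm p T = (fine (Wnorm p T))%:E by rewrite fineK// ge0_fin_numE.
have TK := Wnorm_bound Tl (eq_ind _ (fun z => (z <= _)%E) (lexx _) _ (esym WE)).
split => //.
- move=> x; apply: (strongly_measurable_Lint (A := fine (Wnorm p T) * nrm x) p1 (Tm x)) => t.
  by rewrite mulrAC.
- by exists (fine (Wnorm p T)); rewrite ?fine_ge0.
Qed.

Lemma Lint_strongly_measurable (f : R -> X) : Lint f -> strongly_measurable f.
Proof.
move=> /bintP/isI_bochner [n [B [v [h1 [h2 _]]]]]; by exists n, B, v.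
Qed.

Lemma kern_inW (S : R -> X -> X) : kern p S -> inW p S.
Proof.
move=> [Sl SL [K K0 SK]]; split; last split.
- move=> t; apply: isop_bounded_op; split => //; exists (K * wt p t) => //.
  by rewrite mulr_ge0// wt_ge0.
- by move=> x; exact: Lint_strongly_measurable.
- exact: Wnorm_lty SK.
Qed.

Lemma expmiE (t l : R) : expmi t l = ei (- (l * t)).
Proof. by rewrite /expmi /ei cosN sinN mulrC. Qed.

(** Bochner integrals are unique, so any convolution power in the relational sense is the kernel of
    the power in the ring. *)
Lemma convpow_ker (a : A) (T : R -> X -> X) N U : (0 < N)%N -> inW0 a -> T = ker a ->
  is_convpow T N U -> forall t x, U t x = ker (a ^+ N) t x.
Proof.
move=> + ia ->; elim: N U => [//|[_ U _ -> t x|m IH U _ [V [hV VU]] t x]]; first by rewrite expr1.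
have hVk := IH V isT hV.
have im : inW0 (a ^+ m.+1) by rewrite exprSr; exact: inW0Mr.
rewrite exprSr kerM im ia (islin0 (kerlin _ t)) !add0r.
apply/esym/bintE; have := bochner_isI (VU t x).
by congr isI; apply/funext => s.
Qed.

Lemma translation_bound (U : R -> X -> X) : (forall t, islin (U t)) ->
  (fun d : R => Wnorm p (fun t x => U t x - U (t - d) x)) @ 0^' --> (0 : \bar R) ->
  forall e, 0 < e -> exists2 dl, 0 < dl & forall s t x, `|s| < dl ->
    nrm (U t x - U (t - s) x) <= e * wt p t * nrm x.
Proof.
move=> Ul h e e0.
have hn : nbhs (0 : \bar R) [set y : \bar R | (y < e%:E)%E].
  by apply: open_nbhs_nbhs; split; [exact: open_ereal_lt_ereal|rewrite /= lte_fin].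
have := h _ hn; rewrite /= => -[dl dl0 hdl]; exists dl => // s t x sd.
(* The limit is taken over a punctured neighbourhood and says nothing at s = 0, where the difference
   is 0. *)
have [->|s0] := eqVneq s 0.
  by rewrite subr0 subrr nrm0 !mulr_ge0 ?wt_ge0 ?nrm_ge0// ltW.
apply: (@Wnorm_bound (fun t x => U t x - U (t - s) x) e).
  by move=> u c y z; rewrite !Ul scalerBr; zmod.
apply/ltW/hdl => //=; by rewrite sub0r normrN.
Qed.

End Translation.

Theorem mainTheorem10 (R : realType) (X : completeNormedModType R[i])
  (p : R) (T : R -> X -> X) (N : nat) :
  1 < p ->
  inW p T ->
  (1 <= N)%N ->
  (exists TN : R -> X -> X, is_convpow T N TN /\
     (fun d : R => Wnorm p (fun t x => TN t x - TN (t - d) x))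
       @ 0^' --> (0 : \bar R)) ->
  (forall lam : R, exists F : X -> X,
     is_fourier T lam F /\ invertible_op (fun x => x + F x)) ->
  exists S : R -> X -> X, inW p S /\
    exists U1 U2 : R -> X -> X, is_conv T S U1 /\ is_conv S T U2 /\
      (forall t x, T t x + S t x + U1 t x = 0) /\
      (forall t x, S t x + T t x + U2 t x = 0).
Proof.
move=> p1 WT N1 [TN [hTN trTN]] hF.
have kT := inW_kern p1 WT.
have [K [K0 bT _ _ TK]] := kernP p1 kT.
pose a : alg X p1 := Alg p1 (isop0 X) kT.
have ia : inW0 a by [].
have TNE := @convpow_ker R X p p1 a T N TN N1 ia erefl hTN.
have iN : inW0 (a ^+ N) by case: N N1 {hTN TNE} => // n _; rewrite exprS; exact: inW0Ml.
have [KN [KN0 _ _ _ aKN]] := kernP p1 (kerP (a ^+ N)).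
have eTN : TN = ker (a ^+ N) by apply/funext => t; apply/funext => x.
have tr := translation_bound (kerlin (a ^+ N)).
rewrite eTN in trTN; have {}tr := tr _ trTN.
have [F HF] := choice hF.
have aF l x : isI (fun t => ei (- (l * t)) *: ker a t x) (F l x).
  have := bochner_isI ((HF l).1 x); congr isI; apply/funext => t.
  by rewrite expmiE.
have invF l : exists2 G, isop G & (forall x, G (x + F l x) = x) /\ (forall x, G x + F l (G x) = x).
  have [_ [_ [G [Gb [G1 G2]]]]] := HF l.
  by exists G => //; exact: bounded_op_isop.
have [B hB] := left_invertible (alg_frame X p1) ia N1 (parametrix_alg ia K0 TK aF invF)
  (approx_unit_alg iN KN0 aKN tr).
have [B'' hB''] := left_invertible (alg_frame_conv X p1) ia N1 (parametrix_conv ia K0 TK aF invF)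
  (approx_unit_conv iN KN0 aKN tr).
pose B' : alg X p1 := B''.
have hB' : (1 + a) * B' = 1 by exact: hB''.
have BB : B' = B by have := mulrA B (1 + a) B'; rewrite hB hB' mul1r mulr1.
(* Comparing multiples of delta_0 in B(1 + a) = 1 shows that B is 1 plus its kernel; that kernel is
   the required S. *)
rewrite BB in hB'; have oB x : op B x = x.
  by have := congr1 (fun b => op b x) hB; rewrite /= addr0.
exists (ker B); split; first exact: kern_inW (kerP B).
have [KB [_ bB _ _ _]] := kernP p1 (kerP B).
exists (fun t x => conv T (ker B ^~ x) t), (fun t x => conv (ker B) (T^~ x) t); split; [|split; [|split]].
- by move=> t x; apply: isI_bochner; exact: convP bT (kerLint B x).
- by move=> t x; apply: isI_bochner; exact: convP bB (kerLint a x).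
- move=> t x; have := congr1 (fun b => ker b t x) hB'.
  by rewrite mulrDl mul1r kerD kerM /= oB add0r => <-; zmod.
- move=> t x; have := congr1 (fun b => ker b t x) hB.
  rewrite mulrDr mulr1 kerD kerM /= oB (islin0 (kerlin B t)) addr0 => <-; zmod.
Qed.
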